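(* Assume $\mathbf{(C_{0,1})}$, $\mathbf{(C_1)}$, $\mathbf{(C_2)}$ and $\mathbf{(C_{3,\varepsilon})}$ with $\varepsilon\in(-\infty,1)$ (all defined in the context). Then, almost surely, for every bounded $Sk$-continuous functional $F:\mathbb{D}(\mathbb{R}_+,\mathbb{R}^d)\to\mathbb{R}$, $$\nu^{(n)}(\omega,F)\xrightarrow[n\to+\infty]{}\int F(\alpha)\,\mathbb{P}_{\nu_0}(\mathrm{d}\alpha),\qquad (\ast)$$ where $\mathbb{P}_{\nu_0}$ denotes the stationary distribution of $(X_t)$, i.e. the law of $(X_t)$ with initial law $\nu_0$. Furthermore, for every $T>0$ and every non-bounded $Sk$-continuous functional $F:\mathbb{D}(\mathbb{R}_+,\mathbb{R}^d)\to\mathbb{R}$, the convergence $(\ast)$ holds a.s. with $F$ replaced by $F_T$, if there exist $\mathcal{V}\in\mathcal{K}(\varepsilon)$, $\rho\in[0,1)$ and a constant $C$ such that $$|F_T(\alpha)|\le C\sup_{0\le t\le T}\mathcal{V}^{\rho}(\alpha_t)\qquad\forall\,\alpha\in\mathbb{D}(\mathbb{R}_+,\mathbb{R}^d).$$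
   Context: Process and scheme. $(X_t)_{t\ge0}$ is an $\mathbb{R}^d$-valued cadlag Feller Markov process; $X^x=(X^x_t)_{t\ge 0}$ denotes the process started at $x\in\mathbb{R}^d$. $(\gamma_n)_{n\ge1}$ is a non-increasing sequence of positive steps with $\gamma_n\to0$ and $\Gamma_n:=\sum_{k=1}^n\gamma_k\to+\infty$, $\Gamma_0:=0$. $(\bar X_t)_{t\ge0}$ is a stepwise constant time discretization scheme: $\bar X_0=x_0\in\mathbb{R}^d$ and $\bar X_t=\bar X_{\Gamma_n}$ for $t\in[\Gamma_n,\Gamma_{n+1})$. The shifted processes are $\bar X^{(k)}_t:=\bar X_{\Gamma_k+t}$, $k\ge0$. $(\eta_n)_{n\ge1}$ is a sequence of positive weights with $H_n:=\sum_{k=1}^n\eta_k\to+\infty$. Empirical measures. $\nu^{(n)}(\omega,\mathrm{d}\alpha)=\frac1{H_n}\sum_{k=1}^n\eta_k\mathbf{1}_{\{\bar X^{(k-1)}(\omega)\in\mathrm{d}\alpha\}}$ is a random probability on the space $\mathbb{D}(\mathbb{R}_+,\mathbb{R}^d)$ of cadlag functions endowed with the Skorokhod topology, and $\nu^{(n)}_t(\omega,\mathrm{d}x)=\frac1{H_n}\sum_{k=1}^n\eta_k\mathbf{1}_{\{\bar X^{(k-1)}_t(\omega)\in\mathrm{d}x\}}$, $t\ge 0$, are its marginals on $\mathbb{R}^d$. For a measure $\mu$ and a function $f$, $\mu(f)=\int f\,\mathrm{d}\mu$. A functional is $Sk$-continuous if it is continuous for the Skorokhod topology. For a functional $F$ on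 $\mathbb{D}(\mathbb{R}_+,\mathbb{R}^d)$ and $T>0$, $F_T(\alpha):=F(\alpha^T)$ with $\alpha^T(t)=\alpha(t\wedge T)$. Assumptions. - $\mathbf{(C_{0,1})}$: $(X_t)$ admits a unique invariant distribution $\nu_0$ and, a.s., $\nu^{(n)}_0(\omega,\mathrm{d}x)$ converges weakly to $\nu_0$. - $\mathbf{(C_1)}$: for every $x_0\in\mathbb{R}^d$, $\epsilon>0$, $T>0$, $\limsup_{x\to x_0}\mathbb{P}(\sup_{0\le t\le T}|X^x_t-X^{x_0}_t|\ge\epsilon)=0$. - $\mathbf{(C_2)}$: $(\bar X_t)$ is a non-homogeneous Markov process and for every $n\ge0$ one can construct a family of stochastic processes $(Y^{(n,x)}_t)_{t\ge 0}$, $x\in\mathbb{R}^d$, such that (i) the law of $Y^{(n,x)}$ on $\mathbb{D}(\mathbb{R}_+,\mathbb{R}^d)$ is the conditional law $\mathcal{L}(\bar X^{(n)}\mid\bar X^{(n)}_0=x)$; (ii) for every compact $K\subset\mathbb{R}^d$ and every $T\ge0$, $\sup_{x\in K}\sup_{0\le t\le T}|Y^{(n,x)}_t-X^x_t|\to0$ in probability as $n\to+\infty$. - $\mathbf{(C_{3,\varepsilon})}$: there is a constant $C$ such that $\eta_n\le C\gamma_nH_n^{\varepsilon}$ for every $n\ge1$. The class $\mathcal{K}(\varepsilon)$. Set $N(n,T):=\max\{k\ge0:\Gamma_k-\Gamma_n\le T\}$ and $\Delta N(k,T):=N(k,T)-N(k-1,T)$. A function $\mathcal{V}:\mathbb{R}^d\to\mathbb{R}_+$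 satisfies $\mathbf{H(s,\varepsilon)}$ if for every $T>0$: (i) $\sup_{n\ge1}\mathbb{E}[\sup_{0\le t\le T}\mathcal{V}^s(Y^{(n,x)}_t)]\le C_T\mathcal{V}^s(x)$ for all $x$, where $T\mapsto C_T$ is locally bounded on $\mathbb{R}_+$; (ii) $\sup_{n\ge1}\nu^{(n)}_0(\mathcal{V})<+\infty$ a.s.; (iii) $\sum_{k\ge1}\frac{\eta_k}{H_k^2}\mathbb{E}[\mathcal{V}^2(\bar X_{\Gamma_{k-1}})]<+\infty$; (iv) $\sum_{k\ge1}\frac{\Delta N(k,T)}{H_k^s}\mathbb{E}[\mathcal{V}^{s(1-\varepsilon)}(\bar X_{\Gamma_{k-1}})]<+\infty$. Then $\mathcal{K}(\varepsilon)$ is the set of continuous $\mathcal{V}:\mathbb{R}^d\to\mathbb{R}_+$ satisfying $\mathbf{H(s,\varepsilon)}$ for some $s\ge2$. *)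

(* Defs.v *)
From HB Require Import structures.
From mathcomp Require Import all_boot all_order all_algebra.
From mathcomp Require Import all_classical all_reals all_analysis.
From mathcomp Require Import measurable_realfun.

Set Implicit Arguments.
Unset Strict Implicit.
Unset Printing Implicit Defensive.

Import Order.TTheory GRing.Theory Num.Def Num.Theory.
Import numFieldNormedType.Exports.

Local Open Scope classical_set_scope.
Local Open Scope ring_scope.

(* R^d is 'rV[R]_d with its library (sup) norm and the Borel sigma-algebra. *)
HB.instance Definition _ (R : realType) (d : nat) :=
  @isMeasurable.Build (sigma_display (@open 'rV[R]_d)) 'rV[R]_d
    <<s @open 'rV[R]_d >> (@sigma_algebra0 _ setT _) (@sigma_algebraC _ _)
    (@sigma_algebra_bigcup _ setT _).

(* A cadlag function on R_+ is represented by its unique extension to R that is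
   constant on the negative half-line, so that Leibniz equality of two elements
   is equality of the functions on R_+. *)
Record cadlag (R : realType) (d : nat) := Cadlag {
  path :> R -> 'rV[R]_d;
  path_neg : forall t, t <= 0 -> path t = path 0;
  path_right_continuous : forall t, path x @[x --> t^'+] --> path t;
  path_left_limit : forall t, cvg (path x @[x --> t^'-])
}.

HB.instance Definition _ (R : realType) (d : nat) := gen_eqMixin (cadlag R d).
HB.instance Definition _ (R : realType) (d : nat) :=
  gen_choiceMixin (cadlag R d).

Section cadlag_operations.
Context {R : realType} {d : nat}.

Definition cadlag_cst (x : 'rV[R]_d) : cadlag R d.
Proof.
by apply: (@Cadlag _ _ (cst x)) => // t; [exact: cvg_cst|exact: is_cvg_cst].
Defined.

Lemma path_comp_right (a : cadlag R d) (phi : R -> R) :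
  {homo phi : s t / s <= t} -> continuous phi ->
  forall t, a (phi x) @[x --> t^'+] --> a (phi t).
Proof.
move=> phi_nd phi_cont t U Ut.
have /= [e /= e0 He] := @path_right_continuous _ _ a (phi t) U Ut.
have : \forall x \near t, ball (phi t) e (phi x).
  by apply: phi_cont; exact: nbhsx_ballx.
move=> [e' /= e'0 He']; exists e' => //= x tx xt.
have := phi_nd _ _ (ltW xt); rewrite le_eqVlt => /predU1P[<-|lt].
  exact: nbhs_singleton Ut.
by apply: He => //; exact: He'.
Qed.

Lemma path_comp_left (a : cadlag R d) (phi : R -> R) :
  {homo phi : s t / s <= t} -> continuous phi ->
  forall t, cvg (a (phi x) @[x --> t^'-]).
Proof.
move=> phi_nd phi_cont t.
have [[x0 [x0t ex]]|H] := pselect (exists x, x < t /\ phi x = phi t).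
  apply/cvg_ex; exists (a (phi t)) => U Ut.
  have : \forall x \near t^'-, x0 < x by exact: nbhs_left_gt.
  move=> N; have : \forall x \near t^'-, x < t by exact: nbhs_left_lt.
  move=> M; apply: filterS2 N M => x x0x xt /=.
  suff -> : phi x = phi t by exact: nbhs_singleton Ut.
  apply/le_anti/andP; split; first by apply: phi_nd; exact: ltW.
  by rewrite -ex; apply: phi_nd; exact: ltW.
have /cvg_ex [l al] := @path_left_limit _ _ a (phi t).
apply/cvg_ex; exists l => U Ul.
have /= [e /= e0 He] := al U Ul.
have : \forall x \near t, ball (phi t) e (phi x).
  by apply: phi_cont; exact: nbhsx_ballx.
move=> [e' /= e'0 He']; exists e' => //= x tx xt.
apply: He; first exact: He'.
rewrite lt_neqAle phi_nd 1?ltW// andbT; apply/eqP => E.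
by apply: H; exists x.
Qed.

Definition cadlag_comp (a : cadlag R d) (phi : R -> R)
    (phi_neg : forall t, t <= 0 -> a (phi t) = a (phi 0))
    (phi_nd : {homo phi : s t / s <= t}) (phi_cont : continuous phi) :
  cadlag R d :=
  @Cadlag R d (a \o phi) phi_neg (path_comp_right phi_nd phi_cont)
    (path_comp_left phi_nd phi_cont).

(* For t >= 0 the value at t is a (s + t). *)
Definition shift (s : R) (a : cadlag R d) : cadlag R d.
Proof.
apply: (@cadlag_comp a (fun t => s + Num.max t 0)).
- by move=> t t0; rewrite max_r// max_r.
- by move=> t u tu; rewrite lerD2l le_max2// ?lexx.
- move=> t; apply: cvgD; first exact: cvg_cst.
  by apply: (@continuous_max R R id (cst 0)); [exact: cvg_id|exact: cvg_cst].
Defined.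

Definition stop (T : R) (a : cadlag R d) : cadlag R d.
Proof.
apply: (@cadlag_comp a (fun t => Num.min t T)).
- move=> t t0; rewrite path_neg ?ge_min ?t0//.
  by rewrite [RHS]path_neg// ge_min lexx.
- by move=> t u tu; rewrite le_min2// lexx.
- move=> t.
  by apply: (@continuous_min R R id (cst T)); [exact: cvg_id|exact: cvg_cst].
Defined.

Lemma shiftE s a t : 0 <= t -> shift s a t = a (s + t).
Proof. by move=> t0; rewrite /= max_l. Qed.

Lemma stopE T a t : stop T a t = a (Num.min t T).
Proof. by []. Qed.

End cadlag_operations.

HB.instance Definition _ (R : realType) (d : nat) :=
  isPointed.Build (cadlag R d) (cadlag_cst 0).

Section skorokhod_topology.
Context {R : realType} {d : nat}.

(* An increasing bijection of R_+; it is automatically a homeomorphism. *)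
Definition time_change (lam : R -> R) :=
  set_bij `[0, +oo[%classic `[0, +oo[%classic lam /\
  {in `[0, +oo[ &, {homo lam : s t / s < t}}.

Definition sk_near (a : cadlag R d) (T e : R) : set (cadlag R d) :=
  [set b | exists lam, [/\ time_change lam,
    forall t, 0 <= t -> `|lam t - t| <= e &
    forall t, 0 <= t <= T -> `|b (lam t) - a t| <= e]].

(* The J1 topology on D(R_+, R^d). A sequence a_n converges to a in it iff there
   are time changes lam_n such that sup_(t >= 0) |lam_n t - t| -> 0 and
   sup_(0 <= t <= T) |a_n (lam_n t) - a t| -> 0 for every T, i.e. iff for all T
   and e > 0, a_n is eventually in sk_near a T e. As the topology is
   metrizable, its open sets are the sequentially open ones, which are exactly
   the following. *)
Definition sk_open (U : set (cadlag R d)) :=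
  forall a, U a -> exists T e, 0 < e /\ sk_near a T e `<=` U.

Lemma sk_near_sub a T T' e e' :
  T' <= T -> e <= e' -> sk_near a T e `<=` sk_near a T' e'.
Proof.
move=> TT ee b [lam [tc l1 l2]]; exists lam; split => //.
  by move=> t t0; exact: le_trans (l1 _ t0) ee.
move=> t /andP[t0 tT]; apply: le_trans ee.
by apply: l2; rewrite t0 (le_trans tT).
Qed.

Lemma sk_openT : sk_open setT.
Proof. by move=> a _; exists 0, 1; split. Qed.

Lemma sk_openI : setI_closed sk_open.
Proof.
move=> U V oU oV a [/oU [T [e [e0 TU]]] /oV [T' [e' [e'0 TV]]]].
exists (Num.max T T'), (Num.min e e'); split; first by rewrite lt_min e0.
move=> b ab; split.
  by apply: TU; apply: sk_near_sub ab; rewrite ?le_max ?ge_min lexx.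
by apply: TV; apply: sk_near_sub ab; rewrite ?le_max ?ge_min lexx orbT.
Qed.

Lemma sk_open_bigU (I : Type) (f : I -> set (cadlag R d)) :
  (forall i, sk_open (f i)) -> sk_open (\bigcup_i f i).
Proof.
move=> of_ a [i _ /of_ [T [e [e0 TU]]]]; exists T, e; split => //.
by move=> b /TU fb; exists i.
Qed.

End skorokhod_topology.

HB.instance Definition _ (R : realType) (d : nat) :=
  isOpenTopological.Build (cadlag R d) sk_openT sk_openI (@sk_open_bigU R d).

HB.instance Definition _ (R : realType) (d : nat) :=
  @isMeasurable.Build (sigma_display (@open (cadlag R d))) (cadlag R d)
    <<s @open (cadlag R d) >> (@sigma_algebra0 _ setT _) (@sigma_algebraC _ _)
    (@sigma_algebra_bigcup _ setT _).

Section mixture.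
Context d1 d2 (E : measurableType d1) (T : measurableType d2) (R : realType).
Variables (nu : probability E R) (k : R.-pker E ~> T).
Local Open Scope ereal_scope.

Definition mixture (A : set T) : \bar R := \int[nu]_x k x A.

Let mixture0 : mixture set0 = 0.
Proof. by rewrite /mixture; apply: integral0_eq => x _; rewrite measure0. Qed.

Let mixture_ge0 A : 0 <= mixture A.
Proof. by apply: integral_ge0 => x _; exact: measure_ge0. Qed.

Let mixture_sigma_additive : semi_sigma_additive mixture.
Proof.
move=> F mF tF mUF; rewrite [X in _ --> X](_ : _ =
    \sum_(n <oo) mixture (F n)); last first.
  rewrite /mixture -integral_nneseries//.
  - by apply: eq_integral => x _; rewrite measure_semi_bigcup.
  - by move=> n; exact: measurable_kernel.
by apply: is_cvg_ereal_nneg_natsum => n _; exact: mixture_ge0.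
Qed.

HB.instance Definition _ := isMeasure.Build _ _ _ mixture
  mixture0 mixture_ge0 mixture_sigma_additive.

Let mixture_setT : mixture [set: T] = 1.
Proof.
rewrite /mixture (eq_integral (cst 1)); last by move=> x _; rewrite prob_kernel.
by rewrite integral_cst// mul1e; exact: probability_setT.
Qed.

HB.instance Definition _ :=
  Measure_isProbability.Build _ _ _ mixture mixture_setT.

End mixture.

Section markov.
Context {R : realType} {d : nat}.
Local Notation E := 'rV[R]_d.
Local Notation D := (cadlag R d).
Local Open Scope ereal_scope.

(* The sigma-algebra generated by the coordinates a_u, 0 <= u <= s. *)
Definition past (s : R) : set_system D :=
  <<s [set A : set D | exists (u : R) (B : set E), [/\ (0 <= u <= s)%R, measurable B &
                                       A = [set a : D | B (a u)]]] >>.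

Variable Px : R.-pker E ~> D.

Definition transition (t : R) (x : E) (B : set E) : \bar R :=
  Px x [set a | B (a t)].

(* Px x is the law on D(R_+, R^d) of the process started at x. *)
Definition markov_family :=
  (forall x, Px x [set a | a 0%R = x] = 1) /\
  forall x (s t : R), (0 <= s)%R -> (0 <= t)%R ->
  forall A B, past s A -> measurable B ->
    Px x (A `&` [set a | B (a (s + t)%R)]) =
    \int[Px x]_(a in A) transition t (a s) B.

(* The semigroup preserves bounded continuous functions. Since Px x has total
   mass 1, this also covers semigroups that preserve the continuous functions
   vanishing at infinity; P_t f -> f pointwise as t -> 0 is automatic, the paths
   being right-continuous. *)
Definition feller :=
  forall (t : R) (f : E -> R), (0 <= t)%R -> continuous f -> bounded_fun f ->
    continuous (fun x => \int[Px x]_a f (a t))%R.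

Definition invariant (nu : probability E R) :=
  forall (t : R) (B : set E), (0 <= t)%R -> measurable B ->
    \int[nu]_x transition t x B = nu B.

Definition unique_invariant (nu : probability E R) :=
  invariant nu /\
  forall mu : probability E R, invariant mu ->
    forall B, measurable B -> mu B = nu B.

(* The law of the process with initial law nu. *)
Definition path_law (nu : probability E R) : probability D R := mixture nu Px.

End markov.

Section processes.
Context {R : realType} {d : nat}.
Local Notation E := 'rV[R]_d.
Local Notation D := (cadlag R d).
Context {dO : measure_display} {Omega : measurableType dO}.
Variable P : probability Omega R.
Local Open Scope ereal_scope.

Definition sup_on (T : R) (f : R -> R) : \bar R :=
  ereal_sup [set (f t)%:E | t in `[0%R, T]%classic].

(* h (Z s) is a version of P(Z t \in B | sigma(Z u, u <= s)). *)
Definition nonhomogeneous_markov (Z : {RV P >-> D}) :=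
  forall (s t : R) (B : set E), (0 <= s <= t)%R -> measurable B ->
  exists h : E -> R, [/\ measurable_fun setT h, forall x, (0 <= h x)%R &
    forall A, past s A ->
      P (Z @^-1` A `&` [set w | B (Z w t)]) =
      \int[P]_(w in Z @^-1` A) (h (Z w s))%:E].

(* x |-> Q x is a (regular) conditional law of U given Z = x. *)
Definition conditional_law (d1 d2 : measure_display) (S : measurableType d1)
    (S' : measurableType d2) (U : Omega -> S) (Z : Omega -> S')
    (Q : S' -> set S -> \bar R) :=
  (forall A, measurable A -> measurable_fun setT (Q ^~ A)) /\
  forall A B, measurable A -> measurable B ->
    P (U @^-1` A `&` Z @^-1` B) = \int[P]_(w in Z @^-1` B) Q (Z w) A.

Definition C1 (X : E -> {RV P >-> D}) :=
  forall (x0 : E) (e T : R), (0 < e)%R -> (0 < T)%R ->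
    limf_esup (fun x => P [set w |
      e%:E <= sup_on T (fun t => `|X x w t - X x0 w t|%R)]) (nbhs x0) = 0.

(* The supremum over the uncountable set K need not be a random variable, so
   convergence in probability is expressed with the outer measure of P, which
   coincides with P on measurable sets. *)
Definition C2_ii (X : E -> {RV P >-> D}) (Y : nat -> E -> {RV P >-> D}) :=
  forall (K : set E) (T : R), compact K -> (0 <= T)%R ->
  forall e : R, (0 < e)%R ->
    mu_ext P [set w | e%:E <= ereal_sup
      [set sup_on T (fun t => `|Y n x w t - X x w t|%R) | x in K]]
    @[n --> \oo] --> 0.

End processes.

Section scheme.
Context {R : realType}.
Local Open Scope ereal_scope.

(* Sequences indexed by n >= 1: the value at 0 is never used. *)
Definition psum (u : nat -> {posnum R}) (n : nat) : R :=
  (\sum_(1 <= k < n.+1) (u k)%:num)%R.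

Lemma psumV_ge0 u n : (0 <= (psum u n)^-1)%R.
Proof. by rewrite invr_ge0; apply: sumr_ge0. Qed.

Definition steps (gamma : nat -> {posnum R}) :=
  [/\ forall n, (1 <= n)%N -> ((gamma n.+1)%:num <= (gamma n)%:num)%R,
      ((gamma n)%:num @[n --> \oo] --> (0 : R))%R &
      (psum gamma n @[n --> \oo] --> +oo)%R].

(* 1 / H_n * \sum_(1 <= k <= n) eta_k \d_(Z (k - 1)) *)
Definition empirical (dT : measure_display) (T : measurableType dT)
    (eta : nat -> {posnum R}) (Z : nat -> T) (n : nat) :
    {measure set T -> \bar R} :=
  mscale (NngNum (psumV_ge0 eta n))
    (msum (fun k => mscale ((eta k.+1)%:num%:nng)%R (dirac (Z k))) n).

Definition C3 (gamma eta : nat -> {posnum R}) (eps : R) :=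
  exists C : R, forall n, (1 <= n)%N ->
    ((eta n)%:num <= C * (gamma n)%:num * psum eta n `^ eps)%R.

Definition mcvg (dT : measure_display) (T : measurableType dT)
    (mu_ : nat -> {measure set T -> \bar R}) (mu : {measure set T -> \bar R})
    (f : T -> R) :=
  \int[mu_ n]_x (f x)%:E @[n --> \oo] --> \int[mu]_x (f x)%:E.

Definition is_max (A : set nat) (m : nat) := A m /\ forall k, A k -> (k <= m)%N.

Definition stepN (gamma : nat -> {posnum R}) (n : nat) (T : R) : nat :=
  xget 0%N (is_max [set k | (psum gamma k - psum gamma n <= T)%R]).

Definition deltaN (gamma : nat -> {posnum R}) (k : nat) (T : R) : R :=
  ((stepN gamma k T)%:R - (stepN gamma k.-1 T)%:R)%R.

Context {d : nat}.
Local Notation E := 'rV[R]_d.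
Local Notation D := (cadlag R d).

Definition stepwise_constant (gamma : nat -> {posnum R}) (a : D) :=
  forall n t, (psum gamma n <= t < psum gamma n.+1)%R -> a t = a (psum gamma n).

Definition shifted (gamma : nat -> {posnum R}) (a : D) (k : nat) : D :=
  shift (psum gamma k) a.

Definition nu_path (gamma eta : nat -> {posnum R}) (n : nat) (a : D) :=
  empirical eta (shifted gamma a) n.

Definition nu_marg (gamma eta : nat -> {posnum R}) (t : R) (n : nat) (a : D) :=
  empirical eta (fun k => shifted gamma a k t) n.

Definition weak_cvg (mu_ : nat -> {measure set E -> \bar R})
    (mu : {measure set E -> \bar R}) :=
  forall f : E -> R, continuous f -> bounded_fun f -> mcvg mu_ mu f.

Context {dO dO' : measure_display} {Omega : measurableType dO}
  {Omega' : measurableType dO'}.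
Variables (P : probability Omega R) (P' : probability Omega' R).

Definition C01 (Px : R.-pker E ~> D) (gamma eta : nat -> {posnum R})
    (Xbar : {RV P >-> D}) (nu0 : probability E R) :=
  unique_invariant Px nu0 /\
  {ae P, forall w, weak_cvg (fun n => nu_marg gamma eta 0 n (Xbar w)) nu0}.

Definition C2 (gamma : nat -> {posnum R}) (Xbar : {RV P >-> D})
    (X : E -> {RV P' >-> D}) (Y : nat -> E -> {RV P' >-> D}) :=
  [/\ nonhomogeneous_markov Xbar,
      forall n, conditional_law P
        (fun w => shifted gamma (Xbar w) n)
        (fun w => shifted gamma (Xbar w) n 0%R)
        (fun x => distribution P' (Y n x)) &
      C2_ii X Y].

Definition H_cond (gamma eta : nat -> {posnum R}) (Xbar : {RV P >-> D})
    (Y : nat -> E -> {RV P' >-> D}) (s eps : R) (V : E -> R) :=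
  [/\ exists C : R -> R,
        (forall M : R, exists B : R, forall T, (0 <= T <= M -> `|C T| <= B)%R) /\
        forall T, (0 < T)%R -> forall x,
          ereal_sup [set \int[P']_w sup_on T (fun t => V (Y n x w t) `^ s)%R
                    | n in [set n | (1 <= n)%N]] <= (C T * V x `^ s)%:E,
      {ae P, forall w,
        ereal_sup [set \int[nu_marg gamma eta 0 n (Xbar w)]_x (V x)%:E
                  | n in [set n | (1 <= n)%N]] < +oo},
      \sum_(1 <= k <oo) ((eta k)%:num / psum eta k ^+ 2)%:E *
        \int[P]_w (V (Xbar w (psum gamma k.-1)) ^+ 2)%:E < +oo &
      forall T, (0 < T)%R ->
      \sum_(1 <= k <oo) (deltaN gamma k T / psum eta k `^ s)%:E *
        \int[P]_w (V (Xbar w (psum gamma k.-1)) `^ (s * (1 - eps)))%:E < +oo].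

Definition class_K (gamma eta : nat -> {posnum R}) (Xbar : {RV P >-> D})
    (Y : nat -> E -> {RV P' >-> D}) (eps : R) : set (E -> R) :=
  [set V : E -> R | [/\ continuous V, forall x, (0 <= V x)%R &
    exists2 s : R, (2 <= s)%R & H_cond gamma eta Xbar Y s eps V]].

End scheme.

(* Main.v *)
From HB Require Import structures.
Require Import Defs.
From mathcomp Require Import all_boot all_order all_algebra.
From mathcomp Require Import all_classical all_reals all_analysis.
From mathcomp Require Import measurable_realfun.
From mathcomp Require Import ring lra.

Set Implicit Arguments.
Unset Strict Implicit.
Unset Printing Implicit Defensive.

Import Order.TTheory GRing.Theory Num.Def Num.Theory.
Import numFieldNormedType.Exports.

Local Open Scope classical_set_scope.
Local Open Scope ring_scope.

(** The empirical measure of the shifted schemes integrates a functional [F] to the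
    weighted average of the values [F (Z k)], where [Z k] is the scheme seen from its
    [k]-th step on. Suppose first that [F] is bounded and depends on the path up to some
    time [S] only. Such an average is compared with the average of the conditional means
    [cond F k (Z k 0)], the integrals of [F] over the auxiliary process [Y k] started at
    the present value of the scheme.

    The deviations [F (Z k) - cond F k (Z k 0)] are orthogonal as soon as two indices are
    more than a time [S] apart. Since [eta <= K * gamma * H ^ e] with [e < 1], few pairs
    of indices are closer, and the average up to [n] has a second moment of order
    [H n ^ (e - 1)] ([dev_avg_L2]). This is summable along sparse times, at which [H]
    grows polynomially; as sums of nonnegative terms are monotone, convergence along
    these times is convergence ([sparse_times], [avg_interp]).

    The conditional means converge, uniformly on balls, to [x |-> E F (X x)], and this
    limit is continuous ([cond_uniform], [Phi_continuous]). Both facts come from paths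
    that are uniformly close with large probability, a mode of convergence for which
    stopping a path is harmless, although it is not Skorokhod continuous. The weak
    convergence of the marginals to [nu0] then identifies the limit of the averages as
    the mean of [F] under [nu0] followed by the law of the process ([stopped_cvg]).

    To have one null set for all bounded continuous functionals, a countable family of
    test functionals is used. The function [warp_dist b T] is the distance to a fixed
    step function [b], up to a change of time, on a finite horizon; it is continuous for
    the Skorokhod topology and depends on the path up to time [T + 1]. The balls around
    rational step functions form a base of the topology, so that a nonnegative
    continuous functional is the increasing limit of finite maxima of bumps
    ([test_approx]). A functional and its opposite, both shifted to be nonnegative, give
    the two inequalities of the limit ([test_determining], [bounded_cvg]). The same
    functions show that the Borel sets of the path space are generated by the coordinates
    ([borel_coordinates]), which gives the Markov property of the scheme for all
    functionals of the future ([scheme_markov]).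

    For an unbounded functional, convergence follows from that of the truncations as soon
    as the averages of some power of order greater than 1 stay bounded
    ([uniformly_integrable_cvg]). The domination by [V ^ rho] with [rho < 1] leaves room
    for an exponent [r > 1] such that the conditional means of [|F| ^ r] are at most
    linear in [V] ([powR_dominated]), and the averages of [V] are bounded. To transfer
    this to the path itself, a further exponent [k < 1] is lost: [L ^ k] is at most
    [1 + min L b + b ^ (k - 1) * L], where the level [b] is a small power of the total
    weight. The middle term has small fluctuations, and the last one is small in mean
    ([moment_bound], [dominated_cvg]). *)

(** * Time changes *)

Section time_changes.
Context {R : realType}.
Implicit Types lam mu : R -> R.

Lemma time_change_ge0 lam t : time_change lam -> 0 <= t -> 0 <= lam t.
Proof.
move=> [[lf _ _] _] t0; have := lf t.
by rewrite /= !in_itv /= !andbT; apply.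
Qed.

Lemma time_change_cancel lam mu :
  (forall t, 0 <= t -> 0 <= lam t) -> (forall t, 0 <= t -> 0 <= mu t) ->
  (forall t, 0 <= t -> mu (lam t) = t) ->
  (forall t, 0 <= t -> lam (mu t) = t) ->
  (forall s t, 0 <= s -> s < t -> lam s < lam t) -> time_change lam.
Proof.
move=> l0 m0 ml lm linc; split; first split.
- by move=> t /=; rewrite !in_itv /= !andbT; exact: l0.
- move=> s t; rewrite !inE /= ?in_itv /= ?andbT => s0 t0 st.
  by rewrite -(ml s)// st ml.
- move=> t /=; rewrite in_itv /= andbT => t0; exists (mu t); last exact: lm.
  by rewrite /= in_itv /= andbT m0.
- move=> s t; rewrite !in_itv /= !andbT => s0 _; exact: linc.
Qed.

Lemma time_change_lt lam s t :
  time_change lam -> 0 <= s -> s < t -> lam s < lam t.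
Proof.
move=> [_ li] s0 st; have t0 : 0 <= t by rewrite (le_trans s0) 1?ltW.
by apply: li => //; rewrite in_itv /= andbT.
Qed.

Lemma time_change_inv lam : time_change lam ->
  exists mu, [/\ time_change mu, forall t, 0 <= t -> mu (lam t) = t &
    forall t, 0 <= t -> lam (mu t) = t].
Proof.
move=> tcl; have [[lf lj ls] li] := tcl.
have ex t : exists s, 0 <= t -> 0 <= s /\ lam s = t.
  have [t0|t0] := leP 0 t; last by exists 0.
  have [|s s0 st] := ls t; first by rewrite /= in_itv /= andbT.
  by exists s => _; split => //; move: s0; rewrite /= in_itv /= andbT.
have [mu muP] := choice ex; exists mu.
have m0 t : 0 <= t -> 0 <= mu t by move=> /muP[].
have lm t : 0 <= t -> lam (mu t) = t by move=> /muP[].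
have ml t : 0 <= t -> mu (lam t) = t.
  move=> t0; have lt0 := time_change_ge0 tcl t0.
  by apply: lj; rewrite ?inE /= ?in_itv /= ?andbT ?m0// lm.
split => //; apply: (@time_change_cancel mu lam) => //.
  by move=> t; exact: time_change_ge0.
move=> s t s0 st; rewrite ltNge; apply/negP.
have t0 : 0 <= t by rewrite (le_trans s0) 1?ltW.
rewrite le_eqVlt => /predU1P[E|].
  by move: st; rewrite -(lm s)// -(lm t)// E ltxx.
move/(time_change_lt tcl (m0 _ t0)); rewrite !lm// => ts.
by have := lt_trans st ts; rewrite ltxx.
Qed.

Lemma time_change_id : time_change (@id R).
Proof. exact: (@time_change_cancel id id). Qed.

Lemma time_change_comp lam mu :
  time_change lam -> time_change mu -> time_change (lam \o mu).
Proof.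
move=> tl tm.
have [li [tli li1 li2]] := time_change_inv tl.
have [mi [tmi mi1 mi2]] := time_change_inv tm.
apply: (@time_change_cancel _ (mi \o li)) => [t t0|t t0|t t0|t t0|s t s0 st] /=.
- by apply: time_change_ge0 => //; exact: time_change_ge0.
- by apply: time_change_ge0 => //; exact: time_change_ge0.
- by rewrite li1 ?mi1//; exact: time_change_ge0.
- by rewrite mi2 ?li2//; exact: time_change_ge0.
- by apply: time_change_lt => //; [exact: time_change_ge0|exact: time_change_lt].
Qed.

(** Identity up to [S], affine from [[S, p]] onto [[S, S']], translation
    afterwards: composing with it straightens one more piece of a time change
    without disturbing what has been built before [S]. *)
Definition bend (S p S' : R) (u : R) : R :=
  if u <= S then u else
  if u <= p then S + (u - S) * ((S' - S) / (p - S)) else u + (S' - p).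

Lemma bend_le (S p S' u : R) : u <= S -> bend S p S' u = u.
Proof. by rewrite /bend => ->. Qed.

Lemma bend_ge (S p S' u : R) : S < p -> p <= u -> bend S p S' u = u + (S' - p).
Proof.
move=> Sp pu; rewrite /bend ifF; last first.
  by apply/negbTE; rewrite -ltNge (lt_le_trans Sp).
move: pu; rewrite le_eqVlt => /predU1P[<-|pu].
  by rewrite lexx mulrC divfK ?gt_eqF ?subr_gt0//; ring.
by rewrite ifF//; apply/negbTE; rewrite -ltNge.
Qed.

Lemma bend_cancel (S p S' u : R) : S < p -> S < S' ->
  bend S S' p (bend S p S' u) = u.
Proof.
move=> Sp SS'; rewrite {2}/bend.
have p0 : 0 < p - S by rewrite subr_gt0.
have s0 : 0 < S' - S by rewrite subr_gt0.
case: (leP u S) => uS; first by rewrite /bend uS.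
case: (leP u p) => up; rewrite /bend.
  rewrite leNgt ltrDl mulr_gt0 ?subr_gt0 ?divr_gt0//= ifT; last first.
    rewrite -lerBrDl mulrA ler_pdivrMr// mulrC ler_wpM2l ?lerD2r//.
    exact: ltW.
  by field; rewrite gt_eqF//= gt_eqF.
rewrite !ifF; first by ring.
  by apply/negbTE; rewrite -ltNge; lra.
by apply/negbTE; rewrite -ltNge; lra.
Qed.

Lemma bend_lt (S p S' u v : R) : S < p -> S < S' -> u < v ->
  bend S p S' u < bend S p S' v.
Proof.
move=> Sp SS' uv; rewrite /bend.
have p0 : 0 < p - S by rewrite subr_gt0.
have s0 : 0 < S' - S by rewrite subr_gt0.
set k := (S' - S) / (p - S).
have k0 : 0 < k by rewrite divr_gt0.
have kE : (p - S) * k = S' - S by rewrite /k mulrC divfK// gt_eqF.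
case: (leP u S) => uS; case: (leP v S) => vS //.
- case: (leP v p) => vp; last by lra.
  by rewrite (le_lt_trans uS)// ltrDl mulr_gt0// subr_gt0.
- by have := lt_le_trans uv vS; lra.
- case: (leP u p) => up; case: (leP v p) => vp; last by lra.
  + by rewrite ltrD2l ltr_pM2r// ltrD2r.
  + apply: (@le_lt_trans _ _ S'); last lra.
    by rewrite -lerBrDl -kE ler_pM2r// lerD2r.
  + by have := lt_le_trans uv vp; lra.
Qed.

Lemma time_change_bend (S p S' : R) : 0 <= S -> S < p -> S < S' ->
  time_change (bend S p S').
Proof.
move=> S0 Sp SS'.
have bge0 q q' t : S < q -> S < q' -> 0 <= t -> 0 <= bend S q q' t.
  move=> Sq Sq' t0; have [tS|tS] := leP t S; first by rewrite /bend tS.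
  by have := bend_lt Sq Sq' tS; rewrite {1}/bend lexx; lra.
apply: (@time_change_cancel _ (bend S S' p)) => *; do ?[exact: bge0|exact: bend_cancel].
exact: bend_lt.
Qed.

Lemma bend_dist (S p S' e : R) (u t : R) : S < p -> S < S' ->
  S <= u <= p -> `|S - (t - (u - S))| <= e -> `|S' - (t - (u - p))| <= e ->
  `|bend S p S' u - t| <= e.
Proof.
move=> Sp SS' /andP[Su up]; rewrite /bend.
have p0 : 0 < p - S by rewrite subr_gt0.
rewrite !ler_norml => /andP[a1 a2] /andP[b1 b2].
case: (leP u S) => uS; first by apply/andP; split; lra.
rewrite up; set k := (S' - S) / (p - S).
have kE : (p - S) * k = S' - S by rewrite /k mulrC divfK// gt_eqF.
set y := (u - S) / (p - S).
have y01 : 0 <= y <= 1.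
  by rewrite /y ler_pdivrMr// mul1r lerD2r up andbT divr_ge0 ?ltW ?subr_gt0.
have uE : u = S + y * (p - S) by rewrite /y divfK ?gt_eqF//; ring.
have -> : (u - S) * k = y * (S' - S) by rewrite -kE uE; ring.
rewrite uE in a1 a2 b1 b2.
by move: y01 => /andP[y0 y1]; apply/andP; split; nra.
Qed.

End time_changes.

(** * Comparison of paths up to a time change *)

Section near_paths.
Context {R : realType} {d : nat}.
Local Notation E := 'rV[R]_d.
Local Notation D := (cadlag R d).
Implicit Types (a b c : R -> E) (S T e : R).

(** The relation behind the Skorokhod neighbourhoods, for arbitrary functions
    of time: the first argument will also be a step function. *)
Definition warp_near a b T e := exists lam, [/\ time_change lam,
  forall t, 0 <= t -> `|lam t - t| <= e &
  forall t, 0 <= t <= T -> `|b (lam t) - a t| <= e].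

Lemma warp_near_sub a b T T' e e' :
  T' <= T -> e <= e' -> warp_near a b T e -> warp_near a b T' e'.
Proof.
move=> TT ee [lam [tc l1 l2]]; exists lam; split => //.
  by move=> t t0; exact: le_trans (l1 _ t0) ee.
by move=> t /andP[t0 tT]; apply: le_trans ee; apply: l2; rewrite t0 (le_trans tT).
Qed.

Lemma warp_near_sym a b T e : warp_near a b T e -> warp_near b a (T - e) e.
Proof.
move=> [lam [tc l1 l2]]; have [mu [tm ml lm]] := time_change_inv tc.
exists mu; split => // t.
  move=> t0; have m0 := time_change_ge0 tm t0.
  by rewrite distrC -{1}(lm _ t0); exact: l1.
move=> /andP[t0 tT]; have m0 := time_change_ge0 tm t0.
rewrite distrC -{1}(lm t t0); apply: l2; rewrite m0/=.
by have := l1 _ m0; rewrite lm// ler_norml => /andP[]; lra.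
Qed.

(** The horizon shrinks, because the second comparison is only available at
    the times reached by the first time change. *)
Lemma warp_near_trans a b c T e e' :
  warp_near a b T e -> warp_near b c (T + e) e' -> warp_near a c T (e + e').
Proof.
move=> [lam [tl l1 l2]] [mu [tm m1 m2]]; exists (mu \o lam).
split; first exact: time_change_comp.
- move=> t t0 /=; have l0 := time_change_ge0 tl t0.
  rewrite (_ : _ - t = (lam t - t) + (mu (lam t) - lam t)); last by ring.
  by rewrite (le_trans (ler_normD _ _))// lerD// ?l1// m1.
- move=> t /andP[t0 tT] /=; have l0 := time_change_ge0 tl t0.
  rewrite (_ : _ - a t = (b (lam t) - a t) + (c (mu (lam t)) - b (lam t))).
    rewrite (le_trans (ler_normD _ _))// lerD// ?l2 ?t0 ?m2// l0/=.
    by have := l1 _ t0; rewrite ler_norml => /andP[]; lra.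
  by rewrite [RHS]addrC addrA subrK.
Qed.

Lemma sup_near_warp a b T e : 0 <= e ->
  (forall t, 0 <= t <= T -> `|b t - a t| <= e) -> warp_near a b T e.
Proof.
move=> e0 H; exists id; split=> [|t t0|t tT]; first exact: time_change_id.
  by rewrite subrr normr0.
exact: H.
Qed.

End near_paths.

Section step_paths.
Context {R : realType} {d : nat}.
Local Notation E := 'rV[R]_d.
Local Notation D := (cadlag R d).

Lemma mx_norm_leP (x : E) (e : R) : 0 <= e ->
  (forall j, `|x 0 j| <= e) <-> `|x| <= e.
Proof.
move=> e0; rewrite [`|x|]/Num.norm /= mx_normrE; split => [H|H j].
  by apply/bigmax_leP; split => // -[i j] _ /=; rewrite ord1.
by apply: le_trans H; apply/bigmax_geP; right => /=; exists (0, j).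
Qed.

Lemma rat_vector_dense (x : E) (e : R) : 0 < e ->
  exists q : 'rV[rat]_d, `|x - map_mx ratr q| <= e.
Proof.
move=> e0.
have ex j : exists q : rat, `|x 0 j - ratr q| <= e.
  have [|q] := @rat_in_itvoo R (x 0 j) (x 0 j + e); first by rewrite ltrDl.
  rewrite in_itv /= => /andP[q1 q2]; exists q.
  by rewrite ler_norml; apply/andP; split; lra.
have [q qP] := choice ex; exists (\row_j q j).
by apply/(mx_norm_leP _ (ltW e0)) => j; rewrite !mxE.
Qed.

Lemma nat_ceil (x : R) : exists2 k : nat, x <= k%:R &
  forall j, (j < k)%N -> j%:R < x.
Proof.
have ex : exists k : nat, x <= k%:R.
  by exists (truncn x).+1; rewrite ltW// truncnS_gt.
case: (ex_minnP ex) => k xk kmin; exists k => // j jk.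
by rewrite ltNge; apply/negP => /kmin; rewrite leqNgt jk.
Qed.

Definition grid n (a : R -> E) (t : R) : E :=
  a ((truncn (t * n.+1%:R))%:R / n.+1%:R).

(** The time change matches a time with the mesh point just after it, so that
    the grid approximation reads the path inside the right piece. *)
Let tracked (a : D) (e S : R) := exists N, forall n, (N <= n)%N ->
  exists k lam, [/\ time_change lam, 0 <= S <= k%:R / n.+1%:R,
    forall j, (j < k)%N -> j%:R / n.+1%:R < S,
    forall t, 0 <= t -> `|lam t - t| <= e &
    (forall t, k%:R / n.+1%:R <= t -> lam t = S + (t - k%:R / n.+1%:R)) /\
    forall t, 0 <= t < k%:R / n.+1%:R -> `|a (lam t) - grid n a t| <= e].

Lemma mesh_lt (N : nat) (e : R) : 0 < e ->
  exists2 N', (N <= N')%N & forall n, (N' <= n)%N -> n.+1%:R^-1 < e.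
Proof.
move=> e0; exists (maxn N (truncn e^-1)); first exact: leq_maxl.
move=> n; rewrite geq_max => /andP[_ nt].
by rewrite invf_plt ?posrE// (lt_le_trans (truncnS_gt _))// ler_nat.
Qed.

Let tracked_extend (a : D) (e S S' : R) : 0 < e -> S < S' ->
  (forall u, S <= u < S' -> `|a u - a S| <= e / 2) ->
  tracked a e S -> tracked a e S'.
Proof.
move=> e0 SS' osc [N HN].
have [N1 NN1 HN1] := mesh_lt N e0.
have SS'0 : 0 < S' - S by rewrite subr_gt0.
have [N2 N12 HN2] := mesh_lt N1 SS'0.
exists N2 => n Nn.
have [|k [lam [tl /andP[S0 Sr] jS l1 [l2 l3]]]] := HN n.
  by rewrite (leq_trans NN1)// (leq_trans N12).
have h_e := HN1 n (leq_trans N12 Nn); have h_S := HN2 _ Nn.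
set h := n.+1%:R^-1 in Sr jS l2 l3 h_e h_S *.
have h0 : 0 < h by rewrite invr_gt0.
have hn : n.+1%:R * h = 1 by rewrite /h divff.
have rS : k%:R * h <= S + h.
  case: k {Sr l2 l3} jS => [_|k jS]; first by rewrite mul0r addr_ge0 ?(ltW h0).
  by rewrite -addn1 natrD mulrDl mul1r lerD2r ltW// jS.
have [k' k'S' j'S] := nat_ceil (S' * n.+1%:R).
have S'0 : 0 < S' by rewrite (le_lt_trans S0).
have jS' j : (j < k')%N -> j%:R * h < S'.
  by move=> /j'S; rewrite /h ltr_pdivrMr.
have r'S' : S' <= k'%:R * h by rewrite /h ler_pdivlMr.
have r'e : k'%:R * h <= S' + h.
  case: k' {k'S' j'S r'S'} jS' => [_|k' jS'].
    by rewrite mul0r addr_ge0 ?(ltW h0) ?(ltW S'0).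
  by rewrite -addn1 natrD mulrDl mul1r lerD2r ltW// jS'.
exists k', (bend S (S + (k'%:R * h - k%:R * h)) S' \o lam).
set r := k%:R * h in Sr l2 l3 rS *; set r' := k'%:R * h in r'S' r'e *.
have rr' : r < r' by lra.
set p := S + (r' - r).
have Sp : S < p by rewrite /p ltrDl subr_gt0.
have lamlt t : 0 <= t -> t < r -> lam t < S.
  move=> t0 tr; have := time_change_lt tl t0 tr.
  by rewrite (l2 _ (lexx _)) subrr addr0.
have r0 : 0 <= r by rewrite (le_trans S0).
split.
- by apply: time_change_comp => //; exact: time_change_bend.
- by rewrite r'S' (ltW S'0).
- exact: jS'.
- move=> t t0 /=; have [tr|rt] := ltP t r.
    by rewrite bend_le ?l1// ltW// lamlt.
  have [tr'|r't] := leP t r'.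
    apply: bend_dist => //.
    + by rewrite l2// /p; apply/andP; split; lra.
    + by rewrite l2// ler_norml; apply/andP; split; lra.
    + by rewrite l2// /p ler_norml; apply/andP; split; lra.
  rewrite l2// bend_ge//; last by rewrite /p; lra.
  by rewrite /p ler_norml; apply/andP; split; lra.
- split=> [t r't|t /andP[t0 tr']] /=.
    have rt : r <= t by rewrite (le_trans (ltW rr')).
    by rewrite l2// bend_ge// /p; [ring|lra].
  have [tr|rt] := ltP t r; first by rewrite bend_le ?l3 ?t0// ltW// lamlt.
  rewrite l2//; set u := S + _.
  have up : u < p by rewrite /u /p ltrD2l ltrD2r.
  have uS : S <= u by rewrite /u lerDl subr_ge0.
  have bp : bend S p S' p = S' by rewrite bend_ge// addrC subrK.
  have bS : bend S p S' S = S by rewrite bend_le.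
  have bu : S <= bend S p S' u < S'.
    have := bend_lt Sp SS' up; rewrite bp => ->; rewrite andbT.
    move: uS; rewrite le_eqVlt => /predU1P[<-|/(bend_lt Sp SS')].
      by rewrite bS.
    by rewrite bS => /ltW.
  rewrite /grid; set j := truncn _.
  have ju : S <= j%:R * h < S'.
    rewrite jS' ?andbT; last first.
      by rewrite truncn_lt_nat ?mulr_ge0//; move: tr'; rewrite ltr_pdivlMr.
    rewrite (le_trans Sr)// /r ler_pM2r// ler_nat truncn_ge_nat ?mulr_ge0//.
    by move: rt; rewrite /r /h ler_pdivrMr.
  rewrite (_ : a _ - _ = (a (bend S p S' u) - a S) + (a S - a (j%:R * h))).
    rewrite (le_trans (ler_normD _ _))// [leRHS]splitr lerD// ?osc// distrC.
    exact: osc.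
  by rewrite addrA subrK.
Qed.

(** Continuous induction on the time up to which the grid approximations follow
    the path: existing left limits let it pass to a supremum, right continuity
    lets it go beyond. *)
Let tracked_unbounded (a : D) (e T : R) : 0 < e ->
  exists2 S, T <= S & tracked a e S.
Proof.
move=> e0; apply: contrapT => noS.
have lub S : tracked a e S -> S <= T.
  by move=> H; rewrite leNgt; apply/negP => TS; apply: noS; exists S => //; exact: ltW.
pose A := [set S | tracked a e S].
have A0 : A 0.
  exists 0%N => n _; exists 0%N, id; rewrite mul0r lexx; split => //.
  - exact: time_change_id.
  - by move=> t t0; rewrite subrr normr0 ltW.
  - by split=> [t t0|t /andP[t0]]; rewrite ?add0r ?subr0// ltNge t0.
have supA : has_sup A by split; [exists 0|exists T => S; exact: lub].
pose s := sup A.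
have leS S : A S -> S <= s by move=> AS; apply: sup_upper_bound.
have As : A s.
  have e4 : 0 < e / 4 by rewrite divr_gt0.
  have /cvg_ex [l /cvgrPdist_le /(_ _ e4)] := @path_left_limit _ _ a s.
  rewrite /at_left => -[h /= h0 Hh].
  have [S AS sS] := sup_adherent h0 supA.
  have := leS _ AS; rewrite le_eqVlt => /predU1P[<-//|Ss].
  have Hu u : S <= u < s -> `|l - a u| <= e / 4.
    move=> /andP[Su us]; apply: Hh => //=; rewrite ger0_norm ?subr_ge0 1?ltW//.
    by move: sS; rewrite -/s; lra.
  apply: tracked_extend AS => // u uS.
  rewrite (_ : a u - a S = (l - a S) - (l - a u)); last first.
    by rewrite opprB [RHS]addrC addrA subrK.
  rewrite (le_trans (ler_normB _ _))//.
  have := Hu u uS; have := Hu S; rewrite lexx Ss => /(_ isT); lra.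
have e2 : 0 < e / 2 by rewrite divr_gt0.
have /cvgrPdist_le /(_ _ e2) := @path_right_continuous _ _ a s.
rewrite /at_right => -[h /= h0 Hh].
suff : A (s + h) by move/leS; rewrite leNgt ltrDl h0.
apply: tracked_extend As; rewrite ?ltrDl// => u /andP[su uh].
move: su; rewrite le_eqVlt => /predU1P[<-|su]; first by rewrite subrr normr0 ltW.
rewrite distrC; apply: Hh => //=.
by rewrite distrC gtr0_norm ?subr_gt0//; lra.
Qed.

(** Separability of the path space rests on this: a grid approximation has finitely
    many relevant values, which can be made rational. *)
Lemma grid_near (a : D) (T e : R) : 0 < e ->
  exists N, forall n, (N <= n)%N -> warp_near (grid n a) a T e.
Proof.
move=> e0; have [S TS [N HN]] := tracked_unbounded a (T + 1) e0.
exists N => n /HN [k [lam [tl /andP[S0 Sr] _ l1 [_ l3]]]].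
exists lam; split => // t /andP[t0 tT]; apply: l3; rewrite t0/=.
by rewrite (le_lt_trans tT)// (lt_le_trans _ Sr)// (lt_le_trans _ TS)// ltrDl.
Qed.

(** Step functions with rational values on a mesh: the code records the mesh and
    the values, so that there are countably many of them. *)
Definition step (c : nat * seq 'rV[rat]_d) (t : R) : E :=
  map_mx ratr (nth 0 c.2 (truncn (t * c.1.+1%:R))).

Definition records (c : nat * seq 'rV[rat]_d) (e : R) (a : R -> E) :=
  forall i, (i < size c.2)%N ->
    `|a (i%:R / c.1.+1%:R) - map_mx ratr (nth 0 c.2 i)| <= e.

Lemma records_ex (a : R -> E) (n m : nat) (e : R) : 0 < e ->
  exists2 s, size s = m & records (n, s) e a.
Proof.
move=> e0.
have [q qP] := choice (fun i : nat => rat_vector_dense (a (i%:R / n.+1%:R)) e0).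
exists (mkseq q m) => [|i /=]; first by rewrite size_mkseq.
by rewrite size_mkseq => im; rewrite nth_mkseq.
Qed.

Lemma warp_near_step (a : D) (T e e' : R) n s : 0 <= e' ->
  T * n.+1%:R < (size s)%:R ->
  records (n, s) e' a -> warp_near (grid n a) a T e ->
  warp_near (step (n, s)) a T (e + e').
Proof.
move=> e'0 Ts rec [lam [tl l1 l2]]; exists lam; split => // t tT.
  by rewrite (le_trans (l1 _ tT))// lerDl.
move: (tT) => /andP[t0 tlT].
rewrite (_ : a _ - _ = (a (lam t) - grid n a t) + (grid n a t - step (n, s) t)).
  rewrite (le_trans (ler_normD _ _))// lerD ?l2// rec//=.
  by rewrite truncn_lt_nat ?mulr_ge0// (le_lt_trans _ Ts)// ler_pM2r.
by rewrite addrA subrK.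
Qed.

Lemma step_dense (a : D) (T e : R) : 0 < e -> exists c, warp_near (step c) a T e.
Proof.
move=> e0; have e2 : 0 < e / 2 by rewrite divr_gt0.
have [N /(_ _ (leqnn _)) aN] := grid_near a T e2.
have [s ss rec] := records_ex a N (truncn (T * N.+1%:R)).+1 e2.
exists (N, s); rewrite [e]splitr; apply: warp_near_step => //; first exact: ltW.
by rewrite ss truncnS_gt.
Qed.

End step_paths.

(** * Countably many test functionals on the path space *)

Section skorokhod_continuity.
Context {R : realType} {d : nat}.
Local Notation D := (cadlag R d).

Lemma open_skP (U : set D) : open U <-> sk_open U.
Proof. by []. Qed.

Lemma sk_continuousP (f : D -> R) : continuous f <->
  forall a e, 0 < e -> exists T d', 0 < d' /\
    forall c, sk_near a T d' c -> `|f c - f a| <= e.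
Proof.
split=> [cf a e e0|H].
  have /cvgrPdist_lt/(_ _ e0) := cf a.
  rewrite nbhsE => -[U [oU Ua] HU].
  have [T [d' [d'0 sub]]] := oU _ Ua; exists T, d'; split => // c /sub /HU /=.
  by rewrite distrC => /ltW.
apply/continuousP => A oA; apply/open_skP => a Aa.
move: oA; rewrite openE => /(_ _ Aa) /nbhs_ballP[e /= e0 eA].
have [T [d' [d'0 sub]]] := H a (e / 2) (divr_gt0 e0 (ltr0n _ 2)).
exists T, d'; split => // c /sub ca; apply: eA.
by rewrite /ball /= distrC (le_lt_trans ca)// ltr_pdivrMr// ltr_pMr// ltr1n.
Qed.

(** Stopping destroys the Skorokhod continuity of [F] at paths that jump at the
    stopping time, but not its continuity for the uniform distance. *)
Lemma stop_uniform (F : D -> R) (S : R) (a : D) (e : R) :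
  continuous F -> 0 <= S -> 0 < e ->
  exists2 d', 0 < d' & forall c : D,
    (forall t, 0 <= t <= S -> `|c t - a t| <= d') ->
    `|F (stop S c) - F (stop S a)| <= e.
Proof.
move=> /sk_continuousP cF S0 e0; have [T [d' [d'0 H]]] := cF (stop S a) e e0.
exists d' => // c ca; apply: H; apply: sup_near_warp; first exact: ltW.
by move=> t /andP[t0 _]; rewrite !stopE; apply: ca; rewrite le_min t0 S0 ge_min lexx orbT.
Qed.

End skorokhod_continuity.

Section warp_distance.
Context {R : realType} {d : nat}.
Local Notation E := 'rV[R]_d.
Local Notation D := (cadlag R d).
Implicit Types (a b c : R -> E) (T e : R).

(** Distance to the fixed function [b] over [[0, T]], truncated at 1 so that time
    changes move times by at most 1. As [b] is not moved in time, this is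
    Skorokhod continuous in the path, whatever happens at the horizon [T]. *)
Definition warp_dist b T a : R :=
  inf ([set e | 0 <= e /\ warp_near b a T e] `|` [set 1]).

Let lb0 b T a : lbound ([set e | 0 <= e /\ warp_near b a T e] `|` [set 1]) 0.
Proof. by move=> x [[]|->]. Qed.

Let hinf b T a : has_inf ([set e | 0 <= e /\ warp_near b a T e] `|` [set 1]).
Proof. by split; [exists 1; right|exists 0; exact: lb0]. Qed.

Lemma warp_dist_le1 b T a : warp_dist b T a <= 1.
Proof. by apply: (ge_inf (hinf b T a).2); right. Qed.

Lemma warp_dist_le b T a e : 0 <= e -> warp_near b a T e -> warp_dist b T a <= e.
Proof. by move=> e0 H; apply: ge_inf; [exists 0; exact: lb0|left]. Qed.

Lemma warp_dist_lt b T a e : warp_dist b T a < e -> e <= 1 ->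
  exists2 e', 0 <= e' < e & warp_near b a T e'.
Proof.
move=> ae e1; have de : 0 < e - warp_dist b T a by rewrite subr_gt0.
have [x [[x0 bx]|->]] := inf_adherent de (hinf b T a); rewrite addrC subrK.
  by move=> xe; exists x; rewrite ?x0.
by rewrite ltNge e1.
Qed.

Lemma warp_dist_lipschitz b T a c e : 0 <= e -> warp_near a c (T + 1) e ->
  warp_dist b T c <= warp_dist b T a + e.
Proof.
move=> e0 ac; apply/ler_addgt0Pr => h h0.
have [x [[x0 bx]|->] xh] := inf_adherent h0 (hinf b T a); last first.
  by rewrite (le_trans (warp_dist_le1 _ _ _))// addrAC (le_trans (ltW xh))// lerDl.
have [x1|x1] := leP x 1; last first.
  rewrite (le_trans (warp_dist_le1 _ _ _))// addrAC.
  by rewrite (le_trans (ltW (lt_trans x1 xh)))// lerDl.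
rewrite addrAC (le_trans _ (lerD (ltW xh) (lexx e)))//.
apply: warp_dist_le; first exact: addr_ge0.
apply: warp_near_trans bx _; apply: warp_near_sub ac => //.
by rewrite lerD2l.
Qed.

Lemma warp_dist_continuous b T : continuous (fun a : D => warp_dist b T a).
Proof.
apply/sk_continuousP => a e e0; exists (T + 2), (Num.min e 1); split.
  by rewrite lt_min e0 ltr01.
set m := Num.min e 1 => c ac.
have m0 : 0 <= m by rewrite le_min ler01 ltW.
have me : m <= e by rewrite ge_min lexx.
have m1 : m <= 1 by rewrite ge_min lexx orbT.
have h1 : warp_dist b T c <= warp_dist b T a + m.
  by apply: warp_dist_lipschitz => //; apply: warp_near_sub ac => //; lra.
have h2 : warp_dist b T a <= warp_dist b T c + m.
  apply: warp_dist_lipschitz => //; apply: warp_near_sub (warp_near_sym ac) => //.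
  lra.
by rewrite ler_norml; apply/andP; split; lra.
Qed.

Lemma warp_dist_stop b T S (a : D) : T + 1 <= S ->
  warp_dist b T (stop S a) = warp_dist b T a.
Proof.
move=> TS; have aS t : 0 <= t <= T + 1 -> stop S a t = a t.
  by move=> /andP[_ tT]; rewrite stopE min_l// (le_trans tT).
apply/le_anti/andP; split; rewrite -[leRHS]addr0; apply: warp_dist_lipschitz => //;
  by apply: sup_near_warp => // t tT; rewrite aS// subrr normr0.
Qed.

End warp_distance.

Section evaluation.
Context {R : realType} {d : nat}.
Local Notation E := 'rV[R]_d.
Local Notation D := (cadlag R d).

Lemma norm_sub_continuous (q : E) :
  continuous (fun x : E => `|x - q|).
Proof.
move=> x; apply/(@cvgrPdist_le _ _ _ (nbhs x) (nbhs_filter x)) => e e0.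
apply/nbhs_ballP; exists e => // y.
rewrite -ball_normE /ball_ /= => xy; rewrite (le_trans (ler_dist_dist _ _))//.
by rewrite opprB addrA subrK ltW.
Qed.

Lemma open_measurable_rV (U : set E) : open U -> measurable U.
Proof. by move=> oU; apply: sub_sigma_algebra. Qed.

Lemma open_measurable_cadlag (U : set D) : open U -> measurable U.
Proof. by move=> oU; apply: sub_sigma_algebra. Qed.

Lemma continuous_measurable_rV (f : E -> R) : continuous f ->
  measurable_fun setT f.
Proof.
move=> /continuousP cf; apply: (measurability _ (RGenOpens.measurableE R)).
move=> _ [_ [a [b ->] <-]]; rewrite setTI.
by apply: open_measurable_rV; apply: cf; exact: interval_open.
Qed.

Lemma continuous_measurable_cadlag (f : D -> R) : continuous f ->
  measurable_fun setT f.
Proof.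
move=> /continuousP cf; apply: (measurability _ (RGenOpens.measurableE R)).
move=> _ [_ [a [b ->] <-]]; rewrite setTI.
by apply: open_measurable_cadlag; apply: cf; exact: interval_open.
Qed.

(** The constraint is put on an open interval of times, which a small time change
    cannot leave; with a closed one the set would not be closed. *)
Lemma closed_open_interval (t v : R) (K : set E) : 0 <= t -> closed K ->
  closed [set a : D | forall s, t < s < v -> K (a s)].
Proof.
move=> t0 cK; rewrite -openC; apply/open_skP => a /= /existsNP[s].
move=> /not_implyP[/andP[ts sv] Kas].
have : nbhs (a s) (~` K) by apply: open_nbhs_nbhs; split => //; exact: closed_openC.
move=> /nbhs_ballP[e /= e0 eK].
pose h := Num.min (e / 2) (Num.min ((s - t) / 2) ((v - s) / 2)).
have h0 : 0 < h by rewrite !lt_min !divr_gt0 ?subr_gt0.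
have [he [hs hv]] : h <= e / 2 /\ h <= (s - t) / 2 /\ h <= (v - s) / 2.
  by rewrite /h !ge_min !lexx !orbT.
exists s, h; split => // c [lam [tl l1 l2]] /(_ (lam s)).
have s0 : 0 <= s by rewrite (le_trans t0)// ltW.
have := l1 _ s0; rewrite ler_norml => /andP[m1 m2].
have tls : t < lam s < v by apply/andP; split; lra.
move=> /(_ tls) Kc; apply: (eK (c (lam s))) => //.
rewrite -ball_normE /ball_ /= distrC (le_lt_trans (l2 s _)) ?s0 ?lexx//; lra.
Qed.

Lemma eval_measurable (t : R) : measurable_fun setT (fun a : D => a t).
Proof.
wlog t0 : t / 0 <= t.
  move=> H; have [/H//|/ltW t0] := leP 0 t.
  rewrite (_ : (fun a : D => a t) = (fun a : D => a 0)); first exact: H.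
  by apply/funext => a; rewrite path_neg.
apply: (measurability _ (erefl (@measurable _ E))) => _ [B oB <-].
rewrite setTI.
pose K n := [set x : E | ball x n.+1%:R^-1 `<=` B].
have cK n : closed (K n).
  rewrite -openC openE => x /existsNP[y /not_implyP[xy By]].
  have oy : open (ball y n.+1%:R^-1 : set E) by exact: ball_open.
  move: oy; rewrite openE => /(_ _ (ball_sym xy)); apply: filterS => z yz Kz.
  by apply: By; apply: Kz; exact: ball_sym.
rewrite [X in measurable X](_ : _ = \bigcup_n
    [set a : D | forall s, t < s < t + n.+1%:R^-1 -> K n (a s)]).
  apply: bigcupT_measurable => n; rewrite -[X in measurable X]setCK.
  apply: measurableC; apply: open_measurable_cadlag; apply: closed_openC.
  exact: closed_open_interval.
apply/seteqP; split=> a /= => [Bat|[n _ Ha]].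
  move: oB; rewrite openE => /(_ _ Bat) /nbhs_ballP[e /= e0 eB].
  have e2 : 0 < e / 2 by rewrite divr_gt0.
  have /cvgrPdist_lt/(_ _ e2) := @path_right_continuous _ _ a t.
  rewrite /at_right => -[h /= h0 Hh].
  have he : 0 < Num.min h (e / 2) by rewrite lt_min h0.
  have [N _ HN] := mesh_lt 0 he; exists N => //= s /andP[ts st].
  move=> y sy; apply: eB.
  have := HN N (leqnn _); rewrite lt_min => /andP[Nh Ne].
  have ats : ball (a t) (e / 2) (a s).
    rewrite -ball_normE; apply: Hh => //=; rewrite distrC gtr0_norm ?subr_gt0//.
    by rewrite ltrBlDl (lt_trans st)// ltrD2l.
  rewrite [e]splitr; apply: ball_triangle ats _.
  by apply: le_ball sy; exact: ltW.
have n0 : 0 < n.+1%:R^-1 :> R by rewrite invr_gt0.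
have /cvgrPdist_lt/(_ _ n0) := @path_right_continuous _ _ a t.
rewrite /at_right => -[h /= h0 Hh].
pose h' := Num.min h n.+1%:R^-1.
have h'0 : 0 < h' by rewrite lt_min h0.
have [h1 h2] : h' <= h /\ h' <= n.+1%:R^-1 by rewrite !ge_min !lexx orbT.
have h'2 : h' / 2 < h' by rewrite ltr_pdivrMr// ltr_pMr// ltr1n.
apply: (Ha (t + h' / 2)).
  by rewrite ltrDl divr_gt0//= ltrD2l (lt_le_trans h'2).
rewrite -ball_normE /ball_ /= distrC; apply: Hh => /=; last by rewrite ltrDl divr_gt0.
by rewrite distrC addrAC subrr add0r gtr0_norm ?divr_gt0// (lt_le_trans h'2).
Qed.

End evaluation.

Section coordinates.
Context {R : realType} {d : nat}.
Local Notation E := 'rV[R]_d.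
Local Notation D := (cadlag R d).

(** Countably many balls around step functions form a base; the margin between
    the two radii leaves room for a continuous bump. *)
Lemma step_base (U : set D) (a : D) : open U -> U a ->
  exists c T k, warp_dist (step c) T%:R a <= k.+1%:R^-1 /\
    forall b : D, warp_dist (step c) T%:R b < 2 * k.+1%:R^-1 -> U b.
Proof.
move=> oU Ua; have [T [e [e0 sub]]] := oU _ Ua.
have m0 : 0 < Num.min e 1 / 4 by rewrite divr_gt0// lt_min e0/=.
have [k _ /(_ _ (leqnn _)) kh] := mesh_lt 0 m0.
have [me m1] : Num.min e 1 <= e /\ Num.min e 1 <= 1 by rewrite !ge_min !lexx orbT.
set m := Num.min e 1 in m0 kh me m1; set h := k.+1%:R^-1 in kh.
have h0 : 0 < h :> R by rewrite invr_gt0.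
pose T' := (truncn (Num.max T 0)).+3.
have TT' : T + 2 <= T'%:R.
  have : T <= Num.max T 0 by rewrite le_max lexx.
  by have := truncnS_gt (Num.max T 0); rewrite /T' -!natr1 => ? ?; lra.
have h2 : 0 < h / 2 by rewrite divr_gt0.
have [c ca] := step_dense a T'%:R h2.
exists c, T', k; split => [|b].
  by rewrite (le_trans (warp_dist_le (ltW h2) ca))// ler_pdivrMr// ler_pMr// ler1n.
move=> /warp_dist_lt[|e' /andP[e'0 e'h] cb]; first by rewrite -/h; lra.
rewrite -/h in e'h.
have ac := warp_near_sym ca.
apply: sub; apply: (@warp_near_sub _ _ _ _ T _ (h / 2 + e')); [exact: lexx|lra|].
apply: warp_near_trans; first by apply: warp_near_sub ac; [lra|exact: lexx].
by apply: warp_near_sub cb; [lra|exact: lexx].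
Qed.

Let records_near (b : R -> E) (T : R) (a : D) (e : R) : 0 < e ->
  exists N, forall n, (N <= n)%N -> forall s, size s = (n.+1 * n.+1)%N ->
    records (n, s) n.+1%:R^-1 a ->
    `|warp_dist b T (step (n, s)) - warp_dist b T a| <= e.
Proof.
move=> e0; pose m := Num.min e 1; have m0 : 0 < m by rewrite lt_min e0/=.
have [me m1] : m <= e /\ m <= 1 by rewrite !ge_min !lexx orbT.
have m2 : 0 < m / 2 by rewrite divr_gt0.
have [N HN] := grid_near a (T + 2) m2.
have [N1 NN1 HN1] := mesh_lt (maxn N (truncn (Num.max (T + 2) 0))) m2.
exists N1 => n Nn s ss rec.
have h1 := HN1 _ Nn; have := leq_trans NN1 Nn; rewrite geq_max => /andP[nN nT].
have h0 : 0 <= n.+1%:R^-1 :> R by [].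
have Tn : (T + 2) * n.+1%:R < (size s)%:R.
  rewrite ss natrM ltr_pM2r//.
  have : T + 2 <= Num.max (T + 2) 0 by rewrite le_max lexx.
  move/le_lt_trans; apply; apply: lt_le_trans (truncnS_gt _) _.
  by rewrite ler_nat.
have := warp_near_step h0 Tn rec (HN _ nN).
set h := n.+1%:R^-1 in h0 h1 *; set x := m / 2 + h => near1.
have [x0 xm] : 0 <= x /\ x <= m by rewrite /x; split; lra.
have near2 := warp_near_sym near1.
rewrite (le_trans _ me)// (le_trans _ xm)// ler_norml; apply/andP; split.
  rewrite lerNl opprB lerBlDl; apply: warp_dist_lipschitz => //.
  by apply: warp_near_sub near1; [lra|exact: lexx].
rewrite lerBlDl; apply: warp_dist_lipschitz => //.
by apply: warp_near_sub near2; [lra|exact: lexx].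
Qed.

Definition coordinate_sets : set_system D :=
  [set A | exists (t : R) (B : set E), [/\ 0 <= t, measurable B &
                                          A = [set a : D | B (a t)]]].

Local Notation Dc := (g_sigma_algebraType coordinate_sets).

Let records_coordinate n s (e : R) :
  measurable ([set a : D | records (n, s) e a] : set Dc).
Proof.
rewrite [X in measurable X](_ : _ = \bigcap_i [set a : D |
    (i < size s)%N -> `|a (i%:R / n.+1%:R) - map_mx ratr (nth 0 s i)| <= e]).
  apply: bigcapT_measurable => i.
  have [is_|is_] := boolP (i < size s)%N; last first.
    rewrite [X in measurable X](_ : _ = setT); first exact: (@measurableT _ Dc).
    by apply/seteqP.
  apply: sub_sigma_algebra; exists (i%:R / n.+1%:R).
  exists [set x | `|x - map_mx ratr (nth 0 s i)| <= e]; split => //.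
    have mn := continuous_measurable_rV
      (@norm_sub_continuous R d (map_mx ratr (nth 0 s i))).
    have := mn (@measurableT _ E) `]-oo, e]%classic (measurable_itv _).
    rewrite setTI; set A1 := _ @^-1` _; set A2 := [set _ | _].
    suff -> : A1 = A2 by [].
    by apply/seteqP; split=> x; rewrite /A1 /= in_itv.
  by apply/seteqP; split => a /= H; [exact: (H isT)|move=> _].
by apply/seteqP; split => a /= H i; [move=> _; exact: H|exact: (H i I)].
Qed.

(** The functional is evaluated on rational records of the path instead of the
    path itself: there are countably many records, and which of them fit the path
    depends on finitely many coordinates. *)
Let warp_dist_coordinate (b : R -> E) (T e : R) :
  measurable ([set a : D | warp_dist b T a < e] : set Dc).
Proof.
pose A n s m := [set a : D | [/\ size s = (n.+1 * n.+1)%N,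
  warp_dist b T (step (n, s)) < e - m.+1%:R^-1 & records (n, s) n.+1%:R^-1 a]].
have mA n s m : measurable (A n s m : set Dc).
  have [[H1 H2]|H] := pselect (size s = (n.+1 * n.+1)%N /\
      warp_dist b T (step (n, s)) < e - m.+1%:R^-1).
    rewrite (_ : A n s m = [set a : D | records (n, s) n.+1%:R^-1 a]).
      exact: records_coordinate.
    by apply/seteqP; split=> a; [case|split].
  rewrite (_ : A n s m = set0); first exact: (@measurable0 _ Dc).
  by apply/seteqP; split=> a // [? ? _]; exfalso; apply: H.
rewrite [X in measurable X](_ : _ = \bigcup_m \bigcup_N \bigcap_n
    [set a : D | (N <= n)%N -> exists s, A n s m a]).
  apply: bigcupT_measurable => m; apply: bigcupT_measurable => N.
  apply: bigcapT_measurable => n.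
  have [nN|nN] := boolP (N <= n)%N; last first.
    rewrite [X in measurable X](_ : _ = setT); first exact: (@measurableT _ Dc).
    by apply/seteqP.
  rewrite [X in measurable X](_ : _ = \bigcup_s (A n s m)).
    by apply: countable_bigcupT_measurable => // s; exact: mA.
  by apply/seteqP; split => a /= => [/(_ isT)[s]|[s]]; exists s.
apply/seteqP; split => a /= => [ae|[m _ [N _ H]]].
  have de2 : 0 < (e - warp_dist b T a) / 2 by rewrite divr_gt0// subr_gt0.
  have [m _ /(_ _ (leqnn _)) mh] := mesh_lt 0 de2.
  have [N HN] := records_near b T a de2.
  exists m => //; exists N => // n _ /= Nn.
  have n0 : 0 < n.+1%:R^-1 :> R by rewrite invr_gt0.
  have [s ss rec] := records_ex a n (n.+1 * n.+1) n0.
  exists s; split => //; have := HN _ Nn _ ss rec.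
  by rewrite ler_norml => /andP[_]; move: m.+1%:R^-1 mh => h mh; lra.
have m0 : 0 < m.+1%:R^-1 :> R by rewrite invr_gt0.
have [N' HN'] := records_near b T a m0.
have [s [ss sb rec]] := H (maxn N N') I (leq_maxl _ _).
have := HN' _ (leq_maxr N N') s ss rec.
by rewrite ler_norml => /andP[+ _]; move: m.+1%:R^-1 sb => h; lra.
Qed.

(** An open set is a countable union of balls around step functions, and the distance
    to a step function can be read off the coordinates. *)
Lemma borel_coordinates (A : set D) : measurable A -> <<s coordinate_sets >> A.
Proof.
apply: smallest_sub; first exact: smallest_sigma_algebra.
move=> U oU; change (measurable (U : set Dc)).
pose V (i : (nat * seq 'rV[rat]_d) * nat * nat) :=
  [set a : D | warp_dist (step i.1.1) i.1.2%:R a < 2 * i.2.+1%:R^-1].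
rewrite [X in measurable X](_ : _ =
    \bigcup_i [set a | V i `<=` U /\ V i a]).
  apply: countable_bigcupT_measurable => // i.
  have [VU|VU] := pselect (V i `<=` U).
    rewrite [X in measurable X](_ : _ = V i); first exact: warp_dist_coordinate.
    by apply/seteqP; split => a; [case|].
  rewrite [X in measurable X](_ : _ = set0); first exact: (@measurable0 _ Dc).
  by apply/seteqP; split => a // [].
apply/seteqP; split => a => [Ua|[i _ [+ Va]]]; last exact.
have [c [T [k [H1 H2]]]] := step_base oU Ua.
exists (c, T, k) => //; split => //.
by rewrite /V /= (le_lt_trans H1)// ltr_pMl ?invr_gt0// ltr1n.
Qed.

Lemma shift_measurable (s : R) : measurable_fun setT (@Defs.shift R d s).
Proof.
have H : sigma_algebra setT [set A : set D | measurable (Defs.shift s @^-1` A)].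
  split => /=; first by rewrite preimage_set0.
    by move=> A mA; rewrite setTD preimage_setC; exact: measurableC.
  by move=> F mF; rewrite preimage_bigcup; exact: bigcupT_measurable.
move=> _ A /borel_coordinates mA; rewrite setTI.
apply: (smallest_sub H _ mA) => _ [t [B [t0 mB ->]]] /=.
have := @eval_measurable R d (s + Num.max t 0) measurableT B mB.
by rewrite setTI.
Qed.

Lemma stop_past (s : R) (A : set D) : 0 <= s -> measurable A ->
  past s (stop s @^-1` A).
Proof.
move=> s0; have G := smallest_sigma_algebra setT
  [set A : set D | exists (u : R) (B : set E), [/\ (0 <= u <= s)%R, measurable B &
                                       A = [set a : D | B (a u)]]].
have H : sigma_algebra setT [set A : set D | past s (stop s @^-1` A)].
  split => /=; first by rewrite preimage_set0; case: G.
    by move=> B mB; rewrite setTD preimage_setC -setTD; case: G => _ + _; apply.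
  by move=> F mF; rewrite preimage_bigcup; case: G => _ _; apply.
move=> /borel_coordinates mA; apply: (smallest_sub H _ mA).
move=> _ [t [B [t0 mB ->]]] /=; apply: sub_sigma_algebra.
by exists (Num.min t s), B; split => //; rewrite le_min t0 s0 ge_min lexx orbT.
Qed.

Lemma past_measurable (s : R) (A : set D) : past s A -> measurable A.
Proof.
apply: smallest_sub; first exact: sigma_algebra_measurable.
move=> _ [u [B [_ mB ->]]]; have := @eval_measurable R d u measurableT B mB.
by rewrite setTI.
Qed.

Lemma stop_measurable (s : R) : 0 <= s -> measurable_fun setT (@stop R d s).
Proof.
by move=> s0 _ A mA; rewrite setTI; apply: past_measurable; exact: stop_past.
Qed.

End coordinates.

Section test_functionals.
Context {R : realType} {d : nat}.
Local Notation E := 'rV[R]_d.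
Local Notation D := (cadlag R d).

Definition bump_code : Type := (nat * seq 'rV[rat]_d) * nat * nat * rat.

(** A bump of height [ratr i.2]: full height in the ball of radius [1 / k.+1]
    around the coded step function, zero outside the ball of twice that radius. *)
Definition bump (i : bump_code) (a : D) : R :=
  let: (c, T, k, q) := i in ratr q *
    Num.min 1 (Num.max 0 (2 - k.+1%:R * warp_dist (step c) T%:R a)).

Definition test (s : seq bump_code) (a : D) : R :=
  \big[Num.max/0]_(i <- s) bump i a.

Lemma bump_continuous i : continuous (bump i).
Proof.
case: i => [[[c T] k] q] a.
pose g (x : R) := ratr q * Num.min 1 (Num.max 0 (2 - k.+1%:R * x)).
have cg : continuous g.
  move=> x; apply: cvgM; first exact: cvg_cst.
  apply: (@continuous_min R R (cst 1) (fun x => Num.max 0 (2 - k.+1%:R * x))).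
    exact: cvg_cst.
  apply: (@continuous_max R R (cst 0) (fun x => 2 - k.+1%:R * x)).
    exact: cvg_cst.
  apply: cvgB; first exact: cvg_cst.
  by apply: cvgM; [exact: cvg_cst|exact: cvg_id].
exact: (@continuous_comp D R R _ g a (@warp_dist_continuous _ _ _ _ a) (cg _)).
Qed.

Lemma test_cons i s a : test (i :: s) a = Num.max (bump i a) (test s a).
Proof. by rewrite /test big_cons. Qed.

Lemma test_ge0 s a : 0 <= test s a.
Proof.
by elim: s => [|i s IH]; rewrite ?test_cons ?le_max ?IH ?orbT// /test big_nil.
Qed.

Lemma test_continuous s : continuous (test s).
Proof.
elim: s => [|i s IH] a.
  have -> : test [::] = cst 0 by apply/funext => b; rewrite /test big_nil.
  exact: cst_continuous.
rewrite (_ : test _ = (fun b => Num.max (bump i b) (test s b))).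
  by apply: (@continuous_max R D (bump i) (test s)); [exact: bump_continuous|exact: IH].
by apply/funext => b; rewrite test_cons.
Qed.

Lemma test_bounded s : exists B, forall a, test s a <= B.
Proof.
elim: s => [|[[[c T] k] q] s [B HB]].
  by exists 0 => a; rewrite /test big_nil.
exists (Num.max `|ratr q| B) => a; rewrite test_cons ge_max !le_max HB orbT andbT.
apply/orP; left => /=.
set x := Num.min _ _; have [x0 x1] : 0 <= x /\ x <= 1.
  by rewrite /x ge_min lexx le_min ler01 le_max lexx.
by rewrite (le_trans (ler_norm _))// normrM (ger0_norm x0) ler_piMr.
Qed.

Lemma test_stop s : exists2 S, 0 < S & forall a, test s (stop S a) = test s a.
Proof.
suff [S [S0 HS]] : exists S, 0 < S /\ forall S', S <= S' ->
    forall a, test s (stop S' a) = test s a.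
  by exists S => // a; apply: HS.
elim: s => [|[[[c T] k] q] s [S [S0 HS]]].
  by exists 1; split => // S' _ a; rewrite /test !big_nil.
exists (Num.max S (T%:R + 1)); rewrite lt_max S0; split => // S'.
rewrite ge_max => /andP[SS' TS'] a; rewrite !test_cons HS//= warp_dist_stop//.
Qed.

(** The bumps below [F] reach it everywhere, since [F > q] is open; there are
    countably many of them, so a sequence of finite maxima increases to [F]. *)
Lemma test_approx (F : D -> R) : continuous F -> (forall a, 0 <= F a) ->
  exists s : nat -> seq bump_code, [/\ forall n a, test (s n) a <= F a,
    forall a, nondecreasing_seq (fun n => test (s n) a) &
    forall a, test (s n) a @[n --> \oo] --> F a].
Proof.
move=> cF F0; pose adm (i : bump_code) := `[< forall a, bump i a <= F a >].
pose s n := [seq i <- pmap (@unpickle bump_code) (iota 0 n) | adm i].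
have sF n a : test (s n) a <= F a.
  by rewrite /test big_filter; apply: bigmax_le => // i /asboolP.
have ss m n : (m <= n)%N -> {subset s m <= s n}.
  move=> mn i; rewrite !mem_filter => /andP[-> /=].
  rewrite !mem_pmap => /mapP[j]; rewrite mem_iota /= add0n => jm ->.
  by apply/mapP; exists j => //; rewrite mem_iota /= add0n (leq_trans jm).
have nd a : nondecreasing_seq (fun n => test (s n) a).
  by move=> m n mn; apply: sub_bigmax_seq; exact: ss.
exists s; split => // a; apply/cvgrPdist_le => e e0.
suff [N HN] : exists N, F a - e <= test (s N) a.
  exists N => // n /= Nn; rewrite ger0_norm ?subr_ge0 ?sF// lerBlDr -lerBlDl.
  by rewrite (le_trans HN)// nd.
have [Fe|Fe] := leP (F a - e) 0; first by exists 0%N; rewrite (le_trans Fe)// test_ge0.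
have [|q] := @rat_in_itvoo R (F a - e) (F a); first by rewrite ltrBlDr ltrDl.
rewrite in_itv /= => /andP[qe qF].
have oU : open [set b | ratr q < F b].
  by move/continuousP: cF => /(_ [set x | ratr q < x]); apply; exact: open_gt.
have [c [T [k [ca cU]]]] := step_base oU qF.
pose i : bump_code := (c, T, k, q).
have q0 : 0 < ratr q :> R by rewrite (lt_trans Fe).
have k0 : 0 < k.+1%:R :> R by [].
have kV : k.+1%:R * k.+1%:R^-1 = 1 :> R by rewrite divff.
have adm_i : adm i.
  apply/asboolP => b /=; set x := warp_dist _ _ _.
  have [bU|bU] := ltP x (2 * k.+1%:R^-1).
    rewrite (le_trans _ (ltW (cU _ bU)))// ler_piMr ?(ltW q0)//.
    by rewrite ge_min lexx.
  move: bU; rewrite -(ler_pM2l k0) mulrCA kV mulr1 => bU.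
  by rewrite max_l ?subr_le0// min_r ?mulr0.
have bia : bump i a = ratr q.
  rewrite /= min_l ?mulr1// le_max; apply/orP; right.
  rewrite lerBrDr -lerBrDl; move: ca; rewrite -(ler_pM2l k0) kV => /le_trans; apply.
  by rewrite lerBrDr.
exists (pickle i).+1; rewrite (le_trans (ltW qe))// -bia /test.
apply: (le_bigmax_seq 0 i xpredT (bump^~ a)) => //; rewrite mem_filter adm_i mem_pmap.
apply/mapP.
by exists (pickle i); rewrite ?mem_iota ?add0n//= pickleK.
Qed.

End test_functionals.

(** * Integrals against disintegrated measures *)

Section nonnegative_induction.
Local Open Scope ereal_scope.
Context d (T : measurableType d) (R : realType).

Import HBNNSimple.

(** The monotone class principle for nonnegative measurable functions. *)
Lemma ge0_measurable_ind (P : (T -> \bar R) -> Prop) :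
  (forall A, measurable A -> P (fun x => (\1_A x)%:E)) ->
  (forall (k : R) f, (0 <= k)%R -> measurable_fun setT f ->
    (forall x, 0 <= f x) -> P f -> P (fun x => k%:E * f x)) ->
  (forall f g, measurable_fun setT f -> measurable_fun setT g ->
    (forall x, 0 <= f x) -> (forall x, 0 <= g x) -> P f -> P g ->
    P (fun x => f x + g x)) ->
  (forall (f_ : nat -> T -> \bar R) f, (forall n, measurable_fun setT (f_ n)) ->
    (forall n x, 0 <= f_ n x) -> (forall x, nondecreasing_seq (f_ ^~ x)) ->
    (forall x, f_ n x @[n --> \oo] --> f x) -> (forall n, P (f_ n)) -> P f) ->
  forall f, measurable_fun setT f -> (forall x, 0 <= f x) -> P f.
Proof.
move=> P1 PZ PD PL f mf f0.
pose f_ := nnsfun_approx measurableT mf.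
apply: (PL (fun n x => (f_ n x)%:E) f) => [n|n x|x|x|n].
- exact/measurable_EFinP.
- by rewrite lee_fin.
- by move=> m n mn; rewrite lee_fin; exact/lefP/nd_nnsfun_approx.
- exact: cvg_nnsfun_approx.
move: (f_ n) => g.
pose s : seq R := finmap.enum_fset (fset_set (range g)).
pose h (i : nat) (x : T) : \bar R := (s`_i)%:E * (\1_(g @^-1` [set s`_i]) x)%:E.
have mh i : measurable_fun setT (h i).
  by apply: measurable_funeM; exact/measurable_EFinP/measurable_indic.
have h0 i x : 0 <= h i x by rewrite /h -EFinM nnfun_muleindic_ge0.
have Ph i : P (h i).
  have [si0|si0] := leP 0%R s`_i; last first.
    rewrite (_ : h i = fun x => (\1_set0 x)%:E); first exact: P1.
    by apply/funext => x; rewrite /h preimage_nnfun0// indic0 mule0.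
  apply: PZ => //; last exact: P1.
  exact/measurable_EFinP/measurable_indic.
rewrite (_ : (fun x => (g x)%:E) = fun x => \sum_(i < size s) h i x); last first.
  by apply/funext => x; rewrite fimfunEord -sumEFin.
have [N ->] : exists N, size s = N by exists (size s).
suff : [/\ P (fun x => \sum_(i < N) h i x),
    measurable_fun setT (fun x => \sum_(i < N) h i x) &
    forall x, 0 <= \sum_(i < N) h i x] by case.
elim: N => [|N [IH1 IH2 IH3]].
  rewrite (_ : (fun x => _) = fun x => (\1_set0 x)%:E).
    split; first exact: P1.
      exact/measurable_EFinP/measurable_indic.
    by move=> x; rewrite big_ord0.
  by apply/funext => x; rewrite big_ord0 indic0.
rewrite (_ : (fun x => _) = fun x => \sum_(i < N) h i x + h N x); last first.
  by apply/funext => x; rewrite big_ord_recr.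
split; first exact: PD.
  exact: emeasurable_funD.
by move=> x; rewrite big_ord_recr/= adde_ge0.
Qed.

End nonnegative_induction.

Section disintegration.
Local Open Scope ereal_scope.
Context {R : realType}.

Lemma ndcvgeMr (u : nat -> \bar R) (l c : \bar R) : 0 <= c ->
  nondecreasing_seq u -> (forall n, 0 <= u n) -> u n @[n --> \oo] --> l ->
  u n * c @[n --> \oo] --> l * c.
Proof.
move=> c0 nu u0 ul; have [cf|] := boolP (c \is a fin_num).
  exact: cvgeZr.
rewrite ge0_fin_numE// -leNgt leye_eq => /eqP ->.
have [[N uN]|H] := pselect (exists N, 0 < u N).
  have l0 : 0 < l.
    rewrite (lt_le_trans uN)//; apply: cvge_ge ul.
    by exists N => // n /= Nn; exact: nu.
  rewrite (gt0_muley l0); apply: cvg_near_cst; exists N => // n /= Nn.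
  by rewrite gt0_muley// (lt_le_trans uN)// nu.
have uE n : u n = 0.
  by apply/eqP; rewrite eq_le u0 andbT leNgt; apply/negP => ?; apply: H; exists n.
have -> : l = 0.
  have -> : l = limn u by apply/esym/cvg_lim.
  have -> : u = cst 0 by apply/funext.
  by apply/cvg_lim => //; exact: cvg_cst.
by under eq_fun do rewrite uE; rewrite mul0e; exact: cvg_cst.
Qed.

(** If [Q w] is the law of [V] given [U], on rectangles, then it is so against
    all pairs of nonnegative functions. *)
Lemma ge0_integral_disintegration dO d1 d2 (Om : measurableType dO)
    (P : {measure set Om -> \bar R}) (T1 : measurableType d1)
    (T2 : measurableType d2) (U : Om -> T1) (V : Om -> T2)
    (Q : Om -> {measure set T2 -> \bar R}) :
  measurable_fun setT U -> measurable_fun setT V ->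
  (forall C, measurable C -> measurable_fun setT (Q ^~ C)) ->
  (forall A C, measurable A -> measurable C ->
    P (U @^-1` A `&` V @^-1` C) = \int[P]_(w in U @^-1` A) Q w C) ->
  forall (p : T1 -> \bar R) (g : T2 -> \bar R),
    measurable_fun setT p -> (forall x, 0 <= p x) ->
    measurable_fun setT g -> (forall x, 0 <= g x) ->
  \int[P]_w (p (U w) * g (V w)) = \int[P]_w (p (U w) * \int[Q w]_y g y).
Proof.
move=> mU mV mQ HPQ.
have mQg (g : T2 -> \bar R) : measurable_fun setT g -> (forall x, 0 <= g x) ->
    measurable_fun setT (fun w => \int[Q w]_y g y).
  by move=> mg g0; exact: measurable_fun_integral_kernel.
have Qg0 (g : T2 -> \bar R) w : (forall x, 0 <= g x) -> 0 <= \int[Q w]_y g y.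
  by move=> g0; exact: integral_ge0.
pose L (p : T1 -> \bar R) (g : T2 -> \bar R) w := p (U w) * g (V w).
pose M (p : T1 -> \bar R) (g : T2 -> \bar R) w := p (U w) * \int[Q w]_y g y.
have mL p g : measurable_fun setT p -> measurable_fun setT g ->
    measurable_fun setT (L p g).
  by move=> mp mg; apply: emeasurable_funM; exact: measurableT_comp.
have mM p g : measurable_fun setT p -> measurable_fun setT g ->
    (forall x, 0 <= g x) -> measurable_fun setT (M p g).
  move=> mp mg g0; apply: emeasurable_funM; last exact: mQg.
  exact: (measurableT_comp mp).
have L0 p g : (forall x, 0 <= p x) -> (forall x, 0 <= g x) ->
    forall w, setT w -> 0 <= L p g w.
  by move=> p0 g0 w _; rewrite mule_ge0.
have M0 p g : (forall x, 0 <= p x) -> (forall x, 0 <= g x) ->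
    forall w, setT w -> 0 <= M p g w.
  by move=> p0 g0 w _; rewrite mule_ge0// Qg0.
pose W p g := \int[P]_w L p g w = \int[P]_w M p g w.
have step1 A (g : T2 -> \bar R) : measurable A -> measurable_fun setT g ->
    (forall x, 0 <= g x) -> W (fun x => (\1_A x)%:E) g.
  move=> mA; set p := fun x => _.
  have mp : measurable_fun setT p by exact/measurable_EFinP/measurable_indic.
  have p0 x : 0 <= p x by rewrite /p lee_fin.
  move: g; apply: ge0_measurable_ind.
  - move=> C mC; rewrite /W.
    transitivity (\int[P]_w (\1_(U @^-1` A `&` V @^-1` C) w)%:E).
      by apply: eq_integral => w _; rewrite /L /p -EFinM indicI.
    rewrite integral_indic//; last first.
      by apply: measurableI; rewrite -[X in measurable X]setTI;
        [exact: mU|exact: mV].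
    rewrite setIT HPQ// integral_mkcond; apply: eq_integral => w _.
    rewrite /M /p integral_indic// setIT /patch indicE.
    rewrite -[w \in U @^-1` A]/(U w \in A).
    by case: (U w \in A); rewrite ?mul1e ?mul0e.
  - move=> k f k0 mf f0; rewrite /W => IH.
    have -> : L p (fun x => k%:E * f x) = fun w => k%:E * L p f w.
      by apply/funext => w; rewrite /L muleCA.
    rewrite (ge0_integralZl_EFin P measurableT (L0 _ _ p0 f0) (mL _ _ mp mf) k0) IH.
    rewrite -(ge0_integralZl_EFin P measurableT (M0 _ _ p0 f0) (mM _ _ mp mf f0) k0).
    apply: eq_integral => w _; rewrite /M muleCA.
    by rewrite (ge0_integralZl_EFin _ measurableT (fun x _ => f0 x) mf k0).
  - move=> f h mf mh f0 h0; rewrite /W => IH1 IH2.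
    have -> : L p (fun x => f x + h x) = fun w => L p f w + L p h w.
      by apply/funext => w; rewrite /L ge0_muleDr.
    rewrite (ge0_integralD P measurableT (L0 _ _ p0 f0) (mL _ _ mp mf)
      (L0 _ _ p0 h0) (mL _ _ mp mh)) IH1 IH2.
    rewrite -(ge0_integralD P measurableT (M0 _ _ p0 f0) (mM _ _ mp mf f0)
      (M0 _ _ p0 h0) (mM _ _ mp mh h0)).
    apply: eq_integral => w _; rewrite /M -ge0_muleDr ?Qg0//.
    by rewrite (ge0_integralD _ measurableT (fun x _ => f0 x) mf (fun x _ => h0 x) mh).
  - move=> f_ f mf_ f0_ ndf fl; rewrite /W => IH.
    have f0 x : 0 <= f x by apply: cvge_ge (fl x); exact: nearW.
    have -> : L p f = fun w => limn (fun n => L p (f_ n) w).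
      by apply/funext => w; apply/esym/cvg_lim => //; exact: cvgeZl.
    rewrite (monotone_convergence P measurableT (fun n => mL _ _ mp (mf_ n))
      (fun n => L0 _ _ p0 (f0_ n))); last first.
      by move=> w _ m n mn; rewrite /L lee_wpmul2l//; exact: ndf.
    under [in LHS]eq_fun do rewrite IH.
    rewrite -(monotone_convergence P measurableT
      (fun n => mM _ _ mp (mf_ n) (f0_ n)) (fun n => M0 _ _ p0 (f0_ n))); last first.
      move=> w _ m n mn; rewrite /M lee_wpmul2l//.
      by apply: ge0_le_integral => // y _; exact: ndf.
    apply: eq_integral => w _; apply/cvg_lim => //; apply: cvgeZl => //.
    have -> : f = fun y => limn (f_ ^~ y).
      by apply/funext => y; apply/esym/cvg_lim => //; exact: fl.
    by apply: cvg_monotone_convergence => // x _; exact: ndf.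
move=> p g mp p0 mg g0; suff : W p g by [].
move: p mp p0; apply: ge0_measurable_ind.
- by move=> A mA; exact: step1.
- move=> k f k0 mf f0; rewrite /W => IH.
  have -> : L (fun x => k%:E * f x) g = fun w => k%:E * L f g w.
    by apply/funext => w; rewrite /L muleA.
  rewrite (ge0_integralZl_EFin P measurableT (L0 _ _ f0 g0) (mL _ _ mf mg) k0) IH.
  rewrite -(ge0_integralZl_EFin P measurableT (M0 _ _ f0 g0) (mM _ _ mf mg g0) k0).
  by apply: eq_integral => w _; rewrite /M muleA.
- move=> f h mf mh f0 h0; rewrite /W => IH1 IH2.
  have -> : L (fun x => f x + h x) g = fun w => L f g w + L h g w.
    by apply/funext => w; rewrite /L ge0_muleDl.
  rewrite (ge0_integralD P measurableT (L0 _ _ f0 g0) (mL _ _ mf mg)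
    (L0 _ _ h0 g0) (mL _ _ mh mg)) IH1 IH2.
  rewrite -(ge0_integralD P measurableT (M0 _ _ f0 g0) (mM _ _ mf mg g0)
    (M0 _ _ h0 g0) (mM _ _ mh mg g0)).
  by apply: eq_integral => w _; rewrite /M ge0_muleDl.
- move=> f_ f mf_ f0_ ndf fl; rewrite /W => IH.
  have -> : L f g = fun w => limn (fun n => L (f_ n) g w).
    by apply/funext => w; apply/esym/cvg_lim => //; exact: ndcvgeMr.
  have -> : M f g = fun w => limn (fun n => M (f_ n) g w).
    apply/funext => w; apply/esym/cvg_lim => //; apply: ndcvgeMr => //.
    exact: Qg0.
  rewrite (monotone_convergence P measurableT (fun n => mL _ _ (mf_ n) mg)
    (fun n => L0 _ _ (f0_ n) g0)); last first.
    by move=> w _ m n mn; rewrite /L lee_wpmul2r//; exact: ndf.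
  rewrite (monotone_convergence P measurableT (fun n => mM _ _ (mf_ n) mg g0)
    (fun n => M0 _ _ (f0_ n) g0)); last first.
    by move=> w _ m n mn; rewrite /M lee_wpmul2r ?Qg0//; exact: ndf.
  by congr (lim (_ @ \oo)); apply/funext => n; exact: IH.
Qed.

Lemma ge0_integral_mixture d1 d2 (S : measurableType d1) (T : measurableType d2)
    (nu : probability S R) (k : R.-pker S ~> T) (f : T -> \bar R) :
  measurable_fun setT f -> (forall x, 0 <= f x) ->
  \int[mixture nu k]_y f y = \int[nu]_x \int[k x]_y f y.
Proof.
have mk (g : T -> \bar R) : measurable_fun setT g -> (forall x, 0 <= g x) ->
    measurable_fun setT (fun x => \int[k x]_y g y).
  move=> mg g0; apply: measurable_fun_integral_kernel => // ? ?.
  exact: measurable_kernel.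
have k0 (g : T -> \bar R) : (forall x, 0 <= g x) ->
    forall x, setT x -> 0 <= \int[k x]_y g y.
  by move=> g0 x _; exact: integral_ge0.
move: f; apply: ge0_measurable_ind.
- move=> A mA; rewrite integral_indic// setIT; apply: eq_integral => x _.
  by rewrite integral_indic// setIT.
- move=> c f c0 mf f0 IH.
  rewrite (ge0_integralZl_EFin _ measurableT (fun x _ => f0 x) mf c0) IH.
  rewrite -(ge0_integralZl_EFin _ measurableT (k0 _ f0) (mk _ mf f0) c0).
  apply: eq_integral => x _.
  by rewrite (ge0_integralZl_EFin _ measurableT (fun x _ => f0 x) mf c0).
- move=> f g mf mg f0 g0 IH1 IH2.
  rewrite (ge0_integralD _ measurableT (fun x _ => f0 x) mf (fun x _ => g0 x) mg).
  rewrite IH1 IH2 -(ge0_integralD _ measurableT (k0 _ f0) (mk _ mf f0)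
    (k0 _ g0) (mk _ mg g0)).
  apply: eq_integral => x _.
  by rewrite (ge0_integralD _ measurableT (fun x _ => f0 x) mf (fun x _ => g0 x) mg).
- move=> f_ f mf_ f0_ ndf fl IH.
  have -> : f = fun y => limn (f_ ^~ y).
    by apply/funext => y; apply/esym/cvg_lim => //; exact: fl.
  have mc (m : {measure set T -> \bar R}) :
      \int[m]_y limn (f_ ^~ y) = limn (fun n => \int[m]_y f_ n y).
    exact: (monotone_convergence m measurableT mf_ (fun n x _ => f0_ n x)
      (fun x _ => ndf x)).
  rewrite mc; under [in LHS]eq_fun do rewrite IH.
  rewrite -(monotone_convergence nu measurableT (fun n => mk _ (mf_ n) (f0_ n))
    (fun n => k0 _ (f0_ n))); last first.
    by move=> x _ m n mn; apply: ge0_le_integral => // y _; exact: ndf.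
  by apply: eq_integral => x _; rewrite mc.
Qed.

End disintegration.

(** * The Markov property of the scheme, for path functionals *)

Section partial_sums.
Context {R : realType}.
Implicit Type u : nat -> {posnum R}.

Lemma psum0 u : psum u 0 = 0.
Proof. by rewrite /psum big_geq. Qed.

Lemma psumS u n : psum u n.+1 = psum u n + (u n.+1)%:num.
Proof. by rewrite /psum big_nat_recr. Qed.

Lemma psum_le u m n : (m <= n)%N -> psum u m <= psum u n.
Proof.
move=> /subnK <-; elim: (n - m)%N => // k IH.
by rewrite addSn psumS (le_trans IH)// lerDl.
Qed.

Lemma psum_ge0 u n : 0 <= psum u n.
Proof. by rewrite -(psum0 u) psum_le. Qed.

Lemma psum_gt0 u n : 0 < psum u n.+1.
Proof. by rewrite psumS ltr_wpDl// psum_ge0. Qed.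

Lemma psum_bracket u n t : (psum u k @[k --> \oo] --> +oo) -> 0 <= t ->
  exists m, psum u (n + m) <= psum u n + t < psum u (n + m).+1.
Proof.
move=> uoo t0; have ex : exists m, psum u n + t < psum u (n + m).+1.
  move/cvgryPgt : uoo => /(_ (psum u n + t)) [N _ HN]; exists N.
  by rewrite (lt_le_trans (HN N (leqnn _)))// psum_le// leqW// leq_addl.
case: (ex_minnP ex) => m Hm mmin; exists m; rewrite Hm andbT.
case: m Hm mmin => [|m] _ mmin; first by rewrite addn0 lerDl.
rewrite addnS leNgt; apply/negP => H.
by have := mmin m H; rewrite ltnn.
Qed.

End partial_sums.

Section mixture_on_a_set.
Local Open Scope ereal_scope.
Context {dO d : measure_display} {R : realType} {Om : measurableType dO}
  {T : measurableType d}.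
Variables (P : {measure set Om -> \bar R}) (A : set Om) (mA : measurable A)
  (Q : Om -> {measure set T -> \bar R})
  (mQ : forall C, measurable C -> measurable_fun setT (Q ^~ C)).

Definition mixture_on (_ : forall C, measurable C -> measurable_fun setT (Q ^~ C))
  (_ : measurable A) (C : set T) : \bar R := \int[P]_(w in A) Q w C.

Let mixture_on0 : mixture_on mQ mA set0 = 0.
Proof. by rewrite /mixture_on; apply: integral0_eq => x _; rewrite measure0. Qed.

Let mixture_on_ge0 C : 0 <= mixture_on mQ mA C.
Proof. by apply: integral_ge0 => x _; exact: measure_ge0. Qed.

Let mixture_on_sigma_additive : semi_sigma_additive (mixture_on mQ mA).
Proof.
move=> F mF tF mUF; rewrite [X in _ --> X](_ : _ =
    \sum_(n <oo) mixture_on mQ mA (F n)); last first.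
  rewrite /mixture_on -integral_nneseries//.
  - by apply: eq_integral => x _; rewrite measure_semi_bigcup.
  - by move=> n; apply: measurable_funTS; exact: mQ.
by apply: is_cvg_ereal_nneg_natsum => n _; exact: mixture_on_ge0.
Qed.

HB.instance Definition _ := isMeasure.Build _ _ _ (mixture_on mQ mA)
  mixture_on0 mixture_on_ge0 mixture_on_sigma_additive.

End mixture_on_a_set.

Section scheme_markov.
Context {R : realType} {d : nat} {dO dO' : measure_display}
  {Om : measurableType dO} {Om' : measurableType dO'}.
Local Notation E := 'rV[R]_d.
Local Notation D := (cadlag R d).
Variables (P : probability Om R) (P' : probability Om' R)
  (gamma : nat -> {posnum R}) (Xbar : {RV P >-> D})
  (Y : nat -> E -> {RV P' >-> D}).
Hypothesis gamma_oo : psum gamma n @[n --> \oo] --> +oo.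
Hypothesis Xbar_step : forall w, stepwise_constant gamma (Xbar w).
Hypothesis Xbar_markov : nonhomogeneous_markov Xbar.
Hypothesis Xbar_law : forall n, conditional_law P
  (fun w => shifted gamma (Xbar w) n)
  (fun w => shifted gamma (Xbar w) n 0%R)
  (fun x => distribution P' (Y n x)).
Local Open Scope ereal_scope.

Local Notation G := (psum gamma).
Local Notation Z := (fun n w => shifted gamma (Xbar w) n).
Local Notation Q := (fun n x => distribution P' (Y n x)).

Lemma shifted0 n w : shifted gamma (Xbar w) n 0%R = Xbar w (G n).
Proof. by rewrite /shifted shiftE// addr0. Qed.

Lemma shifted_measurable n : measurable_fun setT (Z n).
Proof. by apply: (measurableT_comp (shift_measurable _)). Qed.

Lemma Xbar_eval_measurable t : measurable_fun setT (fun w => Xbar w t).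
Proof. by apply: (measurableT_comp (eval_measurable t)). Qed.

Lemma Q_measurable n C : measurable C ->
  measurable_fun setT (fun x => Q n x C).
Proof. by case: (Xbar_law n) => + _; apply. Qed.

Lemma past_le s t (A : set D) : (s <= t)%R -> past s A -> past t A.
Proof.
move=> st; apply: sub_sigma_algebra2 => _ [u [B [/andP[u0 us] mB ->]]].
by exists u, B; rewrite u0 (le_trans us).
Qed.

Lemma past_preimage s (A : set D) : past s A -> measurable (Xbar @^-1` A).
Proof.
by move=> /past_measurable mA; rewrite -[X in measurable X]setTI; exact: measurable_funPT.
Qed.

(** The future of the scheme being known to depend on the past through the
    present only, its law given the present is determined by the regular version
    at hand: conditional probabilities are almost surely unique. *)
Let markov_unique n (C : set D) (h : E -> \bar R) : measurable C ->
  measurable_fun setT h -> (forall x, 0 <= h x) ->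
  (forall A, past (G n) A -> P (Xbar @^-1` A `&` Z n @^-1` C) =
     \int[P]_(w in Xbar @^-1` A) h (Xbar w (G n))) ->
  forall A, past (G n) A -> P (Xbar @^-1` A `&` Z n @^-1` C) =
     \int[P]_(w in Xbar @^-1` A) Q n (Xbar w (G n)) C.
Proof.
move=> mC mh h0 Hh A pA; rewrite Hh//.
pose z w := Xbar w (G n).
have mz : measurable_fun setT z by exact: Xbar_eval_measurable.
pose mzi := isMeasurableFun.Build _ _ _ _ z mz.
pose zf : {RV P >-> E} := HB.pack z mzi.
pose mu := distribution P zf.
have Hz (B : set E) : measurable B -> past (G n) [set a | B (a (G n))].
  move=> mB; apply: sub_sigma_algebra; exists (G n), B.
  by rewrite psum_ge0 lexx.
have push (B : set E) (f : E -> \bar R) : measurable B ->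
    measurable_fun setT f -> (forall x, 0 <= f x) ->
    \int[mu]_(x in B) f x = \int[P]_(w in z @^-1` B) f (z w).
  move=> mB mf f0; rewrite /mu /distribution ge0_integral_pushforward//.
  exact: measurable_funTS.
have hQ : ae_eq mu setT h (Q n ^~ C).
  apply: integral_ae_eq => //.
  - apply/integrableP; split => //.
    under eq_integral do rewrite gee0_abs//.
    rewrite ge0_integral_distribution//.
    have := Hh setT; rewrite preimage_setT => <-; last first.
      by apply: (@measurableT _ (g_sigma_algebraType _)).
    rewrite setTI (le_lt_trans (probability_le1 _ _)) ?ltry//.
    by rewrite -[X in measurable X]setTI; exact: shifted_measurable.
  - exact: Q_measurable.
  - move=> B _ mB; rewrite !push//; last exact: Q_measurable.
    have := Hh _ (Hz _ mB); rewrite -[Xbar @^-1` _]/(z @^-1` B) => <-.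
    case: (Xbar_law n) => _ /(_ _ _ mC mB) => H.
    rewrite [RHS](_ : _ = \int[P]_(w in z @^-1` B) Q n (Z n w 0%R) C).
      rewrite setIC (_ : z @^-1` B = (fun w => Z n w 0%R) @^-1` B) ?H//.
      by congr (_ @^-1` B); apply/funext => w; rewrite shifted0.
    by apply: eq_integral => w _; rewrite shifted0.
have [N [mN N0 HN]] := hQ.
apply: ge0_ae_eq_integral => //.
- exact: (past_preimage pA).
- by apply: measurable_funTS; exact: (measurableT_comp mh).
- by apply: measurable_funTS; exact: (measurableT_comp (Q_measurable _ mC)).
exists (z @^-1` N); split => //.
  by rewrite -[X in measurable X]setTI; exact: (mz measurableT _ mN).
move=> w /= H; apply: HN => /= H'; apply: H => _; exact: H'.
Qed.

Local Notation past_type s := (g_sigma_algebraType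
  [set A : set D | exists (u : R) (B : set E), [/\ (0 <= u <= s)%R, measurable B &
                                       A = [set a : D | B (a u)]]]).

Let past_setI s (A B : set D) : past s A -> past s B -> past s (A `&` B).
Proof. exact: (@measurableI _ (past_type s)). Qed.

Let past_eval s (B : set E) : (0 <= s)%R -> measurable B ->
  past s [set a | B (a s)].
Proof.
move=> s0 mB; apply: sub_sigma_algebra; exists s, B.
by rewrite s0 lexx.
Qed.

Let one_step n (B : set E) A : measurable B -> past (G n) A ->
  P (Xbar @^-1` A `&` [set w | B (Xbar w (G n.+1))]) =
  \int[P]_(w in Xbar @^-1` A)
    Q n (Xbar w (G n)) [set a | B (a (gamma n.+1)%:num)].
Proof.
move=> mB pA; have Gle : (0 <= G n <= G n.+1)%R by rewrite psum_ge0 psum_le.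
have [h [mh h0 Hh]] := Xbar_markov Gle mB.
pose C := [set a : D | B (a (gamma n.+1)%:num)].
have mC : measurable C.
  by have := eval_measurable (gamma n.+1)%:num measurableT mB; rewrite setTI.
have ZC : Z n @^-1` C = [set w | B (Xbar w (G n.+1))].
  by apply/seteqP; split => w; rewrite /preimage /C /mkset /shifted shiftE// psumS.
have := @markov_unique n C (EFin \o h) mC.
rewrite ZC; apply => //; first exact/measurable_EFinP.
Qed.

Let integral_preimage (A : set D) (f : Om -> \bar R) :
  \int[P]_(w in Xbar @^-1` A) f w = \int[P]_w ((\1_A (Xbar w))%:E * f w).
Proof.
rewrite integral_mkcond; apply: eq_integral => w _; rewrite /patch indicE.
rewrite -[w \in _]/(Xbar w \in A).
by case: (Xbar w \in A); rewrite ?mul1e ?mul0e.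
Qed.

Let Xbar_past_measurable s :
  measurable_fun setT (Xbar : Om -> past_type s).
Proof. by move=> _ A pA; rewrite setTI; exact: past_preimage pA. Qed.

Let one_step_fun n (f : E -> \bar R) : measurable_fun setT f ->
  (forall x, 0 <= f x) ->
  exists h : E -> \bar R, [/\ measurable_fun setT h, forall x, 0 <= h x &
    forall A, past (G n) A -> \int[P]_(w in Xbar @^-1` A) f (Xbar w (G n.+1)) =
      \int[P]_(w in Xbar @^-1` A) h (Xbar w (G n))].
Proof.
move=> mf f0; pose t := (gamma n.+1)%:num.
have mY x : measurable_fun setT (fun w => Y n x w t).
  exact: (measurableT_comp (eval_measurable t)).
pose Yt x : {RV P' >-> E} := HB.pack (fun w => Y n x w t)
  (isMeasurableFun.Build _ _ _ _ _ (mY x)).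
pose q x := distribution P' (Yt x).
have mq B : measurable B -> measurable_fun setT (fun x => q x B).
  move=> mB; apply: (@Q_measurable n [set a : D | B (a t)]).
  by have := eval_measurable t measurableT mB; rewrite setTI.
exists (fun x => \int[q x]_y f y); split.
- exact: measurable_fun_integral_kernel.
- by move=> x; exact: integral_ge0.
move=> A pA; rewrite !integral_preimage.
pose p (a : past_type (G n)) : \bar R := (\1_A a)%:E.
have mp : measurable_fun setT p by apply/measurable_EFinP; exact: measurable_indic.
have p0 a : 0 <= p a by rewrite lee_fin.
have mqz B : measurable B -> measurable_fun setT (fun w => q (Xbar w (G n)) B).
  by move=> mB; apply: (measurableT_comp (mq B mB)); exact: Xbar_eval_measurable.
have rect (A' : set (past_type (G n))) B : measurable A' -> measurable B ->
    P (Xbar @^-1` A' `&` (fun w => Xbar w (G n.+1)) @^-1` B) =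
    \int[P]_(w in Xbar @^-1` A') q (Xbar w (G n)) B.
  by move=> pA' mB; exact: one_step.
exact: (ge0_integral_disintegration (@Xbar_past_measurable (G n))
  (Xbar_eval_measurable _) mqz rect mp p0 mf f0).
Qed.

(** Events about finitely many steps of the scheme, by induction on the number
    of steps: the first one is absorbed in the past. *)
Let grid_cylinder N : forall n (B : nat -> set E), (forall i, measurable (B i)) ->
  exists h : E -> \bar R, [/\ measurable_fun setT h, forall x, 0 <= h x &
    forall A, past (G n) A ->
    P (Xbar @^-1` A `&` [set w | forall i, (i < N)%N -> B i (Xbar w (G (n + i)))]) =
      \int[P]_(w in Xbar @^-1` A) h (Xbar w (G n))].
Proof.
elim: N => [|N IH] n B mB.
  exists (cst 1); split => // A pA; rewrite integral_cst ?mul1e//.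
    by congr (P _); apply/seteqP; split => w //= [].
  exact: (past_preimage pA).
have [h1 [mh1 h10 Hh1]] := IH n.+1 (fun i => B i.+1) (fun i => mB i.+1).
have [h2 [mh2 h20 Hh2]] := one_step_fun n mh1 h10.
exists (fun x => (\1_(B 0%N) x)%:E * h2 x); split.
- by apply: emeasurable_funM => //; exact/measurable_EFinP/measurable_indic.
- by move=> x; rewrite mule_ge0// lee_fin.
move=> A pA; pose A' := A `&` [set a : D | B 0%N (a (G n))].
have pA' : past (G n) A'.
  by apply: past_setI => //; apply: past_eval => //; exact: psum_ge0.
rewrite (_ : _ `&` _ = Xbar @^-1` A' `&`
    [set w | forall i, (i < N)%N -> B i.+1 (Xbar w (G (n.+1 + i)))]).
  rewrite Hh1; last by apply: past_le pA'; exact: psum_le.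
  rewrite Hh2// !integral_preimage; apply: eq_integral => w _.
  by rewrite muleA -EFinM !indicE -natrM mulnb /A' in_setI.
apply/seteqP; split => w /=.
  move=> [Aw H]; split; first by split => //; have := H 0%N isT; rewrite addn0.
  by move=> i iN; have := H i.+1 iN; rewrite addnS.
move=> [[Aw H0] H]; split => // -[_|i iN]; first by rewrite addn0.
by rewrite addnS; exact: H.
Qed.

(** Events about finitely many coordinates; since the scheme is constant between
    the points of the time grid, they are events about finitely many steps. *)
Let cylinder (N : nat) (u : nat -> R) (B : nat -> set E) : set D :=
  [set a | forall j, (j < N)%N -> B j (a (u j))].

Let cylinder_law n N u B : (forall j, 0 <= u j)%R -> (forall j, measurable (B j)) ->
  forall A, past (G n) A -> P (Xbar @^-1` A `&` Z n @^-1` cylinder N u B) =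
     \int[P]_(w in Xbar @^-1` A) Q n (Xbar w (G n)) (cylinder N u B).
Proof.
move=> u0 mB.
have mC : measurable (cylinder N u B).
  rewrite (_ : cylinder N u B =
      \bigcap_j [set a : D | (j < N)%N -> B j (a (u j))]).
    apply: bigcapT_measurable => j; have [jN|jN] := boolP (j < N)%N.
      have := eval_measurable (u j) measurableT (mB j); rewrite setTI.
      by rewrite (_ : _ @^-1` _ = [set a : D | true -> B j (a (u j))])//;
        apply/seteqP; split => a /= => [H _|/(_ isT)].
    by rewrite [X in measurable X](_ : _ = setT)//; apply/seteqP.
  by apply/seteqP; split => a H j; [move=> _; exact: H|exact: (H j I)].
have [m Hm] := choice (fun j => psum_bracket n gamma_oo (u0 j)).
pose M := \max_(j < N) (m j).+1.
have mM j : (j < N)%N -> (m j < M)%N.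
  by move=> jN; exact: (@leq_bigmax _ (fun i : 'I_N => (m i).+1) (Ordinal jN)).
pose B' i := [set x : E | forall j, (j < N)%N -> m j = i -> B j x].
have mB' i : measurable (B' i).
  rewrite (_ : B' i = \bigcap_j [set x : E | (j < N)%N -> m j = i -> B j x]).
    apply: bigcapT_measurable => j.
    have [[jN mj]|H] := pselect ((j < N)%N /\ m j = i).
      rewrite (_ : [set x | _] = B j); first exact: mB.
      by apply/seteqP; split => x //= H; exact: H.
    rewrite [X in measurable X](_ : _ = setT)//.
    by apply/seteqP; split => // x _ jN mj; exfalso; exact: H.
  by apply/seteqP; split => x H j; [move=> _; exact: H|exact: (H j I)].
have [h [mh h0 Hh]] := grid_cylinder M n mB'.
apply: (markov_unique mC mh h0) => A pA; rewrite -Hh//; congr (P _).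
congr (_ `&` _).
have ZX w j : shifted gamma (Xbar w) n (u j) = Xbar w (G (n + m j)%N).
  by rewrite /shifted shiftE//; exact: Xbar_step.
apply/seteqP; split => w.
  by move=> H i iM j jN mj; rewrite -mj -ZX; exact: H.
by move=> H j jN; rewrite ZX; exact: (H _ (mM _ jN)).
Qed.

(** The Markov property is assumed for one future time only. It extends to cylinders
    by iteration, and to all events because cylinders generate the Borel sets. *)
Lemma scheme_future_law n A C : past (G n) A -> measurable C ->
  P (Xbar @^-1` A `&` Z n @^-1` C) =
  \int[P]_(w in Xbar @^-1` A) Q n (Xbar w (G n)) C.
Proof.
move=> pA mC; have mA := past_preimage pA.
pose K1 w : {measure set D -> \bar R} := \d_(Z n w).
pose K2 w : {measure set D -> \bar R} := Q n (Xbar w (G n)).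
have mK1 B : measurable B -> measurable_fun setT (K1 ^~ B).
  move=> mB; rewrite (_ : K1 ^~ B = (fun w => (\1_B (Z n w))%:E)).
    apply/measurable_EFinP; apply: measurableT_comp; last exact: shifted_measurable.
    exact: measurable_indic.
  by [].
have mK2 B : measurable B -> measurable_fun setT (K2 ^~ B).
  move=> mB; apply: (measurableT_comp (Q_measurable n mB)).
  exact: Xbar_eval_measurable.
have m1E B : measurable B ->
    mixture_on P mK1 mA B = P (Xbar @^-1` A `&` Z n @^-1` B).
  move=> mB; rewrite /mixture_on.
  rewrite (eq_integral (fun w => (\1_(Z n @^-1` B) w)%:E)); last first.
    by move=> w _; rewrite /K1 /= /dirac !indicE.
  rewrite integral_indic// 1?setIC//.
  by rewrite -[X in measurable X]setTI; exact: shifted_measurable.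
rewrite -m1E// -[RHS]/(mixture_on P mK2 mA C).
pose cyl := [set A : set D | exists N u B, [/\ forall j, (0 <= u j)%R,
  forall j, measurable (B j) & A = cylinder N u B]].
have coord_cyl : coordinate_sets `<=` cyl.
  move=> _ [t [B [t0 mB ->]]]; exists 1%N, (fun=> t), (fun=> B); split => //.
  by apply/seteqP; split => a H; [move=> j _; exact: H|exact: (H 0%N isT)].
have cyl_m : cyl `<=` measurable.
  move=> _ [N [u [B [u0 mB ->]]]].
  rewrite (_ : cylinder N u B =
      \bigcap_j [set a : D | (j < N)%N -> B j (a (u j))]).
    apply: bigcapT_measurable => j; have [jN|jN] := boolP (j < N)%N.
      have := eval_measurable (u j) measurableT (mB j); rewrite setTI.
      by rewrite (_ : _ @^-1` _ = [set a : D | true -> B j (a (u j))])//;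
        apply/seteqP; split => a /= => [H _|/(_ isT)].
    by rewrite [X in measurable X](_ : _ = setT)//; apply/seteqP.
  by apply/seteqP; split => a H j; [move=> _; exact: H|exact: (H j I)].
apply: (g_sigma_algebra_measure_unique cyl cyl_m (fun=> setT)).
- move=> _; exists 0%N, (fun=> 0%R), (fun=> setT); split => //.
  by apply/seteqP; split.
- by apply/seteqP; split => // a _; exists 0%N.
- move=> _ _ [N1 [u1 [B1 [u10 mB1 ->]]]] [N2 [u2 [B2 [u20 mB2 ->]]]].
  exists (N1 + N2)%N, (fun j => if (j < N1)%N then u1 j else u2 (j - N1)%N),
    (fun j => if (j < N1)%N then B1 j else B2 (j - N1)%N); split.
  + by move=> j; case: ifP.
  + by move=> j; case: ifP.
  apply/seteqP; split => a.
    move=> [H1 H2] j jN; case: ifPn => [jN1|]; first exact: H1.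
    by rewrite -leqNgt => Nj; apply: H2; rewrite ltn_subLR.
  move=> H; split => j jN.
    by have := H j (leq_trans jN (leq_addr _ _)); rewrite jN.
  have := H (N1 + j)%N; rewrite ltn_add2l => /(_ jN).
  by rewrite ltnNge leq_addr/= addKn.
- move=> _ [N [u [B [u0 mB ->]]]].
  rewrite -[LHS]/(mixture_on P mK1 mA (cylinder N u B)) m1E; last first.
    by apply: cyl_m; exists N, u, B.
  exact: cylinder_law.
- move=> _; rewrite -[X in (X < _)%E]/(mixture_on P mK1 mA setT).
  by rewrite m1E// (le_lt_trans (probability_le1 _ _)) ?ltry//;
    apply: measurableI => //; rewrite preimage_setT.
- by apply: (sub_sigma_algebra2 coord_cyl); exact: borel_coordinates.
Qed.

(** The form in which the Markov property is used: [p] depends on the past up to the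
    [n]-th step only, and [g] on the whole future. *)
Lemma scheme_markov n (p g : D -> \bar R) :
  measurable_fun setT p -> (forall a, 0 <= p a) ->
  measurable_fun setT g -> (forall a, 0 <= g a) ->
  \int[P]_w (p (stop (G n) (Xbar w)) * g (Z n w)) =
  \int[P]_w (p (stop (G n) (Xbar w)) *
    \int[P']_w' g (Y n (Z n w 0%R) w')).
Proof.
move=> mp p0 mg g0; have G0 := psum_ge0 gamma n.
have mK B : measurable B ->
    measurable_fun setT (fun w => Q n (Xbar w (G n)) B).
  move=> mB; apply: (measurableT_comp (Q_measurable n mB)).
  exact: Xbar_eval_measurable.
have mS : measurable_fun setT (fun w => stop (G n) (Xbar w)).
  by apply: (measurableT_comp (stop_measurable G0)).
rewrite (ge0_integral_disintegration mS (shifted_measurable n) mK _ mp p0 mg g0).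
  apply: eq_integral => w _; congr (_ * _).
  by rewrite shifted0 ge0_integral_distribution.
move=> A C mA mC; apply: (@scheme_future_law n (stop (G n) @^-1` A)) => //.
exact: stop_past.
Qed.

End scheme_markov.

(** * Weighted averages and the weights of the scheme *)

Section averages.
Context {R : realType}.
Variable eta : nat -> {posnum R}.
Local Notation H := (psum eta).
Implicit Types f g : nat -> R.

Lemma psumE n : H n = \sum_(k < n) (eta k.+1)%:num.
Proof. by rewrite /psum big_add1 big_mkord. Qed.

(** The integral of a function against an empirical measure. *)
Definition avg f n := (H n)^-1 * \sum_(k < n) (eta k.+1)%:num * f k.

Lemma avg0 f : avg f 0 = 0.
Proof. by rewrite /avg big_ord0 mulr0. Qed.

Lemma avgD f g n : avg (fun k => f k + g k) n = avg f n + avg g n.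
Proof.
rewrite /avg -[RHS]mulrDr -big_split /=; congr (_ * _); apply: eq_bigr => k _.
exact: mulrDr.
Qed.

Lemma avgZ c f n : avg (fun k => c * f k) n = c * avg f n.
Proof.
rewrite /avg [RHS]mulrCA [in RHS]mulr_sumr; congr (_ * _); apply: eq_bigr => k _.
exact: mulrCA.
Qed.

Lemma avgN f n : avg (fun k => - f k) n = - avg f n.
Proof.
rewrite (_ : (fun k => - f k) = fun k => -1 * f k); first by rewrite avgZ mulN1r.
by apply/funext => k; rewrite mulN1r.
Qed.

Lemma avgB f g n : avg (fun k => f k - g k) n = avg f n - avg g n.
Proof. by rewrite avgD avgN. Qed.

Lemma avg_cst c n : avg (cst c) n.+1 = c.
Proof. by rewrite /avg -mulr_suml -psumE mulrA mulVf ?mul1r// gt_eqF// psum_gt0. Qed.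

Lemma le_avg f g n : (forall k, (k < n)%N -> f k <= g k) -> avg f n <= avg g n.
Proof.
move=> fg; rewrite /avg ler_wpM2l ?psumV_ge0// ler_sum// => k _.
by rewrite ler_wpM2l// fg.
Qed.

Lemma avg_ge0 f n : (forall k, 0 <= f k) -> 0 <= avg f n.
Proof.
by move=> f0; rewrite /avg mulr_ge0 ?psumV_ge0// sumr_ge0// => k _; rewrite mulr_ge0.
Qed.

Lemma ler_norm_avg f n : `|avg f n| <= avg (fun k => `|f k|) n.
Proof.
rewrite /avg normrM ger0_norm ?psumV_ge0// ler_wpM2l ?psumV_ge0//.
rewrite (le_trans (ler_norm_sum _ _ _))// ler_sum// => k _.
by rewrite normrM ger0_norm.
Qed.

Lemma avg_le_cst f c n : 0 <= c -> (forall k, (k < n)%N -> f k <= c) -> avg f n <= c.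
Proof.
case: n => [|n] c0 fc; first by rewrite avg0.
by rewrite -[leRHS](avg_cst c n); apply: le_avg.
Qed.

Hypothesis eta_oo : H n @[n --> \oo] --> +oo.

Lemma psum_ge_near A : \forall n \near \oo, A <= H n.
Proof. by move/cvgryPge : eta_oo; apply. Qed.

(** The total weight diverges, so that finitely many terms do not matter. *)
Lemma avg_head f N e : 0 < e ->
  \forall n \near \oo, avg (fun k => if (k < N)%N then `|f k| else 0) n <= e.
Proof.
move=> e0; pose S := \sum_(k < N) (eta k.+1)%:num * `|f k|.
have S0 : 0 <= S by apply: sumr_ge0 => k _; rewrite mulr_ge0.
have : \forall n \near \oo, S / e + 1 <= H n by exact: psum_ge_near.
move=> [N1 _ HN1]; exists (maxn N N1) => // n /=; rewrite geq_max => /andP[Nn N1n].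
have Hn := HN1 n N1n; have Hn0 : 0 < H n.
  by rewrite (lt_le_trans _ Hn)// ltr_pwDr// divr_ge0// ltW.
rewrite /avg (_ : \sum_(k < n) _ = S).
  rewrite mulrC ler_pdivrMr// mulrC -ler_pdivrMr//.
  by rewrite (le_trans _ Hn)// lerDl.
rewrite /S (big_ord_widen _ (fun k => (eta k.+1)%:num * `|f k|) Nn) [RHS]big_mkcond.
by apply: eq_bigr => k _; case: ifP => _; rewrite ?mulr0.
Qed.

End averages.

Section weights.
Context {R : realType}.
Variables (gamma eta : nat -> {posnum R}).
Local Notation H := (psum eta).
Local Notation G := (psum gamma).
Hypothesis gamma_steps : steps gamma.
Hypothesis eta_oo : H n @[n --> \oo] --> +oo.

Lemma steps_le1 n : (gamma n.+1)%:num <= (gamma 1)%:num.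
Proof.
case: gamma_steps => dec _ _; elim: n => // n; exact: le_trans (dec n.+1 isT).
Qed.

(** As [H] is bounded below, a negative exponent can be replaced by 0. *)
Lemma C3_exponent eps : eps < 1 -> C3 gamma eta eps ->
  exists K e, [/\ 0 < K, 0 <= e < 1 &
    forall n, (eta n.+1)%:num <= K * (gamma n.+1)%:num * H n.+1 `^ e].
Proof.
move=> e1 [C HC].
have C0 : 0 < C.
  have := HC 1%N isT; rewrite -mulrA => /(lt_le_trans (gt0 (eta 1))).
  by rewrite pmulr_lgt0// mulr_gt0// powR_gt0// psum_gt0.
have [e0|e0] := leP 0 eps; first by exists C, eps; rewrite e0 e1; split => // n; exact: HC.
exists (C * H 1 `^ eps), 0; rewrite lexx ltr01 mulr_gt0 ?powR_gt0 ?psum_gt0//.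
split => // n; rewrite powRr0 mulr1 (le_trans (HC n.+1 isT))// mulrAC.
rewrite ler_wpM2r// ler_wpM2l// ?(ltW C0)//.
rewrite -[eps]opprK powRN [leRHS]powRN lef_pV2 ?posrE ?powR_gt0 ?psum_gt0//.
apply: ge0_ler_powR; rewrite ?nnegrE ?psum_ge0 ?psum_le// oppr_ge0; exact: ltW.
Qed.

(** The time spent by the grid in a window; the last step may overshoot it. *)
Lemma steps_window c d n : \sum_(k < n | c < G k < d) (gamma k.+1)%:num <=
  Num.max 0 (Num.min (G n) (d + (gamma 1)%:num) - c).
Proof.
elim: n => [|n IH]; first by rewrite big_ord0 le_max lexx.
rewrite big_mkcond big_ord_recr -big_mkcond /=.
have g1 := steps_le1 n; have gS := psumS gamma n.
have g0 : 0 < (gamma n.+1)%:num by [].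
case: ifPn => [/andP[cG Gd]|_].
  rewrite le_max; apply/orP; right.
  move: IH; rewrite max_r; last by rewrite subr_ge0 le_min; apply/andP; split; lra.
  rewrite !min_l; lra.
rewrite addr0 (le_trans IH)// ge_max !le_max lexx/=; apply/orP; right.
by rewrite lerD2r le_min !ge_min gS lerDl (ltW g0) lexx orbT.
Qed.

Variables (K e : R).
Hypothesis K0 : 0 < K.
Hypothesis e01 : 0 <= e < 1.
Hypothesis etaK : forall n, (eta n.+1)%:num <= K * (gamma n.+1)%:num * H n.+1 `^ e.

Definition close_steps S j k := (G k < G j + S) && (G j < G k + S).

(** Only pairs of indices within a time [S] of each other contribute to the second
    moment; there are few of them, as [eta] is at most [gamma * H ^ e]. *)
Lemma close_sum S n : 0 <= S ->
  \sum_(j < n) \sum_(k < n | close_steps S j k) (eta j.+1)%:num * (eta k.+1)%:num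
    <= K * (2 * S + (gamma 1)%:num) * H n * H n `^ e.
Proof.
move=> S0; have g0 : 0 < (gamma 1)%:num by [].
have row (j : 'I_n) : \sum_(k < n | close_steps S j k) (eta k.+1)%:num <=
    K * H n `^ e * (2 * S + (gamma 1)%:num).
  apply: (@le_trans _ _ (K * H n `^ e *
      \sum_(k < n | close_steps S j k) (gamma k.+1)%:num)).
    rewrite mulr_sumr ler_sum// => k _; rewrite (le_trans (etaK k))// mulrAC.
    have Hk : H k.+1 `^ e <= H n `^ e.
      move/andP: e01 => [e0 _].
      by apply: ge0_ler_powR; rewrite ?nnegrE ?psum_ge0 ?psum_le.
    by rewrite ler_wpM2r// ler_wpM2l// ltW.
  rewrite ler_wpM2l ?mulr_ge0 ?powR_ge0// ?(ltW K0)//.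
  rewrite (eq_bigl (fun k : 'I_n => G j - S < G k < G j + S)); last first.
    by move=> k; rewrite /close_steps andbC ltrBlDr.
  rewrite (le_trans (steps_window _ _ _))// ge_max addr_ge0 ?mulr_ge0// ?(ltW g0)//=.
  by rewrite lerBlDr ge_min; apply/orP; right; lra.
rewrite (_ : K * _ * _ * _ = \sum_(j < n) (eta j.+1)%:num *
    (K * H n `^ e * (2 * S + (gamma 1)%:num))); last first.
  by rewrite -mulr_suml -psumE; ring.
by apply: ler_sum => j _; rewrite -mulr_sumr ler_wpM2l.
Qed.

(** Since the exponent [e] is less than 1 and the steps vanish, a single weight is
    negligible with respect to the total. *)
Lemma psum_ratio r : 1 < r -> \forall n \near \oo, H n.+1 <= r * H n.
Proof.
move=> r1; case: gamma_steps => _ g0 _.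
have K1 : 0 < (1 - r^-1) / K.
  by rewrite divr_gt0// subr_gt0 invf_lt1// (lt_trans _ r1).
have : \forall n \near \oo, (gamma n)%:num <= (1 - r^-1) / K.
  by have /cvgrPdist_le /(_ _ K1) := g0; apply: filterS => n; rewrite sub0r normrN ger0_norm.
move=> [N1 _ HN1]; have [N2 _ HN2] := psum_ge_near eta_oo 1.
exists (maxn N1 N2) => // n /=; rewrite geq_max => /andP[n1 n2].
have h1 : 1 <= H n.+1 by rewrite HN2//= leqW.
have h0 : 0 < H n.+1 by rewrite (lt_le_trans ltr01).
have : (eta n.+1)%:num <= (1 - r^-1) * H n.+1.
  rewrite (le_trans (etaK n))//.
  have := HN1 n.+1 (leqW n1); rewrite ler_pdivlMr// mulrC => gn.
  apply: ler_pM; rewrite ?mulr_ge0// ?powR_ge0// ?(ltW K0)//.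
  by apply: ler1_powR => //; move/andP : e01 => [_ /ltW].
move: (psumS eta n) => ->; set x := H n; set y := (eta n.+1)%:num => yr.
have r0 : 0 < r by rewrite (lt_trans _ r1).
have : r * y <= (r - 1) * (x + y).
  have := ler_wpM2l (ltW r0) yr; rewrite mulrA mulrBr mulr1 divff//.
  by rewrite gt_eqF.
lra.
Qed.

Let ratio_near (r : R) : 1 < r -> exists J, forall j, (J <= j)%N ->
  (j.+2)%:R <= r * (j.+1)%:R.
Proof.
move=> r1; exists (truncn (r - 1)^-1) => j Jj.
have r0 : 0 < r - 1 by rewrite subr_gt0.
have : (r - 1)^-1 <= j.+1%:R.
  by rewrite (le_trans (ltW (truncnS_gt _)))// ler_nat ltnS.
rewrite -[X in X <= _]mulr1 ler_pdivrMl//.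
have -> : j.+2%:R = j.+1%:R + 1 :> R by rewrite -[j.+2]addn1 natrD.
lra.
Qed.

Let ratio_near_pow p (r : R) : 1 < r -> exists J, forall j, (J <= j)%N ->
  (j.+2)%:R ^+ p <= r * (j.+1)%:R ^+ p.
Proof.
elim: p r => [|p IH] r r1; first by exists 0%N => j _; rewrite !expr0 mulr1 ltW.
have [q [q0 q1 ->]] : exists q, [/\ 0 <= q, 1 < q & r = q * q].
  have r0 : 0 < r by rewrite (lt_trans _ r1).
  exists (Num.sqrt r); split; first exact: sqrtr_ge0.
    by rewrite -{1}sqrtr1 ltr_sqrt.
  by rewrite -expr2 sqr_sqrtr// ltW.
have [J1 HJ1] := IH _ q1; have [J2 HJ2] := ratio_near q1.
exists (maxn J1 J2) => j; rewrite geq_max => /andP[/HJ1 h1 /HJ2 h2].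
by rewrite !exprS mulrACA ler_pM// exprn_ge0.
Qed.

(** Times along which [H] grows polynomially: fast enough for the powers of [H] to
    be summable, and slowly enough for consecutive values to be equivalent. *)
Lemma sparse_times (delta : R) : 0 < delta -> exists N : nat -> nat,
  [/\ forall j, 1 <= H (N j), forall M, \forall j \near \oo, (M <= N j)%N,
      forall J, \sum_(j < J) H (N j) `^ (- delta) <= 2 &
      forall r J, 1 < r -> \forall n \near \oo, exists j,
        [/\ (J <= j)%N, (N j <= n <= N j.+1)%N & H (N j.+1) <= r * H (N j)]].
Proof.
move=> d0; pose p := (truncn (2 / delta)).+1.
have pd : 2 <= p%:R * delta by rewrite -ler_pdivrMr// ltW// truncnS_gt.
have ex j : exists n, (j.+1)%:R ^+ p <= H n.
  by have [n _ Hn] := psum_ge_near eta_oo (j.+1%:R ^+ p); exists n; apply: Hn => /=.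
pose N j := ex_minn (ex j).
have NH j : (j.+1)%:R ^+ p <= H (N j) by rewrite /N; case: ex_minnP.
have Nmin j n : (j.+1)%:R ^+ p <= H n -> (N j <= n)%N.
  by rewrite /N; case: ex_minnP => m _; apply.
have H1 j : 1 <= H (N j).
  by rewrite (le_trans _ (NH j))// exprn_ege1// ler1n.
exists N; split => //.
- move=> M; exists (truncn (H M)) => // j /= Mj; rewrite leqNgt; apply/negP => jM.
  have := le_trans (NH j) (psum_le eta (ltnW jM)); rewrite leNgt => /negP; apply.
  rewrite (lt_le_trans (truncnS_gt _))// (@le_trans _ _ j.+1%:R)// ?ler_nat//.
  by rewrite -[X in X <= _]expr1 ler_weXn2l// ler1n.
- move=> J; apply: (@le_trans _ _ (2 - 2 / J.+1%:R)); last first.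
    by rewrite lerBlDl lerDr divr_ge0.
  elim: J => [|J IH]; first by rewrite big_ord0 divr1 subrr.
  rewrite big_ord_recr /=.
  have j1 : 1 <= J.+1%:R :> R by rewrite ler1n.
  have t1 : H (N J) `^ (- delta) <= (J.+1%:R ^+ 2)^-1.
    rewrite powRN lef_pV2 ?posrE ?exprn_gt0 ?powR_gt0//; last first.
      by rewrite (lt_le_trans _ (H1 J)).
    apply: (@le_trans _ _ ((J.+1%:R ^+ p) `^ delta)).
      by rewrite -!powR_mulrn// -powRrM; apply: ler_powR.
    apply: ge0_ler_powR; rewrite ?nnegrE ?exprn_ge0// ?psum_ge0//; exact: ltW.
  rewrite (le_trans (lerD IH t1))//.
  have -> : J.+2%:R = J.+1%:R + 1 :> R by rewrite -[J.+2]addn1 natrD.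
  move: (J.+1%:R) j1 => x x1.
  have x0 : x != 0 by rewrite gt_eqF// (lt_le_trans _ x1).
  have x10 : x + 1 != 0 by rewrite gt_eqF// addr_gt0// (lt_le_trans _ x1).
  rewrite -subr_ge0 (_ : _ - _ = (x - 1) / (x ^+ 2 * (x + 1))); last first.
    by field; rewrite ?x0 ?x10.
  have x10' : 0 <= x by rewrite (le_trans _ x1).
  by rewrite divr_ge0 ?subr_ge0// mulr_ge0 ?exprn_ge0 ?addr_ge0.
- move=> r J r1.
  have r0 : 0 < r by rewrite (lt_trans _ r1).
  have [q [q0 s1 rE]] : exists q, [/\ 0 <= q, 1 < q & r = q * q].
    exists (Num.sqrt r); split; first exact: sqrtr_ge0.
      by rewrite -{1}sqrtr1 ltr_sqrt.
    by rewrite -expr2 sqr_sqrtr// ltW.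
  have [J' HJ'] := ratio_near_pow p s1.
  have [M _ HM] := psum_ratio s1.
  have [M' _ HM'] := psum_ge_near eta_oo ((maxn J J').+1%:R ^+ p).
  exists (maxn M M') => // n /=; rewrite geq_max => /andP[Mn M'n].
  have exj : exists j, H n < j.+2%:R ^+ p.
    exists (truncn (H n)); apply: lt_le_trans (truncnS_gt _) _.
    rewrite (@le_trans _ _ ((truncn (H n)).+2%:R))// ?ler_nat//.
    by rewrite -[X in X <= _]expr1 ler_weXn2l// ler1n.
  case: (ex_minnP exj) => j Hj jmin.
  have Jj : (maxn J J' <= j)%N.
    rewrite leqNgt; apply/negP => jJ; have := le_lt_trans (HM' n M'n) Hj.
    by rewrite ltNge lerXn2r ?nnegrE// ler_nat ltnS.
  move: (Jj); rewrite geq_max => /andP[jJ jJ'].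
  have Hj1 : j.+1%:R ^+ p <= H n.
    case: j jmin {Hj Jj jJ jJ'} => [|j] jmin.
      by rewrite expr1n (le_trans _ (HM' n M'n))// exprn_ege1// ler1n.
    by rewrite leNgt; apply/negP => /jmin; rewrite ltnn.
  have nN : (n < N j.+1)%N.
    rewrite ltnNge; apply/negP => Nn; have := le_trans (NH j.+1) (psum_le eta Nn).
    by rewrite leNgt Hj.
  exists j; split => //; first by rewrite (Nmin _ _ Hj1) ltnW.
  have [m mE] : exists m, N j.+1 = m.+1.
    by exists (N j.+1).-1; rewrite prednK// (leq_trans _ nN).
  have mH : H m < j.+2%:R ^+ p.
    rewrite ltNge; apply/negP => /(Nmin j.+1); rewrite mE ltnn//.
  have Mm : (M <= m)%N by rewrite (leq_trans Mn)// -ltnS -mE.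
  rewrite mE (le_trans (HM _ Mm))// rE -mulrA.
  rewrite ler_wpM2l// (le_trans (ltW mH))// (le_trans (HJ' _ jJ'))//.
  by rewrite ler_wpM2l.
Qed.

End weights.

(** * Fluctuations of the empirical means *)

Section bounded_means.
Context {dO : measure_display} {R : realType} {Om : measurableType dO}.
Variable P : probability Om R.
Implicit Types f g : Om -> R.

Definition bounded_rv f := measurable_fun setT f /\ exists b, forall w, `|f w| <= b.

Lemma bounded_rv_cst c : bounded_rv (cst c).
Proof. by split => //; exists `|c|. Qed.

Lemma bounded_rvD f g : bounded_rv f -> bounded_rv g -> bounded_rv (fun w => f w + g w).
Proof.
move=> [mf [b fb]] [mg [c gc]]; split; first exact: measurable_funD.
by exists (b + c) => w; rewrite (le_trans (ler_normD _ _))// lerD.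
Qed.

Lemma bounded_rvM f g : bounded_rv f -> bounded_rv g -> bounded_rv (fun w => f w * g w).
Proof.
move=> [mf [b fb]] [mg [c gc]]; split; first exact: measurable_funM.
by exists (b * c) => w; rewrite normrM ler_pM.
Qed.

Lemma bounded_rvZ c f : bounded_rv f -> bounded_rv (fun w => c * f w).
Proof. exact: (bounded_rvM (bounded_rv_cst c)). Qed.

Lemma bounded_rvB f g : bounded_rv f -> bounded_rv g -> bounded_rv (fun w => f w - g w).
Proof.
move=> bf bg; rewrite (_ : (fun w => _) = fun w => f w + -1 * g w).
  by apply: bounded_rvD => //; exact: bounded_rvZ.
by apply/funext => w; rewrite mulN1r.
Qed.

Lemma bounded_rv_integrable f : bounded_rv f -> P.-integrable setT (EFin \o f).
Proof.
move=> [mf [b fb]]; apply: measurable_bounded_integrable => //.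
  by rewrite (le_lt_trans (probability_le1 _ _)) ?ltry.
exists b; split; first exact: num_real.
by move=> M bM w _ /=; exact: le_trans (fb w) (ltW bM).
Qed.

Definition mean f : R := \int[P]_w f w.

Lemma meanE f : bounded_rv f -> (mean f)%:E = (\int[P]_w (f w)%:E)%E.
Proof.
move=> bf; rewrite /mean /Rintegral fineK// integrable_fin_num//.
exact: bounded_rv_integrable.
Qed.

Lemma meanD f g : bounded_rv f -> bounded_rv g ->
  mean (fun w => f w + g w) = mean f + mean g.
Proof. by move=> bf bg; rewrite /mean RintegralD//; exact: bounded_rv_integrable. Qed.

Lemma meanZ c f : bounded_rv f -> mean (fun w => c * f w) = c * mean f.
Proof. by move=> bf; rewrite /mean RintegralZl//; exact: bounded_rv_integrable. Qed.

Lemma meanB f g : bounded_rv f -> bounded_rv g ->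
  mean (fun w => f w - g w) = mean f - mean g.
Proof. by move=> bf bg; rewrite /mean RintegralB//; exact: bounded_rv_integrable. Qed.

Lemma le_mean f g : bounded_rv f -> bounded_rv g -> (forall w, f w <= g w) ->
  mean f <= mean g.
Proof. by move=> bf bg fg; apply: le_Rintegral => //; exact: bounded_rv_integrable. Qed.

Lemma mean_cst c : mean (cst c) = c.
Proof. by rewrite /mean Rintegral_cst//= probability_setT mulr1. Qed.

Lemma mean_le_cst f c : bounded_rv f -> (forall w, f w <= c) -> mean f <= c.
Proof.
by move=> bf fc; rewrite -[leRHS](mean_cst c); apply: le_mean => //; exact: bounded_rv_cst.
Qed.

Lemma mean_sum (I : Type) (r : seq I) (F : I -> Om -> R) :
  (forall k, bounded_rv (F k)) ->
  bounded_rv (fun w => \sum_(k <- r) F k w) /\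
  mean (fun w => \sum_(k <- r) F k w) = \sum_(k <- r) mean (F k).
Proof.
move=> bF; elim: r => [|k r [IH1 IH2]].
  rewrite (_ : (fun w => _) = cst 0); last by apply/funext => w; rewrite big_nil.
  by rewrite big_nil mean_cst; split => //; exact: bounded_rv_cst.
rewrite (_ : (fun w => _) = fun w => F k w + \sum_(k <- r) F k w); last first.
  by apply/funext => w; rewrite big_cons.
by rewrite meanD// IH2 big_cons; split => //; exact: bounded_rvD.
Qed.

(** The sum of the series has a finite mean and is thus almost surely finite. *)
Lemma ae_cvg0_summable (S : nat -> Om -> R) (a : nat -> R) (c : R) :
  (forall j, measurable_fun setT (S j)) -> (forall j w, 0 <= S j w) ->
  (forall j, \int[P]_w (S j w)%:E <= (a j)%:E)%E ->
  (forall J, \sum_(j < J) a j <= c) ->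
  {ae P, forall w, S j w @[j --> \oo] --> (0 : R)}.
Proof.
move=> mS S0 Sa ac.
have mES j : measurable_fun setT (fun w => (S j w)%:E) by exact/measurable_EFinP.
pose T w := (\sum_(j <oo) (S j w)%:E)%E.
have intT : (\int[P]_w T w < +oo)%E.
  rewrite integral_nneseries//; last by move=> j w _; rewrite lee_fin.
  apply: (@le_lt_trans _ _ c%:E); last exact: ltry.
  apply: lime_le.
    by apply: is_cvg_nneseries => n _ _; apply: integral_ge0 => w _; rewrite lee_fin.
  apply: nearW => J; rewrite big_mkord.
  apply: (@le_trans _ _ (\sum_(j < J) (a j)%:E)%E); first exact: lee_sum.
  by rewrite sumEFin lee_fin.
have T0 w : (0 <= T w)%E by apply: nneseries_ge0 => n _ _; rewrite lee_fin.
have iT : P.-integrable setT T.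
  apply/integrableP; split.
    by apply: ge0_emeasurable_sum => // k w _ _; rewrite lee_fin.
  by under eq_integral do rewrite gee0_abs//.
have := integrable_ae measurableT iT; apply: filterS => w /(_ I) Tw.
apply: cvg_series_cvg_0.
apply: nondecreasing_is_cvgn.
  by apply: nondecreasing_series => k _ _; exact: S0.
exists (fine (T w)) => _ [n _ <-].
rewrite -lee_fin fineK// /series /= -sumEFin.
by apply: nneseries_lim_ge => k _ _; rewrite lee_fin.
Qed.

Lemma mean_cvg (f_ : nat -> Om -> R) (f : Om -> R) c :
  (forall n, measurable_fun setT (f_ n)) -> measurable_fun setT f ->
  (forall n w, `|f_ n w| <= c) -> (forall w, `|f w| <= c) ->
  {ae P, forall w, f_ n w @[n --> \oo] --> f w} ->
  mean (f_ n) @[n --> \oo] --> mean f.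
Proof.
move=> mf_ mf fc_ fc cv.
have mE n : measurable_fun setT (EFin \o f_ n) by exact/measurable_EFinP.
have mEf : measurable_fun setT (EFin \o f) by exact/measurable_EFinP.
have cvE : {ae P, forall w, setT w -> (EFin \o f_ n) w @[n --> \oo] --> (EFin \o f) w}.
  by apply: filterS cv => w cw _; apply: cvg_EFin; [exact: nearW|exact: cw].
have ic : P.-integrable setT (cst c%:E) by exact: finite_measure_integrable_cst.
have fcE : {ae P, forall w n, setT w -> (`|(EFin \o f_ n) w| <= cst c%:E w)%E}.
  by apply: aeW => w n _; rewrite /= lee_fin.
have [_ _ H] := dominated_convergence measurableT mE mEf cvE ic fcE.
move: H; rewrite -(@meanE f); last by split => //; exists c.
rewrite (_ : (fun n => _) = fun n => (mean (f_ n))%:E); first by move=> /fine_cvg.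
by apply/funext => n; rewrite meanE//; split => //; exists c.
Qed.

End bounded_means.

Section cadlag_extensionality.
Context {R : realType} {d : nat}.

Lemma cadlag_ext (a b : cadlag R d) : (forall t, a t = b t) -> a = b.
Proof.
case: a b => [f f1 f2 f3] [g g1 g2 g3] /= fg.
have E : f = g by apply/funext.
by move: g1 g2 g3; rewrite -E => g1 g2 g3; congr Cadlag; exact: Prop_irrelevance.
Qed.

Lemma stop_idem (S : R) (a : cadlag R d) : stop S (stop S a) = stop S a.
Proof.
apply: cadlag_ext => t; rewrite !stopE [Num.min (Num.min t S) S]min_l//.
by rewrite ge_min lexx orbT.
Qed.

(** A functional of the shifted path up to time [S] is not affected when the path
    is stopped later. *)
Lemma stop_shift_stop (s S u : R) (a : cadlag R d) : 0 <= S -> s + S <= u ->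
  stop S (Defs.shift s (stop u a)) = stop S (Defs.shift s a).
Proof.
move=> S0 sSu; apply: cadlag_ext => t; rewrite !stopE /= min_l//.
apply: le_trans sSu; rewrite lerD2l ge_max S0 andbT.
by rewrite ge_min lexx orbT.
Qed.

End cadlag_extensionality.

Section fluctuations.
Context {R : realType} {d : nat} {dO dO' : measure_display}
  {Om : measurableType dO} {Om' : measurableType dO'}.
Local Notation E := 'rV[R]_d.
Local Notation D := (cadlag R d).
Variables (P : probability Om R) (P' : probability Om' R)
  (gamma eta : nat -> {posnum R}) (Xbar : {RV P >-> D})
  (Y : nat -> E -> {RV P' >-> D}).
Hypothesis gamma_steps : steps gamma.
Hypothesis Xbar_step : forall w, stepwise_constant gamma (Xbar w).
Hypothesis Xbar_markov : nonhomogeneous_markov Xbar.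
Hypothesis Xbar_law : forall n, conditional_law P
  (fun w => shifted gamma (Xbar w) n)
  (fun w => shifted gamma (Xbar w) n 0%R)
  (fun x => distribution P' (Y n x)).

Local Notation G := (psum gamma).
Local Notation H := (psum eta).
Local Notation Z := (fun n w => shifted gamma (Xbar w) n).

Lemma steps_oo : psum gamma n @[n --> \oo] --> +oo.
Proof. by case: gamma_steps. Qed.

(** The conditional mean of [g] over the future of the scheme, in a version that makes
    sense at every point. *)
Definition cond (g : D -> R) n (x : E) : R := mean P' (fun w => g (Y n x w)).

Section bounded_functional.
Variables (g : D -> R) (b S : R).
Hypothesis mg : measurable_fun setT g.
Hypothesis g0b : forall a, 0 <= g a <= b.
Hypothesis S0 : 0 <= S.
Hypothesis gS : forall a, g (stop S a) = g a.

Let b0 : 0 <= b.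
Proof. by have /andP[] := g0b (cadlag_cst 0); exact: le_trans. Qed.

Let g_le a : `|g a| <= b.
Proof. by have /andP[g0 gb] := g0b a; rewrite ger0_norm. Qed.

Lemma bounded_Y n x : bounded_rv (fun w => g (Y n x w)).
Proof.
split; last by exists b => w; exact: g_le.
exact: measurableT_comp.
Qed.

Lemma condE n x : (cond g n x)%:E = (\int[P']_w (g (Y n x w))%:E)%E.
Proof. by rewrite /cond meanE//; exact: bounded_Y. Qed.

Lemma cond_ge0 n x : 0 <= cond g n x.
Proof. by apply: Rintegral_ge0 => w _; have /andP[] := g0b (Y n x w). Qed.

Lemma cond_le n x : cond g n x <= b.
Proof.
by apply: mean_le_cst; [exact: bounded_Y|move=> w; have /andP[] := g0b (Y n x w)].
Qed.

Lemma cond_measurable n : measurable_fun setT (cond g n).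
Proof.
apply/measurable_EFinP.
rewrite (_ : _ \o _ = fun x => (\int[distribution P' (Y n x)]_a (g a)%:E)%E).
  apply: measurable_fun_integral_kernel.
  - by move=> C mC; exact: (Q_measurable Xbar_law).
  - by move=> a; rewrite lee_fin; have /andP[] := g0b a.
  - exact/measurable_EFinP.
apply/funext => x /=; rewrite condE ge0_integral_distribution//.
  exact/measurable_EFinP.
by move=> a; rewrite lee_fin; have /andP[] := g0b a.
Qed.

Definition dev n w := g (Z n w) - cond g n (Z n w 0).

Lemma bounded_gZ n : bounded_rv (fun w => g (Z n w)).
Proof.
split; last by exists b => w; exact: g_le.
by apply: (measurableT_comp mg); exact: shifted_measurable.
Qed.

Lemma bounded_condZ n : bounded_rv (fun w => cond g n (Z n w 0)).
Proof.
split; last first.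
  by exists b => w; rewrite ger0_norm ?cond_ge0 ?cond_le.
apply: (measurableT_comp (cond_measurable n)).
apply: (measurableT_comp (eval_measurable 0)); exact: shifted_measurable.
Qed.

Lemma bounded_dev n : bounded_rv (dev n).
Proof. by apply: bounded_rvB; [exact: bounded_gZ|exact: bounded_condZ]. Qed.

Lemma dev_le n w : `|dev n w| <= b.
Proof.
have /andP[g0 gb] := g0b (Z n w).
have c0 := cond_ge0 n (Z n w 0); have cb := cond_le n (Z n w 0).
by rewrite ler_norml /dev; apply/andP; split; lra.
Qed.

(** The earlier deviation only depends on the path up to the later index, where
    the Markov property makes the later one centered. *)
Lemma dev_orthogonal j k : G j + S <= G k ->
  mean P (fun w => dev j w * dev k w) = 0.
Proof.
move=> jk.
have markov := scheme_markov steps_oo Xbar_step Xbar_markov Xbar_law.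
pose u (a : D) := g (Defs.shift (G j) a) - cond g j (a (G j)) + b.
have mu : measurable_fun setT u.
  apply: measurable_funD => //; apply: measurable_funB.
    exact: (measurableT_comp mg (shift_measurable _)).
  exact: (measurableT_comp (cond_measurable j) (eval_measurable _)).
have u0 a : 0 <= u a.
  have /andP[g0 _] := g0b (Defs.shift (G j) a); have := cond_le j (a (G j)).
  by rewrite /u; lra.
have uE w : u (stop (G k) (Xbar w)) = dev j w + b.
  rewrite /u /dev -gS stop_shift_stop// gS stopE shifted0 min_l//.
  by rewrite (le_trans _ jk)// lerDl.
have bu : bounded_rv (fun w => dev j w + b).
  by apply: bounded_rvD; [exact: bounded_dev|exact: bounded_rv_cst].
have centered (v : D -> R) : measurable_fun setT v -> (forall a, 0 <= v a) ->
    bounded_rv (fun w => v (stop (G k) (Xbar w))) ->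
    mean P (fun w => v (stop (G k) (Xbar w)) * dev k w) = 0.
  move=> mv v0 bv; rewrite /dev; under eq_fun do rewrite mulrBr.
  have bg := bounded_rvM bv (bounded_gZ k).
  have bc := bounded_rvM bv (bounded_condZ k).
  rewrite meanB//; apply/eqP; rewrite subr_eq0; apply/eqP.
  apply/EFin_inj; rewrite !meanE//.
  have mv' : measurable_fun setT (EFin \o v) by exact/measurable_EFinP.
  have mg' : measurable_fun setT (EFin \o g) by exact/measurable_EFinP.
  have v0' a : (0 <= (EFin \o v) a)%E by rewrite lee_fin.
  have g0' a : (0 <= (EFin \o g) a)%E by rewrite lee_fin; have /andP[] := g0b a.
  have /= := markov k _ _ mv' v0' mg' g0'.
  under eq_integral do rewrite -EFinM.
  move=> ->.
  by apply: eq_integral => w _; rewrite EFinM condE.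
have c1 := centered u mu u0; have c2 := centered (cst b) _ (fun=> b0).
have bdk := bounded_dev k.
have bjk : bounded_rv (fun w => dev j w * dev k w).
  by apply: bounded_rvM; exact: bounded_dev.
have := c1; rewrite (_ : (fun w => u _) = fun w => dev j w + b); last exact/funext.
move=> /(_ bu).
rewrite (_ : (fun w => u _ * _) = fun w => dev j w * dev k w + b * dev k w); last first.
  by apply/funext => w; rewrite uE mulrDl.
rewrite meanD//; last exact: bounded_rvZ.
by rewrite c2 ?addr0//; exact: bounded_rv_cst.
Qed.

Variables (K e : R).
Hypothesis K0 : 0 < K.
Hypothesis e01 : 0 <= e < 1.
Hypothesis etaK : forall n, (eta n.+1)%:num <= K * (gamma n.+1)%:num * H n.+1 `^ e.

(** By orthogonality, only pairs of close indices contribute to the second moment. *)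
Lemma dev_avg_L2 n : (\int[P]_w ((avg eta (fun k => dev k w) n.+1) ^+ 2)%:E <=
  (b ^+ 2 * (K * (2 * S + (gamma 1)%:num)) * H n.+1 `^ (e - 1))%:E)%E.
Proof.
set N := n.+1; have H0 : 0 < H N by exact: psum_gt0.
pose f j k w := (eta j.+1)%:num * (eta k.+1)%:num * (dev j w * dev k w).
have bjk j k : bounded_rv (fun w => dev j w * dev k w).
  by apply: bounded_rvM; exact: bounded_dev.
have bf j k : bounded_rv (f j k) by exact: bounded_rvZ.
have sqE w : (avg eta (fun k => dev k w) N) ^+ 2 =
    (H N) ^- 2 * \sum_(j < N) \sum_(k < N) f j k w.
  rewrite /avg exprMn exprVn expr2 [in LHS]expr2; congr (_ * _).
  rewrite mulr_suml; apply: eq_bigr => j _; rewrite mulr_sumr.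
  by apply: eq_bigr => k _; rewrite /f mulrACA.
have bsum j : bounded_rv (fun w => \sum_(k < N) f j k w).
  by case: (@mean_sum _ _ _ P 'I_N (index_enum 'I_N) (fun k => f j k)) => // k.
have [bS mS] := @mean_sum _ _ _ P 'I_N (index_enum 'I_N)
  (fun j w => \sum_(k < N) f j k w) bsum.
under eq_integral do rewrite sqE.
rewrite -meanE; last exact: bounded_rvZ.
rewrite lee_fin meanZ// mS.
have fjk (j k : 'I_N) : mean P (f j k) <=
    if close_steps gamma S j k then
      b ^+ 2 * ((eta j.+1)%:num * (eta k.+1)%:num) else 0.
  rewrite meanZ//; case: ifPn => [_|].
    rewrite mulrC ler_wpM2r ?mulr_ge0//; apply: mean_le_cst => // w.
    by rewrite (le_trans (ler_norm _))// normrM expr2 ler_pM ?dev_le.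
  rewrite /close_steps negb_and -!leNgt => /orP[jk|kj].
    by rewrite dev_orthogonal ?mulr0.
  rewrite (_ : (fun w => _) = fun w => dev k w * dev j w).
    by rewrite dev_orthogonal ?mulr0.
  by apply/funext => w; rewrite mulrC.
apply: (@le_trans _ _ (H N ^- 2 * (b ^+ 2 *
    (K * (2 * S + (gamma 1)%:num) * H N * H N `^ e)))).
  rewrite ler_wpM2l ?invr_ge0 ?exprn_ge0 ?(ltW H0)//.
  apply: le_trans (ler_wpM2l (sqr_ge0 b) (close_sum gamma_steps K0 e01 etaK N S0)).
  rewrite mulr_sumr; apply: ler_sum => j _.
  have [_ ->] := @mean_sum _ _ _ P 'I_N (index_enum 'I_N) (fun k => f j k) (bf j).
  rewrite mulr_sumr [leRHS]big_mkcond; apply: ler_sum => k _.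
  by rewrite (le_trans (fjk _ _))//; case: ifP.
rewrite powRB ?powRr1 ?(ltW H0)//; last by rewrite (gt_eqF H0) implybT.
rewrite le_eqVlt; apply/orP; left; apply/eqP; field.
by rewrite gt_eqF.
Qed.

End bounded_functional.
End fluctuations.

(** * Locally uniform convergence of the conditional means *)

Section distance_events.
Context {R : realType} {d : nat} {dO : measure_display} {Om : measurableType dO}.
Local Notation E := 'rV[R]_d.
Local Notation D := (cadlag R d).

Lemma norm_sub_measurable (f g : Om -> E) :
  measurable_fun setT f -> measurable_fun setT g ->
  measurable_fun setT (fun w => `|f w - g w|).
Proof.
move=> mf mg.
rewrite (_ : (fun w => _) =
    fun w => \big[Num.max/0]_ij `|f w ij.1 ij.2 - g w ij.1 ij.2|); last first.
  apply/funext => w; rewrite [LHS]/Num.norm /= mx_normrE.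
  by apply: eq_bigr => ij _; rewrite !mxE.
have mc (h : Om -> E) i j : measurable_fun setT h ->
    measurable_fun setT (fun w => h w i j).
  move=> mh; apply: (@measurableT_comp _ _ _ _ _ _ (fun x : E => x i j)) => //.
  apply: continuous_measurable_rV; exact: coord_continuous.
elim: (index_enum _) => [|ij s IH].
  by rewrite (_ : (fun w => _) = cst 0)//; apply/funext => w; rewrite big_nil.
rewrite (_ : (fun w => _) = fun w => Num.max `|f w ij.1 ij.2 - g w ij.1 ij.2|
    (\big[Num.max/0]_(ij <- s) `|f w ij.1 ij.2 - g w ij.1 ij.2|)); last first.
  by apply/funext => w; rewrite big_cons.
apply: measurable_maxr => //; apply: measurableT_comp => //.
by apply: measurable_funB; exact: mc.
Qed.

Lemma measurable_gt (f : Om -> R) (c : R) : measurable_fun setT f ->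
  measurable [set w | c < f w].
Proof.
move=> mf; rewrite (_ : [set w | c < f w] = f @^-1` `]c, +oo[%classic).
  by rewrite -[X in measurable X]setTI; exact: mf.
by apply/seteqP; split => w /=; rewrite in_itv/= andbT.
Qed.

(** By right continuity the supremum over [[0, T]] can be taken over rational
    times truncated to that interval. *)
Lemma sup_dist_measurable (A B : Om -> D) (T e : R) : 0 <= T ->
  measurable_fun setT A -> measurable_fun setT B ->
  measurable [set w | (e%:E <= sup_on T (fun t => `|A w t - B w t|%R))%E].
Proof.
move=> T0 mA mB.
pose c (q : rat) := Num.min (Num.max 0 (ratr q)) T : R.
have c0T q : 0 <= c q <= T.
  by rewrite /c le_min le_max lexx T0/= ge_min lexx orbT.
have mAB t : measurable_fun setT (fun w => `|A w t - B w t|).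
  by apply: norm_sub_measurable; apply: (measurableT_comp (eval_measurable _)).
rewrite (_ : [set w | _] =
    \bigcap_n \bigcup_q [set w | e - n.+1%:R^-1 < `|A w (c q) - B w (c q)|]).
  apply: bigcapT_measurable => n; apply: bigcupT_measurable_rat => q.
  by apply: measurable_gt; exact: mAB.
apply/seteqP; split => w /=.
  move=> H n _; have : ((e - n.+1%:R^-1)%:E < sup_on T (fun t => `|A w t - B w t|%R))%E.
    by rewrite (lt_le_trans _ H)// lte_fin ltrBlDr ltrDl.
  move=> /ereal_sup_gt [_ [t /= + <-]]; rewrite in_itv /= lte_fin => /andP[t0 tT].
  set k := e - _ => kt.
  have [Tt|tltT] := leP T t.
    exists (ratr (truncn T).+1%:R) => //=.
    rewrite (_ : c _ = t)//; apply/le_anti; rewrite /c.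
    have tE : t = T by apply/le_anti; rewrite tT Tt.
    rewrite tE ge_min lexx orbT/= le_min lexx andbT le_max; apply/orP; right.
    by rewrite ratr_nat ratr_nat ltW// truncnS_gt.
  have e0 : 0 < (`|A w t - B w t| - k) / 2 by rewrite divr_gt0// subr_gt0.
  have /cvgrPdist_lt/(_ _ e0) := @path_right_continuous _ _ (A w) t.
  rewrite /at_right => -[h1 /= h10 Hh1].
  have /cvgrPdist_lt/(_ _ e0) := @path_right_continuous _ _ (B w) t.
  rewrite /at_right => -[h2 /= h20 Hh2].
  have [|q] := @rat_in_itvoo R t (Num.min T (Num.min (t + h1) (t + h2))).
    by rewrite !lt_min tltT !ltrDl h10.
  rewrite in_itv /= !lt_min => /and4P[tq qT q1 q2].
  exists q => //=; have -> : c q = ratr q.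
    by rewrite /c max_r ?min_l ?ltW// (le_lt_trans t0).
  have a1 : `|A w t - A w (ratr q)| < (`|A w t - B w t| - k) / 2.
    by apply: Hh1 => //=; rewrite distrC gtr0_norm ?subr_gt0// ltrBlDl.
  have b1 : `|B w t - B w (ratr q)| < (`|A w t - B w t| - k) / 2.
    by apply: Hh2 => //=; rewrite distrC gtr0_norm ?subr_gt0// ltrBlDl.
  have : `|A w t - B w t| <= `|A w t - A w (ratr q)| +
      `|A w (ratr q) - B w (ratr q)| + `|B w t - B w (ratr q)|.
    rewrite [`|B w t - _|]distrC.
    rewrite (_ : A w t - B w t = (A w t - A w (ratr q)) +
      (A w (ratr q) - B w (ratr q)) + (B w (ratr q) - B w t)).
      by rewrite (le_trans (ler_normD _ _))// lerD2r ler_normD.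
    by rewrite !addrA !subrK.
  by lra.
move=> H; apply/lee_addgt0Pr => x x0.
have [n _ /(_ _ (leqnn _)) nx] := mesh_lt 0 x0.
have [q _ /= Hq] := H n I.
rewrite -leeBlDr// -EFinB; apply: le_ereal_sup_tmp.
exists (`|A w (c q) - B w (c q)|)%:E; first by exists (c q); rewrite //= in_itv/= c0T.
by rewrite lee_fin (le_trans _ (ltW Hq))// lerD2l lerN2 ltW.
Qed.

Lemma sup_on_lt (T e : R) (f : R -> R) t : 0 <= t <= T ->
  ~ (e%:E <= sup_on T f)%E -> f t <= e.
Proof.
move=> tT /negP; rewrite -ltNge => H; rewrite -lee_fin (le_trans _ (ltW H))//.
by apply: ereal_sup_ubound; exists t; rewrite //= in_itv.
Qed.

End distance_events.

Section convergence_of_means.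
Context {R : realType} {d : nat} {dO' : measure_display} {Om' : measurableType dO'}.
Local Notation E := 'rV[R]_d.
Local Notation D := (cadlag R d).
Variable P' : probability Om' R.

(** Convergence in probability is given through outer measures, while the arguments
    below need measurable exceptional events. *)
Lemma outer_cover (N : set Om') (a : R) : (mu_ext P' N < a%:E)%E ->
  exists M, [/\ measurable M, N `<=` M & (P' M <= a%:E)%E].
Proof.
move=> /ereal_inf_lt [_ [F [mF NF] <-]] Fa.
exists (\bigcup_k F k); split => //; first exact: bigcupT_measurable.
rewrite (le_trans _ (ltW Fa))//; apply: measure_sigma_subadditive => //.
exact: bigcupT_measurable.
Qed.

Variables (F : D -> R) (b S : R).
Hypothesis cF : continuous F.
Hypothesis F0b : forall a, 0 <= F a <= b.
Hypothesis S0 : 0 < S.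
Let g := F \o stop S.

Let mg : measurable_fun setT g.
Proof.
apply: measurableT_comp; first exact: continuous_measurable_cadlag.
by apply: stop_measurable; exact: ltW.
Qed.

Let half i : R := 2^-1 ^+ i.

Let half_sum J : \sum_(j < J) half j = 2 - 2 * half J.
Proof.
elim: J => [|J IH]; first by rewrite big_ord0 /half expr0 mulr1 subrr.
by rewrite big_ord_recr /= IH /half exprS; lra.
Qed.

Let half_ge0 i : 0 <= half i.
Proof. by rewrite exprn_ge0. Qed.

(** Uniform closeness off events of summable probabilities holds almost surely
    from some index on, and the functional is continuous for it. *)
Let mean_cvg_off_events (A : nat -> {RV P' >-> D}) (B : {RV P' >-> D})
    (M : nat -> set Om') :
  (forall i, measurable (M i)) -> (forall i, (P' (M i) <= (2 * half i)%:E)%E) ->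
  (forall i w, ~ M i w -> forall t, 0 <= t <= S -> `|A i w t - B w t| <= 2 * half i) ->
  mean P' (fun w => g (A i w)) @[i --> \oo] --> mean P' (fun w => g (B w)).
Proof.
move=> mM PM HM.
have aeM : {ae P', forall w, \1_(M i) w @[i --> \oo] --> (0 : R)}.
  apply: (@ae_cvg0_summable _ _ _ P' (fun i => \1_(M i)) (fun i => 2 * half i) 4).
  - by move=> i; exact: measurable_indic.
  - by [].
  - by move=> i; rewrite integral_indic// setIT; exact: PM.
  - by move=> J; rewrite -mulr_sumr half_sum; have := half_ge0 J; lra.
apply: (@mean_cvg _ _ _ P' _ _ b) => [i|||w|].
- exact: measurableT_comp.
- exact: measurableT_comp.
- by move=> i w; have /andP[h1 h2] := F0b (stop S (A i w)); rewrite ger0_norm.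
- by have /andP[h1 h2] := F0b (stop S (B w)); rewrite ger0_norm.
apply: filterS aeM => w Mw; apply/cvgrPdist_le => e e0.
have [d' d'0 Hd'] := stop_uniform (B w) cF (ltW S0) e0.
have [i1 _ Hi1] : \forall i \near \oo, 2 * half i <= d'.
  have hc : half i @[i --> \oo] --> (0 : R).
    by apply: cvg_expr; rewrite ger0_norm// invf_lt1// ltr1n.
  have d2 : 0 < d' / 2 by rewrite divr_gt0.
  have /cvgrPdist_le/(_ _ d2) := hc; apply: filterS => i.
  by rewrite sub0r normrN ger0_norm ?half_ge0//; lra.
have /cvgrPdist_lt/(_ _ ltr01) := Mw; move=> [i2 _ Hi2].
exists (maxn i1 i2) => // i /=; rewrite geq_max => /andP[/Hi1 h1 /Hi2 h2].
rewrite distrC; apply: Hd' => t tS; apply: le_trans h1; apply: HM => // Miw.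
by move: h2 => /=; rewrite indicE mem_set// sub0r normrN normr1 ltxx.
Qed.

Variables (X : E -> {RV P' >-> D}) (Y : nat -> E -> {RV P' >-> D}).
Hypotheses (HC1 : C1 X) (HC2 : C2_ii X Y).

Let Phi x := mean P' (fun w => g (X x w)).

Let bad_X x0 i : exists2 del : R, 0 < del & forall x, `|x - x0| < del ->
  exists M, [/\ measurable M, (P' M <= (half i)%:E)%E &
    forall w, ~ M w -> forall t, 0 <= t <= S -> `|X x w t - X x0 w t| <= half i].
Proof.
have h0 : 0 < half i by rewrite exprn_gt0.
have H := HC1 x0 h0 S0; rewrite /limf_esup in H.
have : (ereal_inf [set ereal_sup ((fun x => P' [set w | (half i)%:E <=
    sup_on S (fun t => `|X x w t - X x0 w t|%R)]%E) @` V) | V in nbhs x0] <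
    (half i)%:E)%E by rewrite H lte_fin.
move=> /ereal_inf_lt [_ [V /nbhs_ballP[del /= del0 Vdel] <-] Vh].
exists del => // x xx0.
exists [set w | ((half i)%:E <= sup_on S (fun t => `|X x w t - X x0 w t|%R))%E].
split.
- by apply: sup_dist_measurable => //; exact: ltW.
- apply: le_trans (ltW Vh); apply: ereal_sup_ubound; exists x => //.
  by apply: Vdel; rewrite -ball_normE /ball_ /= distrC.
- by move=> w /= nw t tS; exact: (sup_on_lt tS nw).
Qed.

Let unit_ball_compact (x0 : E) (r : R) : compact [set x | `|x - x0| <= r].
Proof.
apply: bounded_closed_compact.
  exists (`|x0| + r); split; first exact: num_real.
  move=> M xM x /= xx0; rewrite -[x](subrK x0) (le_trans (ler_normD _ _))//.
  by rewrite addrC (le_trans _ (ltW xM))// lerD2l.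
rewrite -[X in closed X]setCK closedC.
have := @norm_sub_continuous R d x0; move/continuousP => /(_ _ (@open_gt R r)).
congr open; apply/seteqP; split => x /=; rewrite ltNge; first by move/negP.
by move=> H; apply/negP.
Qed.

Let bad_Y x0 i : exists N, forall n, (N <= n)%N -> forall x, `|x - x0| <= 1 ->
  exists M, [/\ measurable M, (P' M <= (half i)%:E)%E &
    forall w, ~ M w -> forall t, 0 <= t <= S -> `|Y n x w t - X x w t| <= half i].
Proof.
have h0 : 0 < half i by rewrite exprn_gt0.
have := HC2 (unit_ball_compact (x0 := x0) (r := 1)) (ltW S0) h0.
move=> /fine_cvgP[Hf /cvgrPdist_lt/(_ _ h0) Hd].
have [N _ HN] := filterI Hf Hd; exists N => n Nn x xx0.
have [fn] := HN n Nn; rewrite /= sub0r normrN => dn.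
set B := [set w | _] in fn dn.
have Bh : (mu_ext P' B < (half i)%:E)%E.
  by rewrite -(fineK fn) lte_fin (le_lt_trans (ler_norm _)).
have [M [mM BM PM]] := outer_cover Bh.
exists M; split => // w nM t tS.
have nw : ~ ((half i)%:E <= sup_on S (fun t => `|Y n x w t - X x w t|%R))%E.
  move=> Hs; apply: nM; apply: BM; rewrite /B /=; apply: le_trans Hs _.
  by apply: ereal_sup_ubound; exists x.
exact: (sup_on_lt tS nw).
Qed.

Let close_union (A B C : {RV P' >-> D}) i (M1 M2 : set Om') :
  measurable M1 -> measurable M2 ->
  (P' M1 <= (half i)%:E)%E -> (P' M2 <= (half i)%:E)%E ->
  (forall w, ~ M1 w -> forall t, 0 <= t <= S -> `|A w t - B w t| <= half i) ->
  (forall w, ~ M2 w -> forall t, 0 <= t <= S -> `|B w t - C w t| <= half i) ->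
  exists M, [/\ measurable M, (P' M <= (2 * half i)%:E)%E &
    forall w, ~ M w -> forall t, 0 <= t <= S -> `|A w t - C w t| <= 2 * half i].
Proof.
move=> mM1 mM2 P1 P2 H1 H2; exists (M1 `|` M2); split; first exact: measurableU.
  rewrite (le_trans (measureU2 _ mM1 mM2))// mulrDl mul1r EFinD.
  exact: leeD.
move=> w /not_orP[n1 n2] t tS.
rewrite (_ : A w t - C w t = (A w t - B w t) + (B w t - C w t)).
  by rewrite (le_trans (ler_normD _ _))// mulrDl mul1r lerD ?H1 ?H2.
by rewrite addrA subrK.
Qed.

(** If this failed, suitable processes at points converging to [x0] would be close to
    [X x0] off events of summable probabilities, a contradiction. *)
Let cond_local x0 (e : R) : 0 < e -> exists del N, [/\ 0 < del &
  forall n, (N <= n)%N -> forall x, `|x - x0| < del ->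
    `|cond Y g n x - Phi x0| <= e /\ `|Phi x - Phi x0| <= e].
Proof.
move=> e0; apply: contrapT => H.
have ex i : exists (A : {RV P' >-> D}) (M : set Om'),
    [/\ measurable M, (P' M <= (2 * half i)%:E)%E,
    forall w, ~ M w -> forall t, 0 <= t <= S -> `|A w t - X x0 w t| <= 2 * half i &
    e < `|mean P' (fun w => g (A w)) - Phi x0| ].
  have [del del0 Hdel] := bad_X x0 i; have [N HN] := bad_Y x0 i.
  apply: contrapT => noA; apply: H; exists (Num.min del 1), N.
  split; first by rewrite lt_min del0 ltr01.
  move=> n Nn x; rewrite lt_min => /andP[xdel x1].
  have [M1 [mM1 PM1 HM1]] := Hdel x xdel.
  have [M2 [mM2 PM2 HM2]] := HN n Nn x (ltW x1).
  have [M [mM PM HM]] := close_union mM2 mM1 PM2 PM1 HM2 HM1.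
  have h0 : 0 <= half i by exact: half_ge0.
  split; rewrite leNgt; apply/negP => big.
    by apply: noA; exists (Y n x), M.
  apply: noA; exists (X x), M1; split => //.
    by rewrite (le_trans PM1)// lee_fin; lra.
  by move=> w nw t tS; rewrite (le_trans (HM1 w nw t tS))//; lra.
have [A HA] := choice ex; have [M HM] := choice HA.
have mM i : measurable (M i) by case: (HM i).
have PM i : (P' (M i) <= (2 * half i)%:E)%E by case: (HM i).
have dM i w : ~ M i w -> forall t, 0 <= t <= S ->
    `|A i w t - X x0 w t| <= 2 * half i by case: (HM i) => _ _ + _; apply.
have /cvgrPdist_le/(_ _ e0)[N _ /(_ N (leqnn _))] := mean_cvg_off_events mM PM dM.
by rewrite /= distrC leNgt; case: (HM N) => _ _ _ ->.
Qed.

Lemma Phi_continuous : continuous Phi.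
Proof.
move=> x0; apply/(@cvgrPdist_le _ _ _ (nbhs x0) (nbhs_filter x0)) => e e0.
have [del [N [del0 HN]]] := cond_local x0 e0.
apply/nbhs_ballP; exists del => // x; rewrite -ball_normE /ball_ /= => x0x.
by rewrite distrC; case: (HN N (leqnn _) x) => //; rewrite distrC.
Qed.

(** Local uniformity at each point extends to balls by compactness. *)
Lemma cond_uniform (r e : R) : 0 < e -> \forall n \near \oo,
  forall x, `|x| <= r -> `|cond Y g n x - Phi x| <= e.
Proof.
move=> e0; have e2 : 0 < e / 2 by rewrite divr_gt0.
have := @unit_ball_compact 0 r; move/compact_near_coveringP.
move=> /(_ nat \oo (fun n x => `|cond Y g n x - Phi x| <= e)).
move=> /(_ _) H; have : \forall n \near \oo, [set x | `|x - 0| <= r] `<=`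
    (fun x => `|cond Y g n x - Phi x| <= e).
  apply: H => x0 _.
  have [del [N [del0 HN]]] := cond_local x0 e2.
  exists ([set x | `|x - x0| < del], [set n | (N <= n)%N]).
    split; last by exists N.
    apply/nbhs_ballP; exists del => // x.
    by rewrite -ball_normE /ball_ /= distrC.
  move=> [x n] /= [xx0 Nn]; have [h1 h2] := HN n Nn x xx0.
  rewrite (_ : _ - _ = (cond Y g n x - Phi x0) - (Phi x - Phi x0)); last by ring.
  by rewrite (le_trans (ler_normB _ _))// [leRHS]splitr lerD.
by apply: filterS => n Hn x xr; apply: Hn; rewrite /= subr0.
Qed.

End convergence_of_means.

(** * Empirical averages *)

Section empirical_integral.
Context {R : realType} {dT : measure_display} {T : measurableType dT}.
Variables (eta : nat -> {posnum R}) (Z : nat -> T).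

Let ge0_integral_empirical n (f : T -> R) : measurable_fun setT f ->
  (forall x, 0 <= f x) ->
  (\int[empirical eta Z n]_x (f x)%:E = (avg eta (fun k => f (Z k)) n)%:E)%E.
Proof.
move=> mf f0; have mEf : measurable_fun setT (EFin \o f) by exact/measurable_EFinP.
have f0' x : setT x -> (0 <= (EFin \o f) x)%E by rewrite lee_fin.
rewrite /empirical (ge0_integral_mscale _ measurableT _ mEf f0') /=.
rewrite (ge0_integral_measure_sum _ measurableT f0' mEf) /avg EFinM -sumEFin.
congr (_ * _)%E; apply: eq_bigr => k _.
rewrite (ge0_integral_mscale _ measurableT _ mEf f0').
by rewrite (integral_dirac _ measurableT mEf) diracT mul1e EFinM.
Qed.

Lemma integral_empirical n (f : T -> R) : measurable_fun setT f ->
  (\int[empirical eta Z n]_x (f x)%:E = (avg eta (fun k => f (Z k)) n)%:E)%E.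
Proof.
move=> mf.
rewrite integralE.
rewrite (eq_integral (fun x => (Num.max (f x) 0)%:E)); last first.
  by move=> x _; rewrite funeposE EFin_max.
rewrite ge0_integral_empirical; last 2 first.
- exact: measurable_maxr.
- by move=> x; rewrite le_max lexx orbT.
rewrite (eq_integral (fun x => (Num.max (- f x) 0)%:E)); last first.
  by move=> x _; rewrite funenegE EFin_max.
rewrite ge0_integral_empirical; last 2 first.
- apply: measurable_maxr => //; exact: measurableT_comp.
- by move=> x; rewrite le_max lexx orbT.
rewrite -EFinB -avgB; congr (avg _ _ _)%:E; apply/funext => k.
by case: (leP (f (Z k)) 0) => h; case: (leP (- f (Z k)) 0) => h'; lra.
Qed.

End empirical_integral.

Section interpolation.
Context {R : realType}.
Variables (eta : nat -> {posnum R}) (N : nat -> nat).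
Local Notation H := (psum eta).
Hypothesis N1 : forall j, 1 <= H (N j).
Hypothesis sparse : forall r J, 1 < r -> \forall n \near \oo, exists j,
  [/\ (J <= j)%N, (N j <= n <= N j.+1)%N & H (N j.+1) <= r * H (N j)].
Variable f : nat -> R.
Hypothesis f0 : forall k, 0 <= f k.

Let tot n := \sum_(k < n) (eta k.+1)%:num * f k.

Let tot_le m n : (m <= n)%N -> tot m <= tot n.
Proof.
move=> mn; rewrite /tot (big_ord_widen _ (fun k => (eta k.+1)%:num * f k) mn).
by rewrite big_mkcond; apply: ler_sum => k _; case: ifP => // _; rewrite mulr_ge0.
Qed.

Let H0 j : 0 < H (N j).
Proof. by rewrite (lt_le_trans _ (N1 j)). Qed.

Let tot0 n : 0 <= tot n.
Proof. by apply: sumr_ge0 => k _; rewrite mulr_ge0. Qed.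

(** Sums of nonnegative terms are monotone, so that the averages at sparse times
    control the others. *)
Lemma avg_sandwich r J : 1 < r -> \forall n \near \oo, exists j, (J <= j)%N /\
  avg eta f (N j) <= r * avg eta f n /\ avg eta f n <= r * avg eta f (N j.+1).
Proof.
move=> r1; have [M _ HM] := sparse J r1; exists M => // n /HM [j [Jj /andP[jn nj] rH]].
have r0 : 0 < r by rewrite (lt_trans _ r1).
have Hn : 0 < H n by rewrite (lt_le_trans (H0 j))// psum_le.
have key m m' : 0 < H m -> 0 < H m' -> tot m <= tot m' -> H m' <= r * H m ->
    avg eta f m <= r * avg eta f m'.
  move=> m0 m'0 tt HH; rewrite /avg -/(tot m) -/(tot m').
  rewrite mulrA ler_pM// ?invr_ge0 ?(ltW m0)//.
  by rewrite ler_pdivlMr// ler_pdivrMl// mulrC.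
exists j; split => //; split.
  by apply: key => //; [exact: tot_le|rewrite (le_trans (psum_le eta nj))].
apply: key => //; first exact: tot_le.
by rewrite (le_trans rH)// ler_wpM2l ?(ltW r0)// psum_le.
Qed.

Lemma avg_interp (c : R) : avg eta f (N j) @[j --> \oo] --> c ->
  avg eta f n @[n --> \oo] --> c.
Proof.
move=> /cvgrPdist_le cN; apply/cvgrPdist_le => e e0.
have e2 : 0 < e / 2 by rewrite divr_gt0.
have [J _ HJ] := cN _ e2.
have c0 : 0 <= c + e.
  have := HJ J (leqnn _); have := avg_ge0 eta (N J) f0.
  by rewrite /= ler_norml => h /andP[h' _]; lra.
pose h := e / 2 / (c + e + 1).
have h0 : 0 < h by rewrite !divr_gt0//; lra.
have hc : h * (c + e + 1) = e / 2 by rewrite /h divfK// gt_eqF//; lra.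
have r1 : 1 < 1 + h by rewrite ltrDl.
have [M _ HM] := avg_sandwich J r1; exists M => // n /HM [j [Jj [low up]]] /=.
have := HJ j Jj; have := HJ j.+1 (leqW Jj); rewrite /= !ler_norml.
move: (avg eta f (N j)) (avg eta f (N j.+1)) (avg eta f n) low up => x y z.
move=> low up /andP[y1 y2] /andP[x1 x2].
have up' : z <= (1 + h) * (c + e / 2) by rewrite (le_trans up)// ler_wpM2l; lra.
have he : 0 <= h * (e / 2 + 1) by rewrite mulr_ge0; lra.
apply/andP; split; last by nra.
by nra.
Qed.

Lemma avg_interp_bound M : (\forall j \near \oo, avg eta f (N j) <= M) ->
  \forall n \near \oo, avg eta f n <= 2 * M.
Proof.
move=> [J _ HJ]; have [K _ HK] := avg_sandwich J (ltr1n R 2).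
exists K => // n /HK [j [Jj [_ up]]] /=; rewrite (le_trans up)// ler_wpM2l//.
exact: (HJ j.+1 (leqW Jj)).
Qed.

End interpolation.

Section countable_determination.
Context {R : realType} {d : nat}.
Local Notation D := (cadlag R d).
Variables (mu : probability D R) (eta : nat -> {posnum R}) (z : nat -> D).
Hypothesis z_test : forall s : seq (@bump_code d),
  avg eta (fun k => test s (z k)) n @[n --> \oo] --> mean mu (test s).

(** The test functionals below [F] bound its averages from below. The bound from above
    comes from the same fact for [c - F]. *)
Let avg_lower (F : D -> R) c e : continuous F -> (forall a, 0 <= F a <= c) -> 0 < e ->
  \forall n \near \oo, mean mu F - e <= avg eta (fun k => F (z k)) n.
Proof.
move=> cF Fc e0; have e2 : 0 < e / 2 by rewrite divr_gt0.
have F0 a : 0 <= F a by have /andP[] := Fc a.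
have [s [sF _ sn]] := test_approx cF F0.
have ms n : measurable_fun setT (test (s n) : D -> R).
  exact: continuous_measurable_cadlag (@test_continuous _ _ _).
have Fc' a : `|F a| <= c by have /andP[h1 h2] := Fc a; rewrite ger0_norm.
have sc n a : `|test (s n) a| <= c.
  by rewrite ger0_norm ?test_ge0// (le_trans (sF n a))//; have /andP[] := Fc a.
have /cvgrPdist_le/(_ _ e2)[m _ /(_ m (leqnn _))] /= :=
  @mean_cvg _ _ _ mu _ _ _ ms (continuous_measurable_cadlag cF) sc Fc' (aeW _ sn).
rewrite ler_norml => /andP[_ Hm].
have /cvgrPdist_le/(_ _ e2) := @z_test (s m); apply: filterS => n.
rewrite ler_norml => /andP[_ Hn].
have le : avg eta (fun k => test (s m) (z k)) n <= avg eta (fun k => F (z k)) n.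
  by apply: le_avg => k _; exact: sF.
lra.
Qed.

Lemma test_determining (F : D -> R) : continuous F -> bounded_fun F ->
  avg eta (fun k => F (z k)) n @[n --> \oo] --> mean mu F.
Proof.
move=> cF [M [_ HM]]; pose B := `|M| + 1.
have FB a : `|F a| <= B.
  by apply: (HM B) => //; rewrite /B (le_lt_trans (ler_norm M))// ltrDl.
have bF : bounded_rv F by split; [exact: continuous_measurable_cadlag|exists B].
have cB (x : D) : {for x, continuous (cst B : D -> R)} by exact: cst_continuous.
have cFB : continuous (fun a => F a + B).
  by move=> x; exact: (@continuousD _ _ _ F (cst B) x (cF x) (cB x)).
have cBF : continuous (fun a => B - F a).
  by move=> x; exact: (@continuousB _ _ _ (cst B) F x (cB x) (cF x)).
have FB2 a : 0 <= F a + B <= 2 * B.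
  by have := FB a; rewrite ler_norml => /andP[]; lra.
have BF2 a : 0 <= B - F a <= 2 * B.
  by have := FB a; rewrite ler_norml => /andP[]; lra.
apply/cvgrPdist_le => e e0.
have [m _ low] := avg_lower cFB FB2 e0; have [m' _ up] := avg_lower cBF BF2 e0.
exists (maxn m m').+1 => // -[//|n] /=; rewrite ltnS geq_max => /andP[mn m'n].
have := low n.+1 (leqW mn); have := up n.+1 (leqW m'n); rewrite /=.
rewrite (avgB eta (cst B)) avgD avg_cst meanB ?meanD ?mean_cst ?ler_norml//;
  try exact: bounded_rv_cst.
by rewrite -/B => h1 h2; apply/andP; split; lra.
Qed.

End countable_determination.

(** * Moments and uniform integrability *)

Section powers.
Context {R : realType}.
Implicit Types x y b v : R.

Lemma powR_le_add1 y t : 0 <= y -> 0 <= t <= 1 -> y `^ t <= 1 + y.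
Proof.
move=> y0 /andP[t0 t1]; have [y1|/ltW y1] := leP y 1.
  have : y `^ t <= 1 `^ t by apply: ge0_ler_powR; rewrite ?nnegrE.
  by rewrite powR1 => /le_trans -> //; rewrite lerDl.
by rewrite (le_trans (ler1_powR y1 t1))// lerDr.
Qed.

(** Tails are small compared to higher powers. *)
Lemma powR_tail y v s : 0 <= y -> 0 < v -> 1 <= s -> y <= v + v `^ (1 - s) * y `^ s.
Proof.
move=> y0 v0 s1; have [yv|vy] := leP y v.
  by rewrite (le_trans yv)// lerDl mulr_ge0 ?powR_ge0.
have y0' : 0 < y := lt_trans v0 vy.
have /(ler_wpM2r (ltW y0')) : 1 <= (y / v) `^ (s - 1).
  rewrite -[leLHS](powRr0 (y / v)) ler_powR ?subr_ge0//.
  by rewrite ler_pdivlMr// mul1r ltW.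
rewrite mul1r => /le_trans -> //; rewrite powRM ?invr_ge0 ?(ltW v0)//.
rewrite -powR_inv1 ?(ltW v0)// -powRrM mulN1r opprB mulrAC -[X in _ * X * _]powRr1//.
rewrite -powRD; last by rewrite (gt_eqF y0') /= implybT.
by rewrite subrK mulrC lerDr ltW.
Qed.

Lemma powR_truncate y b k : 0 <= y -> 1 <= b -> 0 <= k <= 1 ->
  y `^ k <= 1 + Num.min y b + b `^ (k - 1) * y.
Proof.
move=> y0 b1 k01; have b0 : 0 < b by rewrite (lt_le_trans ltr01).
have [yb|yb] := leP y b.
  by rewrite (le_trans (powR_le_add1 y0 k01))// lerDl mulr_ge0 ?powR_ge0.
have y0' : 0 < y := lt_trans b0 yb.
have E : y `^ (k - 1) <= b `^ (k - 1).
  rewrite -opprB !powRN lef_pV2 ?posrE ?powR_gt0//.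
  by apply: ge0_ler_powR; rewrite ?nnegrE ?(ltW b0) ?(ltW yb)// subr_ge0; case/andP: k01.
have -> : y `^ k = y `^ (k - 1) * y.
  rewrite -[X in _ * X]powRr1// -powRD ?subrK//.
  by rewrite (gt_eqF y0') /= implybT.
rewrite (le_trans (ler_wpM2r y0 E))// lerDr.
by rewrite addr_ge0// ltW.
Qed.

End powers.

Section nonmeasurable_majorant.
Context {dO : measure_display} {R : realType} {Om : measurableType dO}.
Variable P : probability Om R.
Local Open Scope ereal_scope.

(** The integral of a nonnegative function is a supremum over simple functions and thus
    monotone, whether or not the functions are measurable. *)
Lemma le_integral_majorant (f g : Om -> \bar R) : (forall w, 0 <= f w) ->
  (forall w, f w <= g w) -> \int[P]_w f w <= \int[P]_w g w.
Proof.
move=> f0 fg; have g0 w : 0 <= g w := le_trans (f0 w) (fg w).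
rewrite !ge0_integralTE//; apply: le_ereal_sup => _ [h hf <-].
by exists h => // w; exact: le_trans (hf w) (fg w).
Qed.

End nonmeasurable_majorant.

Section uniform_integrability.
Context {R : realType} {dT : measure_display} {T : measurableType dT}.
Variables (mu : probability T R) (eta : nat -> {posnum R}) (z : nat -> T)
  (f : T -> R) (q : R).
Hypothesis q1 : 1 < q.
Hypothesis mf : measurable_fun setT f.

Definition truncate (K y : R) : R := Num.max (- K) (Num.min y K).

Hypothesis abs_cvg : forall K : nat,
  avg eta (fun k => Num.min `|f (z k)| K%:R) n @[n --> \oo] -->
  mean mu (fun a => Num.min `|f a| K%:R).
Hypothesis truncate_cvg : forall K : nat,
  avg eta (fun k => truncate K%:R (f (z k))) n @[n --> \oo] -->
  mean mu (fun a => truncate K%:R (f a)).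
Hypothesis moment : exists M, \forall n \near \oo, avg eta (fun k => `|f (z k)| `^ q) n <= M.

Lemma norm_truncate K y : 0 <= K -> `|truncate K y| <= `|y|.
Proof.
move=> K0; rewrite /truncate; case: (leP y K) => h1; case: (leP (- K) _) => h2 //.
- by rewrite normrN (ger0_norm K0) ler0_norm; lra.
- by rewrite (ger0_norm K0) ger0_norm; lra.
- by rewrite normrN (ger0_norm K0) ger0_norm; lra.
Qed.

Lemma truncate_id K y : `|y| <= K -> truncate K y = y.
Proof.
by rewrite ler_norml => /andP[h1 h2]; rewrite /truncate (min_l h2) max_r.
Qed.

Lemma truncate_tail K y : 0 < K -> `|y - truncate K y| <= K `^ (1 - q) * `|y| `^ q.
Proof.
move=> K0; have [yK|Ky] := leP `|y| K.
  by rewrite truncate_id// subrr normr0 mulr_ge0 ?powR_ge0.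
have := powR_tail (normr_ge0 y) K0 (ltW q1); rewrite -lerBlDl; apply: le_trans.
move: Ky; rewrite /truncate; case: (ger0P y) => y0 Ky.
  by rewrite (min_r (ltW Ky)) max_r ?ger0_norm; lra.
by rewrite min_l ?max_l ?ler0_norm; lra.
Qed.

Let mmin K : measurable_fun setT (fun a => Num.min `|f a| K).
Proof. by apply: measurable_minr => //; exact: measurableT_comp. Qed.

Let mtruncate K : measurable_fun setT (fun a => truncate K (f a)).
Proof. by apply: measurable_maxr => //; exact: measurable_minr. Qed.

Let min_le (y : R) (K : nat) : `|Num.min `|y| K%:R| <= K%:R.
Proof. by rewrite ger0_norm ?le_min ?normr_ge0 ?ler0n// ge_min lexx orbT. Qed.

(** A bound for moments of order [q] along the sequence passes to the limit. *)
Lemma limit_integrable : mu.-integrable setT (EFin \o f).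
Proof.
have [M HM] := moment; pose u n a := (Num.min `|f a| n%:R)%:E.
have mu_ n : measurable_fun setT (u n) by exact/measurable_EFinP.
have u0 n a : setT a -> (0 <= u n a)%E by rewrite lee_fin le_min normr_ge0 ler0n.
have ndu a : setT a -> {homo u ^~ a : n m / (n <= m)%N >-> (n <= m)%E}.
  by move=> _ n m nm; rewrite lee_fin le_min ge_min lexx/= ge_min ler_nat nm orbT.
have uf a : u n a @[n --> \oo] --> (`|f a|)%:E.
  apply: cvg_near_cst; exists (truncn `|f a|).+1 => // n /= fn.
  by congr EFin; rewrite min_l// ltW// (lt_le_trans (truncnS_gt _))// ler_nat.
have mean_bound n : (\int[mu]_a u n a <= (1 + M)%:E)%E.
  have bu : bounded_rv (fun a => Num.min `|f a| n%:R).
    by split => //; exists n%:R => a; exact: min_le.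
  rewrite -[leLHS](meanE mu bu) lee_fin.
  apply: (cvgr_to_le (@abs_cvg n)); apply: filterS HM => m Hm.
  rewrite (@le_trans _ _ (avg eta (fun k => 1 + `|f (z k)| `^ q) m))//.
    apply: le_avg => k _; rewrite ge_min; apply/orP; left.
    by have := powR_tail (normr_ge0 (f (z k))) ltr01 (ltW q1); rewrite powR1 mul1r.
  by rewrite avgD lerD// avg_le_cst.
apply/integrableP; split; first exact/measurable_EFinP.
rewrite (eq_integral (fun a => limn (u ^~ a))); last by move=> a _; apply/esym/cvg_lim.
rewrite monotone_convergence// (@le_lt_trans _ _ (1 + M)%:E) ?ltry//.
apply: lime_le; last exact: nearW.
by apply/cvg_ex; eexists; exact: (cvg_monotone_convergence measurableT mu_ u0 ndu).
Qed.

Let truncate_mean :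
  mean mu (fun a => truncate n%:R (f a)) @[n --> \oo] --> mean mu f.
Proof.
have int_f := limit_integrable.
have mE n : measurable_fun setT (fun a => (truncate n%:R (f a))%:E) by exact/measurable_EFinP.
have mEf : measurable_fun setT (EFin \o f) by exact/measurable_EFinP.
have cv : {ae mu, forall a, setT a ->
    (truncate n%:R (f a))%:E @[n --> \oo] --> (EFin \o f) a}.
  apply: aeW => a _; apply: cvg_near_cst; exists (truncn `|f a|).+1 => // n /= fn.
  congr EFin; rewrite truncate_id// ltW// (lt_le_trans (truncnS_gt _))//.
  by rewrite ler_nat.
have dom : {ae mu, forall a n, setT a ->
    (`|(truncate n%:R (f a))%:E| <= (abse \o (EFin \o f)) a)%E}.
  by apply: aeW => a n _; rewrite /= lee_fin norm_truncate.
have [_ _ H] := dominated_convergence measurableT mE mEf cv (integrable_abse int_f) dom.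
have fin : (\int[mu]_a (f a)%:E)%E \is a fin_num by exact: integrable_fin_num.
by rewrite /mean /Rintegral; apply: fine_cvg; rewrite fineK.
Qed.

Lemma uniformly_integrable_cvg : avg eta (fun k => f (z k)) n @[n --> \oo] --> mean mu f.
Proof.
have [M [n0 _ HM]] := moment; apply/cvgrPdist_le => e e0.
have e3 : 0 < e / 3 by rewrite divr_gt0.
have M1 : 0 < `|M| + 1 by rewrite ltr_wpDl.
pose K0 := ((`|M| + 1) / (e / 3)) `^ ((q - 1)^-1).
have /cvgrPdist_le/(_ _ e3)[K1 _ HK1] := truncate_mean.
pose K := maxn (truncn K0).+1 K1.
have K0K : K0 <= K%:R.
  by rewrite ltW// (lt_le_trans (truncnS_gt _))// ler_nat leq_maxl.
have Kpos : (0 : R) < K%:R by rewrite ltr0n leq_max.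
have tail : K%:R `^ (1 - q) * (`|M| + 1) <= e / 3.
  rewrite -opprB powRN mulrC ler_pdivrMr ?powR_gt0// mulrC -ler_pdivrMr//.
  have -> : (`|M| + 1) / (e / 3) = K0 `^ (q - 1).
    rewrite /K0 -powRrM mulVf ?gt_eqF ?subr_gt0// powRr1//.
    by rewrite divr_ge0 ?ltW.
  by apply: ge0_ler_powR; rewrite ?nnegrE ?subr_ge0 ?powR_ge0 ?(ltW q1).
have HK : `|mean mu f - mean mu (fun a => truncate K%:R (f a))| <= e / 3.
  by apply: HK1; rewrite /= leq_maxr.
have /cvgrPdist_le/(_ _ e3) := @truncate_cvg K.
have : \forall n \near \oo, (n0 <= n)%N by exists n0.
apply: filterS2 => n /HM moment_n cvK.
rewrite (_ : _ - _ = (mean mu f - mean mu (fun a => truncate K%:R (f a))) +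
  (mean mu (fun a => truncate K%:R (f a)) - avg eta (fun k => truncate K%:R (f (z k))) n) -
  avg eta (fun k => f (z k) - truncate K%:R (f (z k))) n); last by rewrite avgB; ring.
rewrite (_ : e = e / 3 + e / 3 + e / 3); last by field.
rewrite (le_trans (ler_normB _ _))// lerD//; last first.
  rewrite (le_trans (ler_norm_avg _ _ _))// (le_trans _ tail)//.
  rewrite (@le_trans _ _ (avg eta (fun k => K%:R `^ (1 - q) * `|f (z k)| `^ q) n))//.
    by apply: le_avg => k _; exact: truncate_tail.
  rewrite avgZ ler_wpM2l ?powR_ge0// (le_trans moment_n)//.
  by rewrite (le_trans (ler_norm M))// lerDl.
by rewrite (le_trans (ler_normD _ _))// lerD.
Qed.

End uniform_integrability.

Section domination.
Context {R : realType} {d : nat}.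
Local Notation E := 'rV[R]_d.
Local Notation D := (cadlag R d).
Variables (V : E -> R) (T : R).
Hypothesis T0 : 0 <= T.
Hypothesis V0 : forall x, 0 <= V x.
Local Open Scope ereal_scope.

Lemma sup_powR_ge0 (s : R) (a : D) : 0 <= sup_on T (fun t => V (a t) `^ s)%R.
Proof.
apply: (@le_trans _ _ (V (a 0%R) `^ s)%:E); first by rewrite lee_fin powR_ge0.
apply: ereal_sup_ubound.
by exists 0%R => //=; rewrite in_itv/= lexx.
Qed.

(** A power of order at most one of the supremum of [V] is compared to the supremum of
    [V ^ s], with a weight such that the mean of the bound is linear in [V]. *)
Lemma powR_dominated (s rho r C v y : R) (a : D) : (1 <= s)%R -> (0 <= rho)%R ->
  (0 <= r)%R -> (rho * r <= 1)%R -> (0 < v)%R -> (0 <= y)%R ->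
  y%:E <= C%:E * sup_on T (fun t => V (a t) `^ rho)%R ->
  (y `^ r)%:E <= ((`|C| + 1) `^ r * (1 + v))%:E +
    ((`|C| + 1) `^ r * v `^ (1 - s))%:E * sup_on T (fun t => V (a t) `^ s)%R.
Proof.
move=> s1 rho0 r0 rr1 v0 y0 yC; set A := ((`|C| + 1) `^ r)%R.
have C0 : (0 < `|C| + 1)%R by rewrite ltr_wpDl.
have A0 : (0 < A)%R by exact: powR_gt0.
have s0 : (0 < s)%R by rewrite (lt_le_trans ltr01).
have := sup_powR_ge0 s a; case E : (sup_on T (fun t => V (a t) `^ s)%R) => [u| |] //.
  rewrite lee_fin => u0; pose m := (u `^ s^-1)%R.
  have m0 : (0 <= m)%R by exact: powR_ge0.
  have ms : (m `^ s = u)%R by rewrite -powRrM mulVf ?gt_eqF// powRr1.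
  have Vm t : (0 <= t <= T)%R -> (V (a t) <= m)%R.
    move=> tT; rewrite -[leLHS]powRr1// -(mulfV (lt0r_neq0 s0)) powRrM.
    apply: ge0_ler_powR; rewrite ?nnegrE ?invr_ge0 ?powR_ge0 ?(ltW s0)//.
    rewrite -lee_fin -E; apply: ereal_sup_ubound; exists t => //=.
  have rho_m : sup_on T (fun t => V (a t) `^ rho)%R <= (m `^ rho)%:E.
    apply: ge_ereal_sup => _ [t /= tT <-]; rewrite lee_fin.
    apply: ge0_ler_powR; rewrite ?nnegrE//; apply: Vm.
    by move: tT; rewrite in_itv.
  have ym : (y <= (`|C| + 1) * m `^ rho)%R.
    rewrite -lee_fin (le_trans yC)//.
    apply: (@le_trans _ _ ((`|C| + 1)%:E * sup_on T (fun t => V (a t) `^ rho)%R)).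
      apply: lee_wpmul2r; first exact: sup_powR_ge0.
      by rewrite lee_fin (le_trans (ler_norm C))// lerDl.
    by rewrite EFinM; apply: lee_wpmul2l => //; rewrite lee_fin ltW.
  have yr : (y `^ r <= A * m `^ (rho * r))%R.
    rewrite powRrM -powRM ?powR_ge0 ?(ltW C0)//.
    by apply: ge0_ler_powR; rewrite ?nnegrE// mulr_ge0 ?powR_ge0 ?(ltW C0).
  rewrite -EFinM -EFinD lee_fin (le_trans yr)// -mulrA -mulrDr ler_wpM2l ?(ltW A0)//.
  have rr01 : (0 <= rho * r <= 1)%R by rewrite mulr_ge0.
  rewrite (le_trans (powR_le_add1 m0 rr01))// -addrA lerD2l -ms.
  exact: powR_tail.
by rewrite gt0_muley ?lte_fin ?mulr_gt0 ?powR_gt0// addey ?leey.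
Qed.

End domination.

Section affine_majorant.
Context {dO : measure_display} {R : realType} {Om : measurableType dO}.
Variable P : probability Om R.
Local Open Scope ereal_scope.

(** The majorant need not be measurable; the part of [f] that exceeds [a] is. *)
Lemma integral_affine_majorant (f : Om -> R) (u : Om -> \bar R) (a b m : R) :
  measurable_fun setT f -> (forall w, 0 <= u w) -> (0 <= a)%R -> (0 < b)%R ->
  (forall w, (f w)%:E <= a%:E + b%:E * u w) -> \int[P]_w u w <= m%:E ->
  \int[P]_w (f w)%:E <= (a + b * m)%:E.
Proof.
move=> mf u0 a0 b0 fu um; pose h w := (Num.max 0 (f w - a) / b)%R.
have mh : measurable_fun setT h.
  apply: measurable_funM => //; apply: measurable_maxr => //.
  exact: measurable_funB.
have h0 w : (0 <= h w)%R by rewrite mulr_ge0 ?invr_ge0 ?(ltW b0)// le_max lexx.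
have mhE : measurable_fun setT (fun w => (h w)%:E) by exact/measurable_EFinP.
have h0E w : setT w -> 0 <= (h w)%:E by rewrite lee_fin.
have hm : \int[P]_w (h w)%:E <= m%:E.
  apply: le_trans um; apply: le_integral_majorant => w; first by rewrite lee_fin.
  have := fu w; have := u0 w; case: (u w) => [x|_ _|//]; last exact: leey.
  rewrite -EFinM -EFinD !lee_fin => x0 fx.
  by rewrite ler_pdivrMr// ge_max; apply/andP; split; [rewrite mulr_ge0// ltW|lra].
have fh w : (f w <= a + b * h w)%R.
  rewrite /h mulrCA mulfV ?gt_eqF// mulr1 -lerBlDl.
  by rewrite le_max lexx orbT.
apply: (@le_trans _ _ (\int[P]_w (a%:E + b%:E * (h w)%:E))).
  rewrite -[leLHS]/(\int[P]_w (EFin \o f) w) integralE.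
  apply: (@le_trans _ _ (\int[P]_w ((EFin \o f)^\+ w))).
    by rewrite -[leRHS]sube0; apply: leeB => //; exact: integral_ge0.
  apply: le_integral_majorant => w; first exact: funepos_ge0.
  rewrite funeposE /= -EFinM -EFinD -EFin_max lee_fin ge_max fh/=.
  by rewrite addr_ge0// mulr_ge0// ltW.
rewrite ge0_integralD//; first last.
- exact: emeasurable_funM.
- by move=> w _; rewrite mule_ge0// lee_fin// ltW.
have -> : \int[P]_w a%:E = a%:E.
  by rewrite (@integral_cst _ _ _ P _ measurableT a%:E) /= probability_setT mule1.
rewrite EFinD EFinM leeD2l//.
rewrite (ge0_integralZl_EFin P measurableT h0E mhE (ltW b0)).
by apply: lee_wpmul2l => //; rewrite lee_fin ltW.
Qed.

End affine_majorant.

Section weighted_integrals.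
Context {dO : measure_display} {R : realType} {Om : measurableType dO}.
Variables (P : probability Om R) (eta : nat -> {posnum R}).

Lemma measurable_avg (f : nat -> Om -> R) n : (forall i, measurable_fun setT (f i)) ->
  measurable_fun setT (fun w => avg eta (fun i => f i w) n).
Proof.
move=> mf; apply: measurable_funM => //; apply: measurable_sum => i.
exact: measurable_funM.
Qed.

Lemma le_integral_avg (f g : nat -> Om -> R) n :
  (forall i, measurable_fun setT (f i)) -> (forall i w, 0 <= f i w) ->
  (forall i, measurable_fun setT (g i)) -> (forall i w, 0 <= g i w) ->
  (forall i, \int[P]_w (f i w)%:E <= \int[P]_w (g i w)%:E)%E ->
  (\int[P]_w (avg eta (fun i => f i w) n)%:E <=
   \int[P]_w (avg eta (fun i => g i w) n)%:E)%E.
Proof.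
move=> mf f0 mg g0 fg.
have avgE (h : nat -> Om -> R) : (forall i, measurable_fun setT (h i)) ->
    (forall i w, 0 <= h i w) -> (\int[P]_w (avg eta (fun i => h i w) n)%:E =
    ((psum eta n)^-1)%:E * \sum_(i < n) (eta i.+1)%:num%:E * \int[P]_w (h i w)%:E)%E.
  move=> mh h0.
  have mE i : measurable_fun setT (fun w => (h i w)%:E) by exact/measurable_EFinP.
  have h0E i w : setT w -> (0 <= (h i w)%:E)%E by rewrite lee_fin.
  have mE' (i : 'I_n) : measurable_fun setT (fun w => ((eta i.+1)%:num%:E * (h i w)%:E)%E).
    exact: emeasurable_funM.
  have h0E' (i : 'I_n) w : setT w -> (0 <= (eta i.+1)%:num%:E * (h i w)%:E)%E.
    by move=> _; rewrite mule_ge0// lee_fin.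
  rewrite (eq_integral (fun w => ((psum eta n)^-1)%:E *
      \sum_(i < n) ((eta i.+1)%:num%:E * (h i w)%:E)))%E; last first.
    by move=> w _; rewrite /avg EFinM -sumEFin.
  rewrite (ge0_integralZl_EFin P measurableT) ?psumV_ge0//; first last.
  - exact: emeasurable_sum.
  - by move=> w _; apply: sume_ge0 => i _; exact: h0E'.
  rewrite (ge0_integral_sum P measurableT mE' h0E'); congr (_ * _)%E.
  apply: eq_bigr => i _.
  exact: (ge0_integralZl_EFin P measurableT (h0E i) (mE i)).
rewrite !avgE//; apply: lee_wpmul2l; first by rewrite lee_fin psumV_ge0.
by apply: lee_sum => i _; apply: lee_wpmul2l; rewrite ?lee_fin// fg.
Qed.

(** At the last term that is counted, the running average is at most [M], and it
    includes all the terms counted before. *)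
Lemma stopped_sum (v : nat -> R) M n : 0 <= M -> (forall i, 0 <= v i) ->
  avg eta (fun i => if avg eta v i.+1 <= M then v i else 0) n <= M.
Proof.
move=> M0 v0; pose tot m := \sum_(i < m) (eta i.+1)%:num * v i.
have totE m : (avg eta v m.+1 <= M) = (tot m.+1 <= M * psum eta m.+1).
  by rewrite /avg -/(tot _) mulrC ler_pdivrMr// psum_gt0.
case: n => [|n]; first by rewrite avg0.
rewrite {1}/avg mulrC ler_pdivrMr ?psum_gt0//.
elim: n.+1 => {n} [|n IH]; first by rewrite big_ord0 psum0 mulr0.
rewrite big_ord_recr /=; have [h|_] := boolP (_ <= M); last first.
  by rewrite mulr0 addr0 (le_trans IH)// ler_wpM2l// psum_le.
move: h; rewrite totE; apply: le_trans; rewrite /tot big_ord_recr lerD2r.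
by apply: ler_sum => i _; rewrite ler_wpM2l//; case: ifP.
Qed.

End weighted_integrals.

(** * Almost sure convergence along the scheme *)

Section almost_sure_convergence.
Context {R : realType} {d : nat} {dO dO' : measure_display}
  {Om : measurableType dO} {Om' : measurableType dO'}.
Local Notation E := 'rV[R]_d.
Local Notation D := (cadlag R d).
Variables (P : probability Om R) (P' : probability Om' R)
  (Px : R.-pker E ~> D) (X : E -> {RV P' >-> D})
  (gamma eta : nat -> {posnum R}) (Xbar : {RV P >-> D})
  (Y : nat -> E -> {RV P' >-> D}) (nu0 : probability E R) (eps : R).
Hypothesis law_X : forall x A, measurable A -> distribution P' (X x) A = Px x A.
Hypothesis gamma_steps : steps gamma.
Hypothesis eta_oo : psum eta n @[n --> \oo] --> +oo.
Hypothesis Xbar_step : forall w, stepwise_constant gamma (Xbar w).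
Hypothesis eps1 : eps < 1.
Hypothesis nu_cvg :
  {ae P, forall w, weak_cvg (fun n => nu_marg gamma eta 0 n (Xbar w)) nu0}.
Hypothesis HC1 : C1 X.
Hypothesis HC2 : C2 gamma Xbar X Y.
Hypothesis HC3 : C3 gamma eta eps.

Local Notation Z := (fun n w => shifted gamma (Xbar w) n).

Lemma weak_avg w (f : E -> R) b :
  weak_cvg (fun n => nu_marg gamma eta 0 n (Xbar w)) nu0 ->
  continuous f -> (forall x, 0 <= f x <= b) ->
  avg eta (fun k => f (Z k w 0)) n @[n --> \oo] --> mean nu0 f.
Proof.
move=> W cf fb; have mf := continuous_measurable_rV cf.
have bf : bounded_fun f.
  exists b; split; first exact: num_real.
  move=> M bM x _ /=; have /andP[f0 fxb] := fb x.
  by rewrite ger0_norm// (le_trans fxb)// ltW.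
have brv : bounded_rv f.
  by split => //; exists b => x; have /andP[f0 fxb] := fb x; rewrite ger0_norm.
have := W f cf bf; rewrite /mcvg -(meanE nu0 brv).
by under eq_fun do rewrite integral_empirical//; move=> /fine_cvg.
Qed.

Let chi (r : R) (x : E) := Num.min 1 (Num.max 0 (`|x| - r)).

Let chi_continuous r : continuous (chi r).
Proof.
pose h (y : R) := Num.min 1 (Num.max 0 (y - r)).
have ch : continuous h.
  move=> y; apply: (@continuous_min R R (cst 1) (fun y => Num.max 0 (y - r))).
    exact: cvg_cst.
  apply: (@continuous_max R R (cst 0) (fun y => y - r)); first exact: cvg_cst.
  by apply: cvgB; [exact: cvg_id|exact: cvg_cst].
move=> x; have := @continuous_comp E R R _ h x
  (@norm_sub_continuous R d 0 x) (ch _).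
rewrite (_ : h \o _ = chi r)//.
by apply/funext => y; rewrite /= subr0.
Qed.

Let chi01 r x : 0 <= chi r x <= 1.
Proof. by rewrite /chi ge_min lexx le_min ler01 le_max lexx. Qed.

(** The mass of [nu0] far away is small, which transfers to the empirical measures
    through the continuous cutoffs [chi]. *)
Let chi_small e : 0 < e -> exists r, mean nu0 (chi r) <= e.
Proof.
move=> e0; have mchi r : measurable_fun setT (chi r).
  exact: continuous_measurable_rV (@chi_continuous r).
have chi1 (n : nat) x : `|chi n%:R x| <= 1.
  by have /andP[c0 c1] := chi01 n%:R x; rewrite ger0_norm.
have cv x : chi n%:R x @[n --> \oo] --> cst 0 x.
  apply: cvg_near_cst; exists (truncn `|x|).+1 => // n /= xn.
  rewrite /chi max_l ?min_r// subr_le0 ltW//.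
  by rewrite (lt_le_trans (truncnS_gt _))// ler_nat.
have cst01 (x : E) : `|cst 0 x : R| <= 1 by rewrite normr0.
have := @mean_cvg _ _ _ nu0 _ _ _ (fun n => mchi n%:R) (measurable_cst _) chi1 cst01
  (aeW _ cv).
move=> /cvgrPdist_le/(_ _ e0)[N _ /(_ N (leqnn _))] /=.
rewrite mean_cst sub0r normrN => H; exists N%:R.
exact: le_trans (ler_norm _) H.
Qed.

Section one_functional.
Variables (F : D -> R) (b S : R).
Hypothesis cF : continuous F.
Hypothesis F0b : forall a, 0 <= F a <= b.
Hypothesis S0 : 0 < S.
Let g := F \o stop S.

Let mg : measurable_fun setT g.
Proof.
apply: measurableT_comp; first exact: continuous_measurable_cadlag.
by apply: stop_measurable; exact: ltW.
Qed.

Let g0b a : 0 <= g a <= b. Proof. exact: F0b. Qed.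

Let gS a : g (stop S a) = g a.
Proof. by rewrite /g /= stop_idem. Qed.

Let Phi x := mean P' (fun w => g (X x w)).

Let b0 : 0 <= b.
Proof. by have /andP[] := F0b (cadlag_cst 0); exact: le_trans. Qed.

Let Phi0b x : 0 <= Phi x <= b.
Proof.
have bX : bounded_rv (fun w => g (X x w)).
  split; first exact: measurableT_comp.
  by exists b => w; have /andP[h1 h2] := g0b (X x w); rewrite ger0_norm.
rewrite /Phi mean_le_cst ?andbT//; last by move=> w; have /andP[] := g0b (X x w).
by apply: Rintegral_ge0 => w _; have /andP[] := g0b (X x w).
Qed.

Let Phi_cont : continuous Phi.
Proof. by case: HC2 => _ _ HY; exact: (Phi_continuous cF F0b S0 HC1 HY). Qed.

(** On a large ball the conditional means are uniformly close to the limit; the cutoff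
    shows that the scheme spends little time outside. *)
Let cond_gap w e :
  weak_cvg (fun n => nu_marg gamma eta 0 n (Xbar w)) nu0 -> 0 < e ->
  \forall n \near \oo,
    avg eta (fun k => `|cond Y g k (Z k w 0) - Phi (Z k w 0)|) n <= e.
Proof.
move=> W e0; have [_ _ HY] := HC2.
pose q := e / (4 * (b + 1)).
have q0 : 0 < q by rewrite divr_gt0// mulr_gt0// ltr_wpDl.
have bq : b * q <= e / 4.
  rewrite /q mulrA ler_pdivrMr ?mulr_gt0 ?ltr_wpDl//.
  have -> : e / 4 * (4 * (b + 1)) = e * b + e by field.
  by rewrite mulrC lerDl ltW.
have e4 : 0 < e / 4 by rewrite divr_gt0.
have [r Hr] := chi_small q0.
have [N _ HN] := cond_uniform cF F0b S0 HC1 HY (r + 1) e4.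
have [N1 _ HN1] := avg_head eta_oo (cst b) N e4.
have /cvgrPdist_le/(_ _ q0)[N2 _ HN2] := weak_avg W (@chi_continuous r) (chi01 r).
exists (maxn N1 N2).+1 => // -[//|n] /=; rewrite ltnS geq_max => /andP[n1 n2].
have h1 := HN1 n.+1 (leqW n1); have := HN2 n.+1 (leqW n2); rewrite /= ler_norml.
set ac := avg eta (fun k => chi r _) _ => /andP[h2 _].
apply: (@le_trans _ _ (avg eta (fun k => (if (k < N)%N then `|cst b k| else 0) +
    (e / 4 + b * chi r (Z k w 0))) n.+1)).
  apply: le_avg => k _; set z := Z k w 0.
  have cb : `|cond Y g k z - Phi z| <= b.
    have /andP[p0 pb] := Phi0b z.
    have c0 := cond_ge0 Y g0b k z; have cb := cond_le Y mg g0b k z.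
    by rewrite ler_norml; apply/andP; split; lra.
  have /andP[c0 c1] := chi01 r z.
  have bc0 : 0 <= b * chi r z by rewrite mulr_ge0.
  case: ltnP => kN.
    rewrite /cst (ger0_norm b0) (le_trans cb)// lerDl addr_ge0//.
    exact: ltW.
  have [zr|zr] := leP `|z| (r + 1).
    by rewrite add0r (le_trans (HN k kN z zr))// lerDl.
  have -> : chi r z = 1.
    by rewrite /chi min_l// le_max; apply/orP; right; lra.
  by rewrite add0r mulr1 (le_trans cb)// lerDr ltW.
rewrite avgD avgD avg_cst avgZ -/ac.
have : b * ac <= b * (q + q) by rewrite ler_wpM2l//; lra.
rewrite mulrDr; lra.
Qed.

Let mean_Phi : mean nu0 Phi = mean (path_law Px nu0) g.
Proof.
have bPhi : bounded_rv Phi.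
  split; first exact: continuous_measurable_rV Phi_cont.
  by exists b => x; have /andP[p0 pb] := Phi0b x; rewrite ger0_norm.
have bg : bounded_rv g.
  by split => //; exists b => a; have /andP[h1 h2] := g0b a; rewrite ger0_norm.
apply/EFin_inj; rewrite !meanE//.
have mEg : measurable_fun setT (EFin \o g) by exact/measurable_EFinP.
have g0' a : (0 <= (EFin \o g) a)%E by rewrite lee_fin; have /andP[] := g0b a.
rewrite (ge0_integral_mixture nu0 Px mEg g0').
apply: eq_integral => x _.
have -> : (\int[Px x]_y (EFin \o g) y = \int[distribution P' (X x)]_y (EFin \o g) y)%E.
  by apply: eq_measure_integral => A mA _; rewrite -law_X.
rewrite (ge0_integral_distribution _ mEg g0') meanE//.
split; first exact: measurableT_comp.
by exists b => w; have /andP[h1 h2] := g0b (X x w); rewrite ger0_norm.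
Qed.

(** The averages of the deviations from the conditional means vanish along sparse times
    by their second moments, which is enough for the averages of a nonnegative
    functional. *)
Lemma stopped_cvg : {ae P, forall w,
  avg eta (fun k => F (stop S (Z k w))) n @[n --> \oo]
    --> mean (path_law Px nu0) (F \o stop S)}.
Proof.
have [K [e [K0 e01 etaK]]] := C3_exponent eps1 HC3.
have e1 : 0 < 1 - e by rewrite subr_gt0; move/andP : e01 => [].
have [N [N1 Noo Nsum Nsp]] := sparse_times gamma_steps eta_oo K0 e01 etaK e1.
have [Hmarkov Hlaw _] := HC2.
pose dv k w := g (Z k w) - cond Y g k (Z k w 0).
have bdv k : bounded_rv (dv k) by exact: (bounded_dev Hlaw mg g0b).
pose Sq j w := (avg eta (fun k => dv k w) (N j)) ^+ 2.
pose c := b ^+ 2 * (K * (2 * S + (gamma 1)%:num)).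
have c0 : 0 <= c.
  by rewrite mulr_ge0 ?sqr_ge0// mulr_ge0 ?(ltW K0)// addr_ge0// mulr_ge0// ltW.
have fluct : {ae P, forall w, Sq j w @[j --> \oo] --> (0 : R)}.
  apply: (@ae_cvg0_summable _ _ _ P Sq (fun j => c * psum eta (N j) `^ (- (1 - e))) (c * 2)).
  - move=> j; apply: measurable_funX; apply: measurable_avg => i.
    by case: (bdv i).
  - by move=> j w; exact: sqr_ge0.
  - move=> j; have : (0 < N j)%N.
      rewrite lt0n; apply/negP => /eqP Nj; have := N1 j.
      by rewrite Nj psum0 leNgt ltr01.
    rewrite /Sq; case: (N j) => // n _; rewrite opprB.
    exact: (dev_avg_L2 gamma_steps Xbar_step Hmarkov Hlaw mg g0b (ltW S0) gS
      K0 e01 etaK).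
  - by move=> J; rewrite -mulr_sumr ler_wpM2l.
apply: filterS2 fluct nu_cvg => w Fw Ww.
pose z k := Z k w 0.
have cond_cvg : avg eta (fun k => cond Y g k (z k)) n @[n --> \oo] --> mean nu0 Phi.
  have Pc := weak_avg Ww Phi_cont Phi0b.
  apply/cvgrPdist_le => h h0; have h2 : 0 < h / 2 by rewrite divr_gt0.
  have /cvgrPdist_le/(_ _ h2) := Pc; apply: filterS2 (cond_gap Ww h2) => n g1 g2.
  rewrite (_ : _ - _ = (mean nu0 Phi - avg eta (fun k => Phi (z k)) n) -
    avg eta (fun k => cond Y g k (z k) - Phi (z k)) n); last by rewrite avgB; ring.
  rewrite (le_trans (ler_normB _ _))// [leRHS]splitr lerD//.
  exact: le_trans (ler_norm_avg _ _ _) g1.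
rewrite -/g -mean_Phi; apply: (avg_interp N1 Nsp) => [k|].
  by have /andP[] := g0b (Z k w).
apply/cvgrPdist_le => h h0; have h2 : 0 < h / 2 by rewrite divr_gt0.
have /cvgrPdist_le/(_ _ h2) [M _ HM] := cond_cvg.
have hh : 0 < (h / 2) ^+ 2 by rewrite exprn_gt0.
have /cvgrPdist_le/(_ _ hh) := Fw; apply: filterS2 (Noo M) => j Mj.
rewrite sub0r normrN /Sq normrX => sq.
have h1 : `|avg eta (fun k => dv k w) (N j)| <= h / 2.
  by rewrite -(@ler_pXn2r _ 2) ?nnegrE// ltW.
rewrite (_ : _ - _ = (mean nu0 Phi - avg eta (fun k => cond Y g k (z k)) (N j)) -
  avg eta (fun k => dv k w) (N j)); last by rewrite /dv avgB; ring.
rewrite (le_trans (ler_normB _ _))// [leRHS]splitr lerD//.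
exact: HM.
Qed.

End one_functional.

(** A countable family of functionals suffices, each of which only depends on the
    path up to some time. *)
Lemma bounded_cvg : {ae P, forall w, forall F : D -> R, continuous F -> bounded_fun F ->
  mcvg (fun n => nu_path gamma eta n (Xbar w)) (path_law Px nu0) F}.
Proof.
have cv (s : seq (@bump_code d)) : {ae P, forall w,
    avg eta (fun k => test s (Z k w)) n @[n --> \oo] --> mean (path_law Px nu0) (test s)}.
  have [S S0 sS] := @test_stop R d s; have [b sb] := @test_bounded R d s.
  have s0b a : 0 <= (test s a : R) <= b by rewrite test_ge0 sb.
  have := stopped_cvg (@test_continuous R d s) s0b S0.
  rewrite (_ : test s \o stop S = test s); last by apply/funext => a /=; rewrite sS.
  by apply: filterS => w; under eq_fun do under eq_fun do rewrite sS.
have : {ae P, forall w, forall n : nat, forall s : seq (@bump_code d), unpickle n = Some s ->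
    avg eta (fun k => test s (Z k w)) n @[n --> \oo] --> mean (path_law Px nu0) (test s)}.
  apply: ae_foralln => n; case: (unpickle n) => [s|]; last by apply: aeW.
  by apply: filterS (cv s) => w H _ [<-].
apply: filterS => w H F cF bF.
have Ht s := H (pickle s) s (pickleK s).
have mF := continuous_measurable_cadlag cF.
have brv : bounded_rv F.
  split => //; have [M [_ HM]] := bF; exists (`|M| + 1) => a; apply: HM => //.
  by rewrite (le_lt_trans (ler_norm M))// ltrDl.
rewrite /mcvg -meanE//; under eq_fun do rewrite integral_empirical//.
apply: cvg_EFin; first exact: nearW.
exact: test_determining Ht _ cF bF.
Qed.

Section moment_bound.
Variables (L : D -> R) (V : E -> R) (S c1 k : R).
Hypothesis mL : measurable_fun setT L.
Hypothesis L0 : forall a, 0 <= L a.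
Hypothesis S0 : 0 <= S.
Hypothesis LS : forall a, L (stop S a) = L a.
Hypothesis mV : measurable_fun setT V.
Hypothesis V0 : forall x, 0 <= V x.
Hypothesis c10 : 0 <= c1.
Hypothesis k01 : 0 < k < 1.
Hypothesis L_mean : forall n x, (1 <= n)%N ->
  (\int[P']_w (L (Y n x w))%:E <= (c1 * (1 + V x))%:E)%E.
Hypothesis V_avg : {ae P, forall w, exists M, forall n,
  avg eta (fun i => V (Z i w 0)) n <= M}.
Local Notation G := (psum gamma).
Local Notation H := (psum eta).

Let Vavg i (a : D) := avg eta (fun j => V (a (G j))) i.+1.

Let Vavg_measurable i : measurable_fun setT (Vavg i).
Proof.
apply: measurable_avg => j; apply: measurableT_comp => //.
exact: eval_measurable.
Qed.

(** The averages of [V] are bounded along almost every path, but not in mean. First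
    moments are therefore taken on the event that they have not exceeded [M] yet. *)
Let good M i : set D := [set a | Vavg i a <= M].

Let good_measurable M i : measurable (good M i).
Proof.
rewrite -[good M i]setTI; have := Vavg_measurable i.
by move/(_ measurableT `]-oo, M]%classic (measurable_itv _)); rewrite set_itvNyc.
Qed.

Let good_stop M i a : good M i (stop (G i) a) = good M i a.
Proof.
rewrite /good /= /Vavg /avg; congr (_ * _ <= _); apply: eq_bigr => j _.
by rewrite stopE min_l// psum_le// -ltnS.
Qed.

Let stage M i w := (0 < i)%:R * \1_(good M i) (Xbar w) * L (Z i w).

Let stage_ge0 M i w : 0 <= stage M i w.
Proof. by rewrite /stage !mulr_ge0// indicE. Qed.

Let mLZ i : measurable_fun setT (fun w => L (Z i w)).
Proof. by apply: (measurableT_comp mL); exact: shifted_measurable. Qed.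

Let mVZ i : measurable_fun setT (fun w => V (Z i w 0)).
Proof.
apply: (measurableT_comp mV).
by under eq_fun do rewrite shifted0; exact: Xbar_eval_measurable.
Qed.

Let mgood M i : measurable_fun setT (fun w => \1_(good M i) (Xbar w) : R).
Proof.
have m1 : measurable_fun setT (\1_(good M i) : D -> R) by exact: measurable_indic.
exact: (measurableT_comp m1).
Qed.

Let stage_measurable M i : measurable_fun setT (stage M i).
Proof. by apply: measurable_funM => //; apply: measurable_funM. Qed.

Let stage_bound M i w := c1 * (\1_(good M i) (Xbar w) * (1 + V (Z i w 0))).

Let stage_bound_ge0 M i w : 0 <= stage_bound M i w.
Proof. by rewrite /stage_bound !mulr_ge0// ?indicE// addr_ge0. Qed.

Let stage_bound_measurable M i : measurable_fun setT (stage_bound M i).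
Proof.
apply: measurable_funM => //; apply: measurable_funM => //.
exact: measurable_funD.
Qed.

Let stage_mean M i :
  (\int[P]_w (stage M i w)%:E <= \int[P]_w (stage_bound M i w)%:E)%E.
Proof.
have [Hmarkov Hlaw _] := HC2.
have bE w : setT w -> (0 <= (stage_bound M i w)%:E)%E by rewrite lee_fin.
case: i bE => [|i] bE.
  rewrite integral0_eq ?integral_ge0// => w _.
  by rewrite /stage ltnn !mul0r.
have markov := scheme_markov (steps_oo gamma_steps) Xbar_step Hmarkov Hlaw.
pose p (a : D) := (\1_(good M i.+1) a : R)%:E.
have mp : measurable_fun setT p by apply/measurable_EFinP; exact: measurable_indic.
have p0 a : (0 <= p a)%E by rewrite lee_fin indicE.
have mEL : measurable_fun setT (EFin \o L) by exact/measurable_EFinP.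
have EL0 a : (0 <= (EFin \o L) a)%E by rewrite lee_fin.
have pE w : p (stop (G i.+1) (Xbar w)) = p (Xbar w).
  by rewrite /p !indicE; congr ((nat_of_bool _)%:R)%:E; apply/idP/idP; rewrite !inE good_stop.
rewrite (eq_integral (fun w => p (stop (G i.+1) (Xbar w)) * (EFin \o L) (Z i.+1 w))%E);
  last by move=> w _; rewrite pE /stage mul1r.
rewrite (markov _ _ _ mp p0 mEL EL0).
apply: le_integral_majorant => w.
  by rewrite mule_ge0 ?integral_ge0.
rewrite pE /stage_bound mulrCA EFinM; apply: lee_wpmul2l => //.
exact: L_mean.
Qed.

Let stage_avg M n : 0 <= M ->
  (\int[P]_w (avg eta (fun i => stage M i w) n)%:E <= (c1 * (1 + M))%:E)%E.
Proof.
move=> M0; apply: (@le_trans _ _ (\int[P]_w (avg eta (fun i => stage_bound M i w) n)%:E)%E).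
  by apply: le_integral_avg => // i; exact: stage_mean.
rewrite -[leRHS]mule1 -(@probability_setT _ _ _ P) -integral_cst//.
apply: le_integral_majorant => w; first by rewrite lee_fin avg_ge0.
rewrite lee_fin avgZ ler_wpM2l//.
apply: (@le_trans _ _ (avg eta (fun i => 1 + (if avg eta (fun j => V (Z j w 0)) i.+1 <= M
    then V (Z i w 0) else 0)) n)).
  apply: le_avg => i _; have -> : avg eta (fun j => V (Z j w 0)) i.+1 = Vavg i (Xbar w).
    by congr avg; apply/funext => j; rewrite shifted0.
  rewrite indicE; have [h|h] := boolP (_ <= M).
    by rewrite mem_set// mul1r.
  by rewrite memNset ?mul0r ?addr0//; apply/negP.
rewrite avgD lerD ?stopped_sum//.
by apply: avg_le_cst.
Qed.

(** The function [L ^ k] is split at a level [b] that grows with the number of steps.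
    Up to the level, its averages differ from those of the conditional means by
    fluctuations with small second moments. Above it, the factor [b ^ (k - 1)] makes the first moments
    summable along sparse times. *)
Lemma moment_bound : {ae P, forall w, exists M, \forall n \near \oo,
  avg eta (fun i => L (Z i w) `^ k) n <= M}.
Proof.
have [K [e [K0 e01 etaK]]] := C3_exponent eps1 HC3.
have [e0 e1] := andP e01; have [k0 k1] := andP k01.
(* [c] makes [b ^+ 2 * H `^ (e - 1)] decay, and [delta] is the decay of [b `^ (k - 1)] *)
pose c := (1 - e) / 4; pose delta := c * (1 - k).
have c0 : 0 < c by rewrite divr_gt0// subr_gt0.
have delta0 : 0 < delta by rewrite mulr_gt0// subr_gt0.
have [N [N1 Noo Nsum Nsp]] := sparse_times gamma_steps eta_oo K0 e01 etaK delta0.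
have [Hmarkov Hlaw _] := HC2.
pose b j := H (N j) `^ c.
have b1 j : 1 <= b j.
  by rewrite -[leLHS](powRr0 (H (N j))) ler_powR// ltW.
pose g j a := Num.min (L a) (b j).
have g0b j a : 0 <= g j a <= b j.
  by rewrite /g le_min L0 (le_trans ler01 (b1 j))//= ge_min lexx orbT.
have mg j : measurable_fun setT (g j) by exact: measurable_minr.
have gS j a : g j (stop S a) = g j a by rewrite /g LS.
pose dv j i w := g j (Z i w) - cond Y (g j) i (Z i w 0).
have bdv j i : bounded_rv (dv j i) by exact: (bounded_dev Hlaw (mg j) (g0b j)).
pose q := K * (2 * S + (gamma 1)%:num).
have q0 : 0 <= q by rewrite mulr_ge0 ?(ltW K0)// addr_ge0// mulr_ge0.
have Npos j : (0 < N j)%N.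
  rewrite lt0n; apply/negP => /eqP Nj; have := N1 j.
  by rewrite Nj psum0 leNgt ltr01.
have fluct : {ae P, forall w,
    (avg eta (fun i => dv j i w) (N j)) ^+ 2 @[j --> \oo] --> (0 : R)}.
  apply: (@ae_cvg0_summable _ _ _ P (fun j w => (avg eta (fun i => dv j i w) (N j)) ^+ 2)
    (fun j => q * H (N j) `^ (- delta)) (q * 2)).
  - move=> j; apply: measurable_funX; apply: measurable_avg => i.
    by case: (bdv j i).
  - by move=> j w; exact: sqr_ge0.
  - move=> j; apply: (@le_trans _ _ ((b j) ^+ 2 * q * H (N j) `^ (e - 1))%:E).
      case: (N j) (Npos j) => // n _.
      exact: (dev_avg_L2 gamma_steps Xbar_step Hmarkov Hlaw (mg j) (g0b j) S0 (gS j)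
        K0 e01 etaK).
    rewrite lee_fin mulrAC [leRHS]mulrC ler_wpM2r// /b -powR_mulrn ?powR_ge0//.
    rewrite -powRrM -powRD; last by rewrite (gt_eqF (lt_le_trans ltr01 (N1 j))) /= implybT.
    rewrite ler_powR// /delta /c; nra.
  - by move=> J; rewrite -mulr_sumr ler_wpM2l.
have large : {ae P, forall w, forall M : nat,
    b j `^ (k - 1) * avg eta (fun i => stage M%:R i w) (N j) @[j --> \oo] --> (0 : R)}.
  apply: ae_foralln => M.
  apply: (@ae_cvg0_summable _ _ _ P
    (fun j w => b j `^ (k - 1) * avg eta (fun i => stage M%:R i w) (N j))
    (fun j => c1 * (1 + M%:R) * H (N j) `^ (- delta)) (c1 * (1 + M%:R) * 2)).
  - by move=> j; apply: measurable_funM => //; exact: measurable_avg.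
  - by move=> j w; rewrite mulr_ge0 ?powR_ge0// avg_ge0.
  - move=> j; have mE : measurable_fun setT
        (fun w => (avg eta (fun i => stage M%:R i w) (N j))%:E).
      by apply/measurable_EFinP; exact: measurable_avg.
    have E0 w : setT w -> (0 <= (avg eta (fun i => stage M%:R i w) (N j))%:E)%E.
      by move=> _; rewrite lee_fin avg_ge0.
    under eq_integral do rewrite EFinM.
    rewrite (ge0_integralZl_EFin P measurableT E0 mE (powR_ge0 _ _)).
    rewrite [X in (_ <= X%:E)%E]mulrC EFinM /b -powRrM.
    rewrite (_ : - delta = c * (k - 1)); last by rewrite /delta; ring.
    by apply: lee_wpmul2l; [rewrite lee_fin powR_ge0|exact: stage_avg].
  - by move=> J; rewrite -mulr_sumr ler_wpM2l// mulr_ge0// addr_ge0.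
apply: filterS3 fluct large V_avg => w Fw Lw [M0 VM].
have [M VM'] : exists M : nat, forall n, avg eta (fun i => V (Z i w 0)) n <= M%:R.
  by exists (truncn M0).+1 => n; rewrite (le_trans (VM n))// ltW// truncnS_gt.
pose e1' := (eta 1)%:num; have e1'0 : 0 <= e1' by rewrite /e1'.
suff [B HB] : exists B, \forall j \near \oo, avg eta (fun i => L (Z i w) `^ k) (N j) <= B.
  by exists (2 * B); apply: (avg_interp_bound N1 Nsp) => // i; exact: powR_ge0.
exists (1 + (1 + (e1' + c1 * (1 + M%:R))) + (e1' * L (Z 0 w) + 1)).
have /cvgrPdist_le/(_ _ ltr01) := Fw; have /cvgrPdist_le/(_ _ ltr01) := Lw M.
apply: filterS2 => j; rewrite !sub0r !normrN => large1 small1.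
have Hj : 0 < H (N j) by rewrite (lt_le_trans ltr01).
have b0 : 0 <= b j by rewrite (le_trans ler01).
(* the moment hypothesis does not cover the process of index 0 *)
have head x : avg eta (fun i => if i == 0%N then x else 0) (N j) = e1' * x / H (N j).
  rewrite /avg; case: (N j) (Npos j) => // n _.
  by rewrite big_ord_recl big1 ?addr0 1?mulrC// => i _; rewrite mulr0.
apply: (@le_trans _ _ (avg eta (fun i => 1 + Num.min (L (Z i w)) (b j) +
    b j `^ (k - 1) * L (Z i w)) (N j))).
  by apply: le_avg => i _; apply: powR_truncate => //; rewrite !ltW.
rewrite avgD avgD avgZ; apply: lerD; first (apply: lerD; first exact: avg_le_cst).
- rewrite (_ : avg _ _ _ = avg eta (fun i => dv j i w) (N j) +
      avg eta (fun i => cond Y (g j) i (Z i w 0)) (N j)); last by rewrite /dv avgB subrK.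
  apply: lerD.
    apply: le_trans (ler_norm _) _; move: small1; rewrite normrX.
    by rewrite -[X in _ <= X](expr1n _ 2) ler_pXn2r// nnegrE.
  apply: (@le_trans _ _ (avg eta (fun i => (if i == 0%N then b j else 0) +
      c1 * (1 + V (Z i w 0))) (N j))).
    apply: le_avg => i _; have [->|i0] := eqVneq i 0%N.
      rewrite (le_trans (cond_le Y (mg j) (g0b j) _ _))// lerDl mulr_ge0//.
      by rewrite addr_ge0.
    rewrite add0r -lee_fin (condE Y (mg j) (g0b j)).
    have i1 : (1 <= i)%N by rewrite lt0n.
    apply: (le_trans _ (L_mean _ i1)).
    apply: le_integral_majorant => w'; rewrite lee_fin.
      by case/andP: (g0b j (Y i (Z i w 0) w')).
    by rewrite /g ge_min lexx.
  rewrite avgD head avgZ avgD; apply: lerD.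
    rewrite -mulrA ler_piMr// ler_pdivrMr// mul1r.
    rewrite -[leRHS]powRr1 ?(ltW Hj)// ler_powR// /c; lra.
  by rewrite ler_wpM2l// lerD// avg_le_cst.
apply: (@le_trans _ _ (b j `^ (k - 1) * (e1' * L (Z 0 w) / H (N j) +
    avg eta (fun i => stage M%:R i w) (N j)))).
  rewrite ler_wpM2l ?powR_ge0// -head -avgD; apply: le_avg => i _ /=.
  have [->|i0] := eqVneq i 0%N; first by rewrite lerDl.
  rewrite add0r /stage lt0n i0 mul1r indicE mem_set ?mul1r//=.
  rewrite /good /= (le_trans _ (VM' i.+1))// /Vavg; apply: le_avg => l _.
  by rewrite shifted0.
rewrite mulrDr lerD//; last exact: le_trans (ler_norm _) _.
have bk : b j `^ (k - 1) <= 1.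
  by rewrite -[leRHS](powRr0 (b j)) ler_powR// subr_le0 ltW.
rewrite (le_trans (ler_piMl _ bk))// ?mulr_ge0 ?invr_ge0 ?(ltW Hj)//.
by rewrite ler_piMr ?mulr_ge0// invf_le1.
Qed.

End moment_bound.

Section dominated_functional.
Variables (F : D -> R) (T : R).
Hypothesis cF : continuous F.
Hypothesis T0 : 0 < T.

(** Bounded truncations of [F] are covered by the convergence for bounded functionals. *)
Let truncation_cvg (h : R -> R) b : continuous h -> (forall y, 0 <= h y <= b) ->
  {ae P, forall w, avg eta (fun k => h (F (stop T (Z k w)))) n @[n --> \oo]
    --> mean (path_law Px nu0) (fun a => h (F (stop T a)))}.
Proof.
move=> ch hb; have chF : continuous (h \o F).
  by move=> x; exact: (@continuous_comp D R R F h x (@cF x) (@ch (F x))).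
exact: (stopped_cvg chF (fun a => hb (F a)) T0).
Qed.

Let abs_cvg : {ae P, forall w, forall K : nat,
  avg eta (fun k => Num.min `|F (stop T (Z k w))| K%:R) n @[n --> \oo]
    --> mean (path_law Px nu0) (fun a => Num.min `|F (stop T a)| K%:R)}.
Proof.
apply: ae_foralln => K; apply: (@truncation_cvg (fun y => Num.min `|y| K%:R) K%:R).
  move=> y; apply: (@continuous_min R R (fun y => `|y|) (cst K%:R)).
    exact: norm_continuous.
  exact: cvg_cst.
by move=> y; rewrite le_min normr_ge0 ler0n ge_min lexx orbT.
Qed.

Let truncate_cvg : {ae P, forall w, forall K : nat,
  avg eta (fun k => truncate K%:R (F (stop T (Z k w)))) n @[n --> \oo]
    --> mean (path_law Px nu0) (fun a => truncate K%:R (F (stop T a)))}.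
Proof.
apply: ae_foralln => K; pose h y := truncate K%:R y + K%:R : R.
have ct : continuous (truncate K%:R : R -> R).
  move=> y; apply: (@continuous_max R R (cst (- K%:R)) (fun y => Num.min y K%:R)).
    exact: cvg_cst.
  by apply: (@continuous_min R R id (cst K%:R)); [exact: cvg_id|exact: cvg_cst].
have ch : continuous h by move=> y; apply: cvgD; [exact: ct|exact: cvg_cst].
have tK y : - K%:R <= (truncate K%:R y : R) <= K%:R.
  rewrite /truncate le_max lexx ge_max ge_min lexx orbT andbT /=.
  by rewrite (le_trans _ (ler0n _ K))// oppr_le0.
have hb y : 0 <= h y <= K%:R + K%:R.
  by have /andP[t1 t2] := tK y; rewrite /h; apply/andP; split; lra.
have brv : bounded_rv (fun a : D => truncate K%:R (F (stop T a))).
  split; last by exists K%:R => a; rewrite ler_norml.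
  apply: measurable_maxr => //; apply: measurable_minr => //.
  apply: measurableT_comp; first exact: continuous_measurable_cadlag.
  exact: stop_measurable (ltW T0).
apply: filterS (truncation_cvg ch hb) => w.
rewrite /h meanD ?mean_cst//; last exact: bounded_rv_cst.
move=> H; have K_cvg : avg eta (cst K%:R) n @[n --> \oo] --> (K%:R : R).
  by apply: cvg_near_cst; exists 1%N => // -[//|n] _; rewrite avg_cst.
have := cvgB H K_cvg; rewrite addrK => HK.
rewrite (_ : (fun n => _) = (fun n =>
  avg eta (fun k => truncate K%:R (F (stop T (Z k w))) + K%:R) n - avg eta (cst K%:R) n)).
  exact: HK.
by apply/funext => n; rewrite avgD addrK.
Qed.

Variables (V : E -> R) (s rho C : R).
Hypothesis cV : continuous V.
Hypothesis V0 : forall x, 0 <= V x.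
Hypothesis s1 : 1 <= s.
Hypothesis HV : H_cond gamma eta Xbar Y s eps V.
Hypothesis rho01 : 0 <= rho < 1.
Hypothesis F_dominated : forall a,
  (`|F (stop T a)|%:E <= C%:E * sup_on T (fun t => V (a t) `^ rho)%R)%E.

Let mf : measurable_fun setT (fun a : D => F (stop T a)).
Proof.
apply: measurableT_comp; first exact: continuous_measurable_cadlag.
exact: stop_measurable (ltW T0).
Qed.

Let V_avg : {ae P, forall w, exists M, forall n, avg eta (fun i => V (Z i w 0)) n <= M}.
Proof.
have [_ H _ _] := HV; apply: filterS H => w; set S := ereal_sup _ => Soo.
have mV := continuous_measurable_rV cV.
have avgS n : ((avg eta (fun i => V (Z i w 0)) n.+1)%:E <= S)%E.
  apply: ereal_sup_ubound; exists n.+1 => //.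
  by rewrite integral_empirical.
have S0 : (0 <= S)%E by rewrite (le_trans _ (avgS 0%N))// lee_fin avg_ge0.
have Sfin : S \is a fin_num by rewrite ge0_fin_numE.
exists (fine S) => -[|n]; first by rewrite avg0 fine_ge0.
by rewrite -lee_fin fineK.
Qed.

Let L_mean r : 1 <= r -> rho * r <= 1 -> exists2 c1, 0 <= c1 & forall n x, (1 <= n)%N ->
  (\int[P']_w (`|F (stop T (Y n x w))| `^ r)%:E <= (c1 * (1 + V x))%:E)%E.
Proof.
move=> r1 rr1; have [[Cs [_ HCs]] _ _ _] := HV.
have [rho0 _] := andP rho01; have r0 : 0 <= r by rewrite (le_trans ler01).
pose A := (`|C| + 1) `^ r; have A0 : 0 < A by rewrite powR_gt0// ltr_wpDl.
exists (A * (2 + `|Cs T|)); first by rewrite mulr_ge0 ?(ltW A0)// addr_ge0.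
move=> n x n1; pose v := 1 + V x.
have v1 : 1 <= v by rewrite /v lerDl.
have v0 : 0 < v by rewrite (lt_le_trans ltr01).
have sup_mean : (\int[P']_w sup_on T (fun t => V (Y n x w t) `^ s)%R <=
    (`|Cs T| * v `^ s)%:E)%E.
  apply: (@le_trans _ _ (Cs T * V x `^ s)%:E).
    by apply: le_trans (HCs _ T0 x); apply: ereal_sup_ubound; exists n.
  rewrite lee_fin (le_trans (ler_norm _))// normrM (ger0_norm (powR_ge0 _ _)).
  rewrite ler_wpM2l//; apply: ge0_ler_powR; rewrite ?nnegrE ?(ltW v0)//.
    by rewrite (le_trans ler01).
  by rewrite /v lerDr.
have mFY : measurable_fun setT (fun w => `|F (stop T (Y n x w))| `^ r).
  have mp : measurable_fun setT (fun y : R => `|y| `^ r).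
    exact: (measurableT_comp (measurable_powR r) (@normr_measurable R setT)).
  exact: (measurableT_comp mp (measurableT_comp mf _)).
have := integral_affine_majorant mFY (fun w => sup_powR_ge0 V (ltW T0) s (Y n x w))
  (a := A * (1 + v)) (b := A * v `^ (1 - s)) _ _ _ sup_mean.
rewrite mulr_ge0 ?(ltW A0) ?addr_ge0 ?(ltW v0)// mulr_gt0 ?powR_gt0// => /(_ isT isT).
rewrite (_ : A * v `^ (1 - s) * (`|Cs T| * v `^ s) = A * `|Cs T| * v); last first.
  rewrite mulrACA -[LHS]mulrA [_ * v `^ s]mulrC -mulrA -powRD; last first.
    by rewrite (gt_eqF v0) /= implybT.
  by rewrite addrCA subrr addr0 powRr1 ?(ltW v0)// mulrA.
move=> H; apply: (le_trans (H _)).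
  by move=> w; exact: (powR_dominated (ltW T0) V0 s1 rho0 r0 rr1 v0).
rewrite lee_fin -/v -!mulrA -mulrDr ler_wpM2l ?(ltW A0)//.
by rewrite [leRHS]mulrDl; lra.
Qed.

(** The exponent [r] makes the conditional moments of [|F| ^ r] linear in [V], the
    exponent [k] is lost in the almost sure bound, and [r * k > 1] is what remains for
    uniform integrability. *)
Lemma dominated_cvg :
  (path_law Px nu0).-integrable setT (EFin \o (F \o stop T)) /\
  {ae P, forall w, mcvg (fun n => nu_path gamma eta n (Xbar w)) (path_law Px nu0)
    (F \o stop T)}.
Proof.
have [rho0 rho1] := andP rho01.
pose r := 2 / (1 + rho); pose k := (3 + rho) / 4.
have rho_pos : 0 < 1 + rho by rewrite ltr_wpDr.
have r1 : 1 <= r by rewrite ler_pdivlMr// mul1r; lra.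
have rr1 : rho * r <= 1 by rewrite /r mulrA ler_pdivrMr// mul1r; lra.
have k01 : 0 < k < 1 by rewrite /k; apply/andP; split; lra.
have q1 : 1 < r * k.
  rewrite /r /k mulrAC ltr_pdivlMr// mul1r; lra.
have [c1 c10 Lm] := L_mean r1 rr1.
pose L a := `|F (stop T a)| `^ r.
have mL : measurable_fun setT L.
  have mp : measurable_fun setT (fun y : R => `|y| `^ r).
    exact: (measurableT_comp (measurable_powR r) (@normr_measurable R setT)).
  exact: (measurableT_comp mp mf).
have LS a : L (stop T a) = L a by rewrite /L stop_idem.
have bound := moment_bound mL (fun a => powR_ge0 _ _) (ltW T0)
  LS (continuous_measurable_rV cV) V0 c10 k01 Lm V_avg.
have all3 : {ae P, forall w, (path_law Px nu0).-integrable setT (EFin \o (F \o stop T)) /\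
    avg eta (fun k => F (stop T (Z k w))) n @[n --> \oo]
      --> mean (path_law Px nu0) (fun a => F (stop T a))}.
  apply: filterS3 abs_cvg truncate_cvg bound => w Aw Tw [M HM].
  have Mq : exists M, \forall n \near \oo,
      avg eta (fun i => `|F (stop T (Z i w))| `^ (r * k)) n <= M.
    exists M; rewrite (_ : (fun i => _) = fun i => L (Z i w) `^ k)//.
    by apply/funext => i; rewrite powRrM.
  split; first exact: (limit_integrable q1 mf Aw Mq).
  exact: (uniformly_integrable_cvg q1 mf Aw Tw Mq).
have ae_proper : ProperFilter (almost_everywhere P).
  apply: ae_properfilter_algebraOfSetsType.
  by rewrite -[X in (_ < X)%E]/(P setT) probability_setT.
have [w0 [int _]] := filter_ex all3; split => //.
apply: filterS all3 => w [_ H]; rewrite /mcvg.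
have -> : (\int[path_law Px nu0]_a ((F \o stop T) a)%:E)%E =
    (mean (path_law Px nu0) (fun a => F (stop T a)))%:E.
  by rewrite /mean /Rintegral fineK//; exact: integrable_fin_num int.
under eq_fun do rewrite integral_empirical//.
by apply: cvg_EFin; first exact: nearW.
Qed.

End dominated_functional.

End almost_sure_convergence.

Theorem theorem1 (R : realType) (d : nat)
  (dO dO' : measure_display)
  (Omega : measurableType dO) (P : probability Omega R)
  (Omega' : measurableType dO') (P' : probability Omega' R)
  (Px : R.-pker 'rV[R]_d ~> cadlag R d)
  (X : 'rV[R]_d -> {RV P' >-> cadlag R d})
  (gamma eta : nat -> {posnum R})
  (xinit : 'rV[R]_d) (Xbar : {RV P >-> cadlag R d})
  (Y : nat -> 'rV[R]_d -> {RV P' >-> cadlag R d})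
  (nu0 : probability 'rV[R]_d R) (eps : R)
  (HPx : markov_family Px) (HFeller : feller Px)
  (HX : forall x A, measurable A -> distribution P' (X x) A = Px x A)
  (Hgamma : steps gamma)
  (Heta : psum eta n @[n --> \oo] --> +oo)
  (HXbar0 : forall w, Xbar w 0 = xinit)
  (HXbar : forall w, stepwise_constant gamma (Xbar w))
  (Heps : eps < 1)
  (HC01 : C01 Px gamma eta Xbar nu0)
  (HC1 : C1 X)
  (HC2 : C2 gamma Xbar X Y)
  (HC3 : C3 gamma eta eps) :
  {ae P, forall w, forall F : cadlag R d -> R, continuous F -> bounded_fun F ->
     mcvg (fun n => nu_path gamma eta n (Xbar w)) (path_law Px nu0) F} /\
  (forall (T : R) (F : cadlag R d -> R), 0 < T -> continuous F ->
     (exists (V : 'rV[R]_d -> R) (rho C : R),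
        [/\ class_K gamma eta Xbar Y eps V, 0 <= rho < 1 &
            forall a : cadlag R d,
              (`|F (stop T a)|%:E <=
                 C%:E * sup_on T (fun t => V (a t) `^ rho)%R)%E]) ->
     (path_law Px nu0).-integrable setT (EFin \o (F \o stop T)) /\
     {ae P, forall w,
        mcvg (fun n => nu_path gamma eta n (Xbar w)) (path_law Px nu0)
          (F \o stop T)}).
Proof.
have [_ nu_cvg] := HC01; split.
  exact: (bounded_cvg HX Hgamma Heta HXbar Heps nu_cvg HC1 HC2 HC3).
move=> T F T0 cF [V [rho [C [[cV V0 [s s2 HV]] rho01 dom]]]].
have s1 : 1 <= s by rewrite (le_trans _ s2)// ler1n.
exact: (dominated_cvg HX Hgamma Heta HXbar Heps nu_cvg HC1 HC2 HC3 cF T0 cV V0 s1 HV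
  rho01 dom).
Qed.
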